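(* Let $\Omega\subset\mathbb{R}^2$ be a bounded domain with smooth boundary, let $V\in C^1(\overline{\Omega})$ be positive, let $\lambda_k\downarrow 0$, and let $v_k$ be solutions of $-\Delta v_k=\lambda_k V e^{v_k}$ in $\Omega$, $v_k=0$ on $\partial\Omega$, with $\|v_k\|_{L^\infty(\Omega)}\to+\infty$, $\int_\Omega \lambda_k V e^{v_k}\to 8\pi m$ for a positive integer $m$, and blow-up set $\mathcal{S}=\{x_1^\ast,\ldots,x_m^\ast\}\subset\Omega$ (as described in the context). Then for each $n=1,\ldots,m$ and for some subsequence of $\{w_k^n\}_k$, $$\tilde w_{j,k}^n(x)=w_k^n(x_{j,k})+\mu_k^nc_j^nU(x)+o(\mu_k^n),\qquad 1\le j\le m,$$ locally uniformly in $x\in\mathbb{R}^2$, where $$U(x)=\log\frac{1}{\left(1+\frac18|x|^2\right)^2}$$ and $w_k^n,\mu_k^n,x_{j,k},\tilde w_{j,k}^n,c_j^n$ are as described in the context.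
   Context: Green function: $G=G(x,y)$ satisfies $-\Delta G(\cdot,y)=\delta_y$ in $\Omega$, $G(\cdot,y)=0$ on $\partial\Omega$. Blow-up set: $\mathcal{S}=\{x_0\in\overline{\Omega}: \exists\{x_k\}\subset\Omega,\ x_k\to x_0,\ v_k(x_k)\to+\infty\}$. It is known that, after passing to a subsequence (fixed once and for all and still denoted by $v_k$), $\mathcal{S}$ consists of $m$ distinct points $x_1^\ast,\ldots,x_m^\ast\in\Omega$ and $v_k\to 8\pi\sum_{j=1}^m G(\cdot,x_j^\ast)$ locally uniformly in $\overline{\Omega}\setminus\mathcal{S}$. Local maxima and scaling: fix a small radius $R>0$ such that $B_{2R}(x_j^\ast)\subset\subset\Omega$ for all $j$ and the balls $B_R(x_j^\ast)$ are pairwise disjoint. Choose $x_{j,k}\in B_R(x_j^\ast)$ with $v_k(x_{j,k})=\sup_{B_R(x_{j,k})}v_k\to+\infty$ and $x_{j,k}\to x_j^\ast$. Define $\delta_{j,k}>0$ by $\lambda_kV(x_{j,k})e^{v_k(x_{j,k})}\delta_{j,k}^2=1$; then $\delta_{j,k}\to0$. Linearized eigenvalue problem: $\mu_k^n$ ($0<\mu_k^1<\mu_k^2\le\mu_k^3\le\cdots$) is the $n$-th eigenvalue (counted with multiplicity), and $w_k^n$ a corresponding eigenfunction, of $-\Delta w=\mu\lambda_kVe^{v_k}w$ in $\Omega$, $w=0$ on $\partial\Omega$, normalized by $\|w_k^n\|_{L^\infty(\Omega)}=\max_{\overline{\Omega}}w_k^n=1$ and with $\int_\Omega\nabla w_k^i\cdot\nabla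 w_k^j=0$ for $i\ne j$. Put $\tilde w_{j,k}^n(\tilde x)=w_k^n(\delta_{j,k}\tilde x+x_{j,k})$ for $\tilde x\in B_{R/\delta_{j,k}}(0)$. Limit vectors: it is known that $\mu_k^n\to0$ for $1\le n\le m$ and that, after passing to a subsequence, there exist $\boldsymbol{c}^n=(c_1^n,\ldots,c_m^n)\in\mathbb{R}^m\setminus\{\boldsymbol 0\}$, $1\le n\le m$, with $|c_j^n|\le1$, $\tilde w_{j,k}^n\to c_j^n$ locally uniformly in $\mathbb{R}^2$, $\boldsymbol c^i\cdot\boldsymbol c^{i'}=0$ for $i\ne i'$, and $w_k^n/\mu_k^n\to8\pi\sum_{j=1}^mc_j^nG(\cdot,x_j^\ast)$ uniformly in $\overline{\Omega}\setminus\bigcup_{j=1}^mB_R(x_{j,k})$. The numbers $c_j^n$ in the claim are those obtained along such a subsequence. *)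

(* Defs.v *)
(* The plane is [R * R] for an arbitrary [R : realType]. *)
From HB Require Import structures.
From mathcomp Require Import all_boot all_order all_algebra.
From mathcomp Require Import all_classical all_reals all_analysis.

Set Implicit Arguments.
Unset Strict Implicit.
Unset Printing Implicit Defensive.

Import Order.TTheory GRing.Theory Num.Theory.
Import numFieldNormedType.Exports.

Local Open Scope classical_set_scope.
Local Open Scope ring_scope.

Section Plane.
Context {R : realType}.
Implicit Types (A W Omega : set (R * R)) (f g u q : R * R -> R).

Definition mu2 : {measure set (measurableTypeR R * measurableTypeR R) -> \bar R}
  := ((@lebesgue_measure R) \x (@lebesgue_measure R))%E.

(* The library's norm and [ball] on [R * R] are those of the max norm. *)
Definition dotp (a b : R * R) : R := a.1 * b.1 + a.2 * b.2.
Definition enorm (a : R * R) : R := Num.sqrt (dotp a a).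
Definition eball (a : R * R) (r : R) : set (R * R) :=
  [set x | enorm (x - a) < r].

Definition e1 : R * R := (1, 0).
Definition e2 : R * R := (0, 1).
Definition grad f (x : R * R) : R * R := ('D_e1 f x, 'D_e2 f x).
Definition laplacian f (x : R * R) : R :=
  'D_e1 ('D_e1 f) x + 'D_e2 ('D_e2 f) x.

(* f is of class C^n on A; only meant for open A. *)
Fixpoint Ck (n : nat) A f : Prop :=
  (forall x, A x -> {for x, continuous f}) /\
  if n is p.+1 then
    (forall x, A x -> derivable f x e1 /\ derivable f x e2) /\
    Ck p A ('D_e1 f) /\ Ck p A ('D_e2 f)
  else True.

Definition smooth A f : Prop := forall n, Ck n A f.

(* f belongs to C^1(closure Omega): f is continuous on the closure, C^1 in
   Omega, and its first partials extend continuously to the closure. *)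
Definition C1_closure Omega f : Prop :=
  [/\ Ck 1 Omega f,
      {within closure Omega, continuous f}
    & exists g1 g2 : R * R -> R,
      [/\ {within closure Omega, continuous g1},
          {within closure Omega, continuous g2}
        & forall x, Omega x -> grad f x = (g1 x, g2 x)]].

(* For open Omega, this is the topological boundary. *)
Definition bdry Omega : set (R * R) := closure Omega `\` Omega.

(* Bounded domain with C^infinity boundary, by local defining functions. *)
Definition smooth_bounded_domain Omega : Prop :=
  [/\ Omega !=set0, open Omega, connected Omega, bounded_set Omega
    & forall p, bdry Omega p -> exists W (rho : R * R -> R),
      [/\ open W, W p, smooth W rho,
          forall x, W x -> grad rho x != 0
        & Omega `&` W = W `&` [set x | rho x < 0]]].

(* u is a classical solution of - Delta u = f in Omega, u = 0 on the boundary. *)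
Definition dirichlet_solution Omega f u : Prop :=
  [/\ Ck 2 Omega u, {within closure Omega, continuous u},
      forall x, Omega x -> - laplacian u x = f x
    & forall x, bdry Omega x -> u x = 0].

Definition test_function Omega (phi : R * R -> R) : Prop :=
  smooth setT phi /\
  exists K, [/\ compact K, K `<=` Omega & forall x, ~ K x -> phi x = 0].

(* - Delta G(., y) = delta_y in the sense of distributions in Omega.  The
   boundary condition is understood with G(., y) continuous on the closure
   minus {y}; this makes G(x, y) unique for x <> y, and its value on the
   diagonal is irrelevant. *)
Definition green_function Omega (G : R * R -> R * R -> R) : Prop :=
  forall y, Omega y ->
    [/\ forall K, compact K -> K `<=` Omega ->
          mu2.-integrable K (EFin \o (G ^~ y)),
        forall phi, test_function Omega phi ->
          (\int[mu2]_(x in Omega) (G x y * - laplacian phi x)%:E = (phi y)%:E)%E,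
        {within closure Omega `\ y, continuous (G ^~ y)}
      & forall x, bdry Omega x -> G x y = 0].

Definition blowup_set Omega (v : nat -> R * R -> R) : set (R * R) :=
  [set x0 | closure Omega x0 /\
    exists x : nat -> R * R,
      [/\ forall k, Omega (x k), x k @[k --> \oo] --> x0
        & v k (x k) @[k --> \oo] --> +oo%R]].

(* Locally uniform convergence on A: uniform on every compact subset of A. *)
Definition loc_unif_cvg A (f : nat -> R * R -> R) g : Prop :=
  {family (fun K => compact K /\ K `<=` A), f @ \oo --> g}.

(* L^infinity(Omega) norm: f is extended by 0 outside Omega. *)
Definition Linfty_norm Omega f : \bar R := ('N[mu2]_+oo [EFin \o (f \_ Omega)])%E.

Definition eigenspace Omega q (t : R) : set (R * R -> R) :=
  [set u | dirichlet_solution Omega (fun x => t * q x * u x) u].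

(* E has dimension d, its elements being identified when they agree on the
   closure of Omega. *)
Definition has_dim Omega (E : set (R * R -> R)) (d : nat) : Prop :=
  exists e : 'I_d -> R * R -> R,
    (forall i, E (e i)) /\
    (forall u, E u -> exists! a : 'rV[R]_d,
       forall x, closure Omega x -> u x = \sum_(i < d) a 0 i * e i x).

(* mu 0 <= mu 1 <= ... lists the eigenvalues t, each repeated dim E_t times
   (so a t which is not an eigenvalue, with E_t = 0, is not listed). *)
Definition eigenvalue_sequence Omega q (mu : nat -> R) : Prop :=
  [/\ 0 < mu 0, mu 0 < mu 1, nondecreasing_seq mu
    & forall t : R, exists d : nat,
        ([set n | mu n = t] #= `I_d)%card /\ has_dim Omega (eigenspace Omega q t) d].

(* Sequence of mutually orthogonal (for the Dirichlet form) eigenfunctions,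
   normalized by ||w n||_{L^infty} = max w n = 1. *)
Definition normalized_eigenfunctions Omega q (mu : nat -> R)
    (w : nat -> R * R -> R) : Prop :=
  [/\ forall n, eigenspace Omega q (mu n) (w n),
      forall n, Linfty_norm Omega (w n) = 1%E,
      forall n, (exists2 x, closure Omega x & w n x = 1) /\
                (forall x, closure Omega x -> w n x <= 1)
    & forall i j, i <> j ->
        (\int[mu2]_(x in Omega) (dotp (grad (w i) x) (grad (w j) x))%:E = 0)%E].

Definition subsequence (s : nat -> nat) : Prop :=
  forall i j, (i < j)%N -> (s i < s j)%N.

(* w j k n (z) |-> w_k^n (delta_{j,k} z + x_{j,k}) *)
Definition rescaled (m : nat) (x : 'I_m -> nat -> R * R)
    (delta : 'I_m -> nat -> R) (w : nat -> nat -> R * R -> R)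
    (j : 'I_m) (k n : nat) (z : R * R) : R :=
  w k n (delta j k *: z + x j k).

(* The vectors c^n (n < m) are the limit vectors of the first m eigenfunctions
   along the subsequence s. *)
Record limit_vectors Omega (G : R * R -> R * R -> R) (m : nat)
    (xs : 'I_m -> R * R) (r : R) (x : 'I_m -> nat -> R * R)
    (delta : 'I_m -> nat -> R) (mu : nat -> nat -> R)
    (w : nat -> nat -> R * R -> R) (s : nat -> nat)
    (c : 'I_m -> 'rV[R]_m) : Prop := LimitVectors {
  limvec_mu : forall n : 'I_m, mu k n @[k --> \oo] --> (0 : R);
  limvec_neq0 : forall n, c n != 0;
  limvec_le1 : forall n j, `|c n 0 j| <= 1;
  limvec_rescaled : forall n j : 'I_m,
    loc_unif_cvg setT (fun k => rescaled x delta w j (s k) n)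
                      (fun=> c n 0 j);
  limvec_orth : forall i i', i != i' -> \sum_(j < m) c i 0 j * c i' 0 j = 0;
  limvec_outer : forall (n : 'I_m) (eps : R), 0 < eps ->
    \forall k \near \oo, forall y,
      (closure Omega `\` \bigcup_(j in [set: 'I_m]) eball (x j (s k)) r) y ->
      `|w (s k) n y / mu (s k) n
        - 8 * pi * \sum_(j < m) c n 0 j * G y (xs j)| < eps
}.

Definition bubble (z : R * R) : R :=
  ln (1 / (1 + 8^-1 * enorm z ^+ 2) ^+ 2).

End Plane.

(* Main.v *)
Require Import Defs.
From HB Require Import structures.
From mathcomp Require Import all_boot all_order all_algebra.
From mathcomp Require Import all_classical all_reals all_analysis.
From mathcomp Require Import measurable_realfun ess_sup_inf ring lra.
Import Order.TTheory GRing.Theory Num.Theory.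
Import numFieldNormedType.Exports.
Local Open Scope classical_set_scope.
Local Open Scope ring_scope.

Set Implicit Arguments.
Unset Strict Implicit.
Unset Printing Implicit Defensive.

(** Fix a blow-up point and drop the indices k, n: write q for the local maximum [x j k], d for
    [delta j k], c for [c n 0 j], and put u = w / mu - c v. Then (w (q + d z) - w q) / mu is the sum
    of u (q + d z) - u q and c (v (q + d z) - v q). It is enough that, locally uniformly in z, the
    first difference tends to 0 and v (q + d z) - v q tends to the bubble.

    The first difference ([rescaled_difference]). One has - Delta u = lambda V e^v (w - c). Within
    distance T d of the points considered, lambda V e^v is O(d^-2) and w - c is uniformly small;
    farther out the mass of lambda V e^v is bounded and the gradient of the logarithmic kernel is at
    most 1 / (T d); on a fixed annulus around the blow-up point u is bounded, because |w| <= mu v by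
    the maximum principle ([eigenfunction_le_potential]). The interior estimate [gradient_bound]
    turns this into |grad u| = o(1) / d at distance O(d) from q, if T is chosen large before w - c
    is made small.

    The second difference ([rescaled_bubble]). The Hopf differential H = v_zz - v_z^2 / 2 would be
    holomorphic if V were constant; in general its d-bar derivative only involves lambda e^v grad V.
    A Cauchy-Pompeiu formula ([hopfA_approx_id], [hopfB_approx_id]) therefore bounds H by O(1 / d)
    ([hopf_center]), one power of d better than its natural size d^-2. The function g = exp (- (v -
    v q) / 2) satisfies g_zz = - H g / 2, so the Hessian of g is almost a multiple of the identity.
    A first integral shows that the multiple is almost 1 / (4 d^2), whence g is close to 1 + |y -
    q|^2 / (8 d^2) ([bubble_approx]); taking logarithms gives the bubble.

    All integral formulas come from the divergence theorem on a square for fields vanishing on its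
    edges ([sqint_div]), applied with a cut-off version of the kernel (y - x) / (|y - x|^2 + eps^2).
    Passing from its regularised delta to point values costs only a constant factor
    ([approx_id_pointwise]). Every bound has an explicit constant independent of k, so the limit in
    k is taken only at the very end, where [peak_bound] also yields d -> 0. *)

(** * Calculus of directional derivatives and of the classes [Ck] *)

Section CkCalculus.
Context {R : realType}.
Implicit Types (A : set (R * R)) (f g u : R * R -> R) (phi : R -> R).
Implicit Types (x y v : R * R).

(** The two difference quotients are the same function of the increment, so one-variable theorems
    (chain rule, mean value, FTC) become available for directional derivatives. *)
Lemma is_derive_slice f x v d :
  is_derive x v f d <-> is_derive (0 : R) 1 (fun h : R => f (h *: v + x)) d.
Proof.
have E : (fun h : R => h^-1 *: ((f \o shift x) (h *: v) - f x)) =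
  (fun h : R => h^-1 *: (((fun h => f (h *: v + x)) \o shift 0) (h *: (1 : R))
                  - (fun h => f (h *: v + x)) 0)).
  by apply/funext => h /=; rewrite addr0 scale0r add0r [_%:A]mulr1.
split=> -[d1 d2]; split.
- by move: d1; rewrite /derivable E.
- by rewrite -d2 /derive -E.
- by move: d1; rewrite /derivable E.
- by rewrite -d2 /derive E.
Qed.

Lemma is_derive_slice_at f x v d (t : R) :
  is_derive (t *: v + x) v f d ->
  is_derive t 1 (fun h : R => f (h *: v + x)) d.
Proof.
move=> /is_derive_slice.
have E : (fun h : R => h^-1 *: (((fun h : R => f (h *: v + (t *: v + x))) \o shift 0)
             (h *: (1 : R)) - f (0 *: v + (t *: v + x)))) =
  (fun h : R => h^-1 *: (((fun h => f (h *: v + x)) \o shift t) (h *: (1 : R))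
                  - f (t *: v + x))).
  apply/funext => h /=.
  by rewrite addr0 [_%:A]mulr1 scalerDl scale0r add0r addrA.
move=> [d1 d2]; split.
  by move: d1; rewrite /derivable E.
by rewrite -d2 /derive E.
Qed.

Lemma is_derive_comp2 f phi x v (a b : R) :
  is_derive x v f a -> is_derive (f x) (1 : R) phi b ->
  is_derive x v (fun y => phi (f y)) (b * a).
Proof.
move=> /is_derive_slice fa pb; apply/is_derive_slice.
apply: (@is_derive1_comp _ phi (fun h => f (h *: v + x))).
by rewrite scale0r add0r.
Qed.

Lemma is_deriveD2 f g x v (a b : R) : is_derive x v f a -> is_derive x v g b ->
  is_derive x v (fun y => f y + g y) (a + b).
Proof. exact: is_deriveD. Qed.

Lemma is_deriveB2 f g x v (a b : R) : is_derive x v f a -> is_derive x v g b ->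
  is_derive x v (fun y => f y - g y) (a - b).
Proof. exact: is_deriveB. Qed.

Lemma is_deriveM2 f g x v (a b : R) : is_derive x v f a -> is_derive x v g b ->
  is_derive x v (fun y => f y * g y) (a * g x + f x * b).
Proof.
move=> fa gb; apply: is_derive_eq (is_deriveM fa gb) _.
by rewrite /GRing.scale /=; ring.
Qed.

Lemma is_deriveC2 (c : R) x v : is_derive x v (fun=> c) 0.
Proof. exact: is_derive_cst. Qed.

Lemma is_deriveV2 f x v (a : R) : f x != 0 -> is_derive x v f a ->
  is_derive x v (fun y => (f y)^-1) (- (f x) ^- 2 * a).
Proof.
move=> f0 [fd <-]; split; first exact: derivableV.
by rewrite deriveV.
Qed.

Lemma is_derive_affine (a b t : R) : is_derive t 1 (fun h : R => h * a + b) a.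
Proof.
have H := is_deriveD (is_deriveM (is_derive_id t 1) (is_derive_cst a t 1))
  (is_derive_cst b t 1).
apply: is_derive_eq H _; rewrite /GRing.scale /=; ring.
Qed.

Lemma is_derive_fst x v : is_derive x v (fun y => y.1) v.1.
Proof. by apply/is_derive_slice; exact: is_derive_affine. Qed.

Lemma is_derive_snd x v : is_derive x v (fun y => y.2) v.2.
Proof. by apply/is_derive_slice; exact: is_derive_affine. Qed.

Lemma is_derive_expR2 f x v (a : R) : is_derive x v f a ->
  is_derive x v (fun y => expR (f y)) (expR (f x) * a).
Proof. by move=> fa; apply: is_derive_comp2. Qed.

Lemma Ck_cont n A f x : Ck n A f -> A x -> {for x, continuous f}.
Proof. by case: n => [|n] [+ _]; exact. Qed.

Lemma Ck_D1 n A f : Ck n.+1 A f -> Ck n A ('D_e1 f).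
Proof. by case=> _ [_ []]. Qed.

Lemma Ck_D2 n A f : Ck n.+1 A f -> Ck n A ('D_e2 f).
Proof. by case=> _ [_ []]. Qed.

Lemma Ck_is_derive1 n A f x : Ck n.+1 A f -> A x ->
  is_derive x e1 f ('D_e1 f x).
Proof. by case=> _ [+ _] Ax => /(_ x Ax)[? _]; apply/derivableP. Qed.

Lemma Ck_is_derive2 n A f x : Ck n.+1 A f -> A x ->
  is_derive x e2 f ('D_e2 f x).
Proof. by case=> _ [+ _] Ax => /(_ x Ax)[_ ?]; apply/derivableP. Qed.

Lemma Ck_subset n A B f : A `<=` B -> Ck n B f -> Ck n A f.
Proof.
elim: n f => [|n IH] f AB /=.
  by case=> cf _; split=> // x /AB; exact: cf.
case=> cf [df [c1 c2]]; split; first by move=> x /AB; exact: cf.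
by split; [move=> x /AB; exact: df | split; exact: IH].
Qed.

Lemma CkW n A f : Ck n.+1 A f -> Ck n A f.
Proof.
elim: n f => [|n IH] f; first by case.
case=> cf [df [c1 c2]]; split; first exact: cf.
by split; [exact: df | split; [exact: (IH _ c1) | exact: (IH _ c2)]].
Qed.

Lemma Ck_le m n A f : (m <= n)%N -> Ck n A f -> Ck m A f.
Proof.
elim: n => [|n IH]; first by rewrite leqn0 => /eqP ->.
rewrite leq_eqVlt => /orP[/eqP -> //|]; rewrite ltnS => mn /CkW; exact: IH.
Qed.

Lemma open_near_eq A f g x : open A -> (forall y, A y -> f y = g y) -> A x ->
  \forall y \near x, f y = g y.
Proof.
move=> oA fg Ax; have := open_nbhs_nbhs (conj oA Ax).
by apply: filterS => y /fg.
Qed.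

Lemma near_eq_continuous_at f g x : (\forall y \near x, f y = g y) ->
  {for x, continuous f} -> {for x, continuous g}.
Proof.
move=> fg; rewrite /prop_for /continuous_at -(nbhs_singleton fg).
by apply: cvg_trans; apply: near_eq_cvg.
Qed.

(** Openness of [A] turns equality on [A] into equality near each point, which passes to the partial
    derivatives and so lets the induction go on. *)
Lemma Ck_ext n A f g : open A -> (forall y, A y -> f y = g y) ->
  Ck n A f -> Ck n A g.
Proof.
move=> oA; elim: n f g => [|n IH] f g fg.
  case=> cf _; split=> // x Ax.
  exact: near_eq_continuous_at (open_near_eq oA fg Ax) (cf x Ax).
case=> cf [df [c1 c2]]; split.
  move=> x Ax.
  exact: near_eq_continuous_at (open_near_eq oA fg Ax) (cf x Ax).
split.
  move=> x Ax; have fgx := open_near_eq oA fg Ax.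
  have [d1 d2] := df x Ax.
  by split; [exact: near_eq_derivable d1|exact: near_eq_derivable d2].
split.
  apply: IH c1 => y Ay; apply: near_eq_derive; exact: (open_near_eq oA).
apply: IH c2 => y Ay; apply: near_eq_derive; exact: (open_near_eq oA).
Qed.

(** The introduction rule for [Ck]: the partials may be given by formulas valid on [A] only, which
    is how they are computed in practice. *)
Lemma CkS n A f g1 g2 : open A ->
  (forall x, A x -> {for x, continuous f}) ->
  (forall x, A x -> is_derive x e1 f (g1 x)) ->
  (forall x, A x -> is_derive x e2 f (g2 x)) ->
  Ck n A g1 -> Ck n A g2 -> Ck n.+1 A f.
Proof.
move=> oA cf d1 d2 c1 c2; split=> //; split.
  by move=> x Ax; have [? _] := d1 x Ax; have [? _] := d2 x Ax.
split.
  by apply: Ck_ext c1 => // y Ay; have [_ ->] := d1 y Ay.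
by apply: Ck_ext c2 => // y Ay; have [_ ->] := d2 y Ay.
Qed.

Lemma Ck_cst n A (c : R) : open A -> Ck n A (fun=> c).
Proof.
move=> oA; elim: n c => [|n IH] c; first by split=> // x _; exact: cvg_cst.
apply: (@CkS n A _ (fun=> 0) (fun=> 0)); try exact: oA; try exact: IH.
by move=> x _; exact: cvg_cst.
Qed.

Lemma Ck_fst n A : open A -> Ck n A (fun y : R * R => y.1).
Proof.
move=> oA; have c x : A x -> {for x, continuous (fun y : R * R => y.1)}.
  by move=> _; exact: cvg_fst.
case: n => [|n]; first by split.
apply: (@CkS n A _ (fun=> 1) (fun=> 0) oA c); try exact: Ck_cst.
  by move=> x _; exact: is_derive_fst.
by move=> x _; exact: is_derive_fst.
Qed.

Lemma Ck_snd n A : open A -> Ck n A (fun y : R * R => y.2).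
Proof.
move=> oA; have c x : A x -> {for x, continuous (fun y : R * R => y.2)}.
  by move=> _; exact: cvg_snd.
case: n => [|n]; first by split.
apply: (@CkS n A _ (fun=> 0) (fun=> 1) oA c); try exact: Ck_cst.
  by move=> x _; exact: is_derive_snd.
by move=> x _; exact: is_derive_snd.
Qed.

Lemma CkD n A f g : open A -> Ck n A f -> Ck n A g ->
  Ck n A (fun y => f y + g y).
Proof.
move=> oA; elim: n f g => [|n IH] f g cf cg.
  by split=> // x Ax; exact: (cvgD (Ck_cont cf Ax) (Ck_cont cg Ax)).
apply: (@CkS n A _ (fun y => 'D_e1 f y + 'D_e1 g y)
                   (fun y => 'D_e2 f y + 'D_e2 g y)); first exact: oA.
- by move=> x Ax; exact: (cvgD (Ck_cont cf Ax) (Ck_cont cg Ax)).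
- move=> x Ax.
  exact: (is_deriveD2 (Ck_is_derive1 cf Ax) (Ck_is_derive1 cg Ax)).
- move=> x Ax.
  exact: (is_deriveD2 (Ck_is_derive2 cf Ax) (Ck_is_derive2 cg Ax)).
- by apply: IH; [exact: Ck_D1 cf|exact: Ck_D1 cg].
- by apply: IH; [exact: Ck_D2 cf|exact: Ck_D2 cg].
Qed.

Lemma CkM n A f g : open A -> Ck n A f -> Ck n A g ->
  Ck n A (fun y => f y * g y).
Proof.
move=> oA; elim: n f g => [|n IH] f g cf cg.
  by split=> // x Ax; exact: (cvgM (Ck_cont cf Ax) (Ck_cont cg Ax)).
apply: (@CkS n A _ (fun y => 'D_e1 f y * g y + f y * 'D_e1 g y)
                   (fun y => 'D_e2 f y * g y + f y * 'D_e2 g y)); first exact: oA.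
- by move=> x Ax; exact: (cvgM (Ck_cont cf Ax) (Ck_cont cg Ax)).
- move=> x Ax.
  exact: (is_deriveM2 (Ck_is_derive1 cf Ax) (Ck_is_derive1 cg Ax)).
- move=> x Ax.
  exact: (is_deriveM2 (Ck_is_derive2 cf Ax) (Ck_is_derive2 cg Ax)).
- exact: (CkD oA (IH _ _ (Ck_D1 cf) (CkW cg)) (IH _ _ (CkW cf) (Ck_D1 cg))).
- exact: (CkD oA (IH _ _ (Ck_D2 cf) (CkW cg)) (IH _ _ (CkW cf) (Ck_D2 cg))).
Qed.

Lemma CkN n A f : open A -> Ck n A f -> Ck n A (fun y => - f y).
Proof.
move=> oA cf; apply: (Ck_ext (f := fun y => (-1) * f y)) => //.
  by move=> y _; rewrite mulN1r.
exact: (CkM oA (Ck_cst n (-1) oA) cf).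
Qed.

Lemma CkB n A f g : open A -> Ck n A f -> Ck n A g ->
  Ck n A (fun y => f y - g y).
Proof. by move=> oA cf cg; exact: (CkD oA cf (CkN oA cg)). Qed.

(** The regularity of [phi'] composed with [f] is a hypothesis, so that inductions for exp, square
    root and powers of the positive part can supply it from the previous order. *)
Lemma Ck_comp n A f phi phi' : open A -> Ck n.+1 A f ->
  (forall x, A x -> is_derive (f x) (1 : R) phi (phi' (f x))) ->
  Ck n A (fun y => phi' (f y)) -> Ck n.+1 A (fun y => phi (f y)).
Proof.
move=> oA cf dphi cphi'.
apply: (@CkS n A _ (fun y => phi' (f y) * 'D_e1 f y)
                   (fun y => phi' (f y) * 'D_e2 f y)); first exact: oA.
- move=> x Ax; apply: (@cvg_comp _ _ _ f phi _ (nbhs (f x))).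
    exact: (Ck_cont cf Ax).
  have [/derivable1_diffP/differentiable_continuous + _] := dphi x Ax.
  exact.
- move=> x Ax; apply: is_derive_comp2; last exact: dphi.
  exact: (Ck_is_derive1 cf Ax).
- move=> x Ax; apply: is_derive_comp2; last exact: dphi.
  exact: (Ck_is_derive2 cf Ax).
- exact: (CkM oA cphi' (Ck_D1 cf)).
- exact: (CkM oA cphi' (Ck_D2 cf)).
Qed.

Lemma Ck_expR n A f : open A -> Ck n A f -> Ck n A (fun y => expR (f y)).
Proof.
move=> oA; elim: n => [|n IH] cf.
  split=> // x Ax; apply: (@cvg_comp _ _ _ f expR _ (nbhs (f x))).
    exact: (Ck_cont cf Ax).
  exact: continuous_expR.
apply: (@Ck_comp n A f expR expR) => //.
exact: (IH (CkW cf)).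
Qed.

Lemma CkV n A f : open A -> (forall x, A x -> f x != 0) -> Ck n A f ->
  Ck n A (fun y => (f y)^-1).
Proof.
move=> oA f0; elim: n => [|n IH] cf.
  by split=> // x Ax; apply: cvgV; [exact: f0|exact: (Ck_cont cf Ax)].
have cV : Ck n A (fun y => (f y)^-1) := IH (CkW cf).
apply: (@CkS n A _ (fun y => - ((f y)^-1 * (f y)^-1) * 'D_e1 f y)
                   (fun y => - ((f y)^-1 * (f y)^-1) * 'D_e2 f y)); first exact: oA.
- by move=> x Ax; apply: cvgV; [exact: f0|exact: (Ck_cont cf Ax)].
- move=> x Ax; rewrite -invfM -expr2.
  by apply: is_deriveV2; [exact: f0|exact: (Ck_is_derive1 cf Ax)].
- move=> x Ax; rewrite -invfM -expr2.
  by apply: is_deriveV2; [exact: f0|exact: (Ck_is_derive2 cf Ax)].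
- exact: (CkM oA (CkN oA (CkM oA cV cV)) (Ck_D1 cf)).
- exact: (CkM oA (CkN oA (CkM oA cV cV)) (Ck_D2 cf)).
Qed.

Lemma Ck_sqrt n A f : open A -> (forall x, A x -> 0 < f x) -> Ck n A f ->
  Ck n A (fun y => Num.sqrt (f y)).
Proof.
move=> oA f0; elim: n => [|n IH] cf.
  split=> // x Ax; apply: (@cvg_comp _ _ _ f Num.sqrt _ (nbhs (f x))).
    exact: (Ck_cont cf Ax).
  exact: sqrt_continuous.
apply: (@Ck_comp n A f Num.sqrt (fun t => (2 * Num.sqrt t)^-1)) => //.
  by move=> x Ax; apply: is_derive1_sqrt; exact: f0.
apply: CkV => //.
  by move=> x Ax; rewrite mulf_neq0// lt0r_neq0// sqrtr_gt0; exact: f0.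
exact: (CkM oA (Ck_cst n 2 oA) (IH (CkW cf))).
Qed.

End CkCalculus.

(** * Integration over squares and the divergence theorem without boundary terms *)

Section SquareIntegral.
Context {R : realType}.
Implicit Types (A U : set (R * R)) (F G : R * R -> R) (p x y : R * R).

Definition square p (a : R) : set (R * R) :=
  `[p.1 - a, p.1 + a] `*` `[p.2 - a, p.2 + a].

Lemma squareP p a y :
  square p a y <-> `|y.1 - p.1| <= a /\ `|y.2 - p.2| <= a.
Proof.
rewrite /square /= !in_itv /= !ler_norml.
by split=> -[/andP[h1 h2] /andP[h3 h4]]; split; apply/andP; split; lra.
Qed.

Lemma square_compact p a : compact (square p a).
Proof. by apply: compact_setX; exact: segment_compact. Qed.

Let plane := (measurableTypeR R * measurableTypeR R)%type.

Lemma square_measurable p a : measurable (square p a : set plane).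
Proof. by apply: measurableX; exact: measurable_itv. Qed.

Lemma square_measure p a : 0 <= a -> mu2 (square p a) = (4 * a ^+ 2)%:E.
Proof.
move=> a0.
have HI (c : R) : lebesgue_measure (`[c - a, c + a]%classic : set R) = (2 * a)%:E.
  rewrite lebesgue_measure_itv /= lte_fin.
  have [a1|a1] := ltP (c - a) (c + a); first by rewrite -EFinB; congr EFin; ring.
  by congr EFin; lra.
etransitivity; first by apply: product_measure1E; exact: measurable_itv.
apply: etrans (congr2 mule (HI _) (HI _)) _.
by rewrite -EFinM; congr EFin; ring.
Qed.

(** An open set is the countable union of the boxes with rational corners that it contains, and
    boxes belong to the product sigma-algebra. *)
Lemma open_measurable2 U : open U -> measurable (U : set plane).
Proof.
move=> oU.
pose box (q1 q2 q3 q4 : rat) : set plane :=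
  `]ratr q1, ratr q2[ `*` `]ratr q3, ratr q4[.
have -> : U = \bigcup_q1 \bigcup_q2 \bigcup_q3 \bigcup_q4
    (if pselect (box q1 q2 q3 q4 `<=` U) then box q1 q2 q3 q4 else set0).
  apply/seteqP; split=> [y Uy|y]; last first.
    by move=> [q1 _ [q2 _ [q3 _ [q4 _]]]]; case: pselect => [sub /sub|_ []].
  have := open_nbhs_nbhs (conj oU Uy).
  rewrite -nbhs_ballE => -[e /= e0 yeU].
  have H (t : R) : t - e < t /\ t < t + e by lra.
  have [q1 /[!in_itv]/= q1P] := rat_in_itvoo (H y.1).1.
  have [q2 /[!in_itv]/= q2P] := rat_in_itvoo (H y.1).2.
  have [q3 /[!in_itv]/= q3P] := rat_in_itvoo (H y.2).1.
  have [q4 /[!in_itv]/= q4P] := rat_in_itvoo (H y.2).2.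
  exists q1 => //; exists q2 => //; exists q3 => //; exists q4 => //.
  case: pselect => [sub|nsub].
    by rewrite /box /= !in_itv /=; split; apply/andP; lra.
  case: nsub => z; rewrite /box /= !in_itv /= => -[z1 z2]; apply: yeU; split => /=.
    by rewrite /ball /= ltr_norml; apply/andP; lra.
  by rewrite /ball /= ltr_norml; apply/andP; lra.
do 4 (apply: bigcupT_measurable_rat => ?).
case: pselect => [sub|nsub]; last exact: measurable0.
by apply: measurableX; exact: measurable_itv.
Qed.

Lemma continuous_measurable2 A F : measurable (A : set plane) ->
  (forall y, A y -> {for y, continuous F}) ->
  measurable_fun (A : set plane) (F : plane -> R).
Proof.
move=> mA cF; apply: (measurability _ (measurable_realfun.RGenOpens.measurableE R)).
move=> _ [_ [a [b ->] <-]].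
(* Continuity holds in the whole plane at the points of [A], so the preimage is the trace on [A] of
   an open set. *)
rewrite (_ : _ `&` _ = A `&` interior [set y | A y -> F y \in `]a, b[ ]).
  by apply: measurableI => //; apply: open_measurable2; exact: open_interior.
apply/seteqP; split=> y [Ay Fy]; split=> //.
  have : nbhs (F y) `]a, b[%classic.
    by apply: open_nbhs_nbhs; split=> //; exact: itv_open.
  move=> nF; have nF' : nbhs y (F @^-1` `]a, b[) := cF y Ay _ nF.
  by apply: (filterS _ nF') => z /= Fz _.
by have := interior_subset Fy; exact.
Qed.

(** Continuity in the plane at each point of [A], not relative to [A]: this is what [Ck] on a larger
    open set provides. *)
Definition cont_on A F := forall y, A y -> {for y, continuous F}.

Lemma Ck_cont_on n A U F : A `<=` U -> Ck n U F -> cont_on A F.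
Proof. by move=> AU cF y /AU; exact: Ck_cont cF. Qed.

Lemma cont_on_within A F : cont_on A F -> {within A, continuous F}.
Proof. by move=> cF; apply: continuous_in_subspaceT => y /set_mem; exact: cF. Qed.

Lemma cont_on_bounded A F : compact A -> cont_on A F ->
  exists M, forall y, A y -> `|F y| <= M.
Proof.
move=> cA cF.
have [M [_ HM]] := compact_bounded (continuous_compact (cont_on_within cF) cA).
exists (M + 1) => y Ay; apply: (HM (M + 1)); first by rewrite ltrDl.
by exists y.
Qed.

Lemma cont_onD A F G : cont_on A F -> cont_on A G ->
  cont_on A (fun y => F y + G y).
Proof. by move=> cF cG y Ay; exact: (cvgD (cF y Ay) (cG y Ay)). Qed.

Lemma cont_onM A F G : cont_on A F -> cont_on A G ->
  cont_on A (fun y => F y * G y).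
Proof. by move=> cF cG y Ay; exact: (cvgM (cF y Ay) (cG y Ay)). Qed.

Lemma cont_onN A F : cont_on A F -> cont_on A (fun y => - F y).
Proof. by move=> cF y Ay; exact: (cvgN (cF y Ay)). Qed.

Lemma cont_onB A F G : cont_on A F -> cont_on A G ->
  cont_on A (fun y => F y - G y).
Proof. by move=> cF cG; apply: cont_onD => //; exact: cont_onN. Qed.

Lemma cont_on_cst A (c : R) : cont_on A (fun=> c).
Proof. by move=> y _; exact: cvg_cst. Qed.

Lemma cont_on_norm A F : cont_on A F -> cont_on A (fun y => `|F y|).
Proof. by move=> cF y Ay; exact: (cvg_norm (cF y Ay)). Qed.

Variables (p : R * R) (a : R).
Hypothesis a_ge0 : 0 <= a.
Let Q := square p a.

Lemma cont_on_integrable F : cont_on Q F ->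
  mu2.-integrable (Q : set plane) (EFin \o (F : plane -> R)).
Proof.
move=> cF; apply: measurable_bounded_integrable.
- exact: square_measurable.
- by rewrite square_measure// ltry.
- by apply: continuous_measurable2 => //; exact: square_measurable.
- have [M HM] := cont_on_bounded (@square_compact p a) cF.
  exists M; split; first by rewrite num_real.
  by move=> N MN y /= Qy; rewrite (le_trans (HM _ Qy))// ltW.
Qed.

Definition sqint F : R := \int[mu2]_(y in square p a) F y.

Lemma eq_sqint F G : (forall y, Q y -> F y = G y) -> sqint F = sqint G.
Proof. by move=> FG; apply: eq_Rintegral => y /set_mem; exact: FG. Qed.

Lemma sqintD F G : cont_on Q F -> cont_on Q G ->
  sqint (fun y => F y + G y) = sqint F + sqint G.
Proof.
by move=> cF cG; apply: RintegralD;
  [exact: square_measurable|exact: cont_on_integrable..].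
Qed.

Lemma sqintB F G : cont_on Q F -> cont_on Q G ->
  sqint (fun y => F y - G y) = sqint F - sqint G.
Proof.
by move=> cF cG; apply: RintegralB;
  [exact: square_measurable|exact: cont_on_integrable..].
Qed.

Lemma sqintZ c F : cont_on Q F -> sqint (fun y => c * F y) = c * sqint F.
Proof.
by move=> cF; apply: RintegralZl;
  [exact: square_measurable|exact: cont_on_integrable].
Qed.

Lemma le_sqint F G : cont_on Q F -> cont_on Q G ->
  (forall y, Q y -> F y <= G y) -> sqint F <= sqint G.
Proof.
move=> cF cG FG.
exact: (le_Rintegral (@square_measurable p a)
  (cont_on_integrable cF) (cont_on_integrable cG) FG).
Qed.

Lemma le_norm_sqint F G : cont_on Q F -> cont_on Q G ->
  (forall y, Q y -> `|F y| <= G y) -> `|sqint F| <= sqint G.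
Proof.
move=> cF cG FG; apply: (@le_trans _ _ (sqint (fun y => `|F y|))).
  by apply: le_normr_Rintegral; [exact: square_measurable|exact: cont_on_integrable].
by apply: le_sqint => //; exact: cont_on_norm.
Qed.

Let square_sub_integrable x b : 0 <= b -> square x b `<=` Q -> forall c : R,
  mu2.-integrable (Q : set plane) (EFin \o (fun y : plane => c * \1_(square x b) y)).
Proof.
move=> b0 sub c; apply: measurable_bounded_integrable.
- exact: square_measurable.
- by rewrite square_measure// ltry.
- by apply: measurable_funM => //; apply: measurable_indic; exact: square_measurable.
- exists `|c|; split; first by rewrite num_real.
  move=> N MN y /= Qy; rewrite (le_trans _ (ltW MN))// indicE normrM.
  by case: (y \in _) => /=; rewrite ?normr1 ?normr0 ?mulr1 ?mulr0.
Qed.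

Let sqint_indic x b c : 0 <= b -> square x b `<=` Q ->
  \int[mu2]_(y in Q) (c * \1_(square x b) y) = c * (4 * b ^+ 2).
Proof.
move=> b0 sub; rewrite RintegralZl; last 2 first.
- exact: square_measurable.
- have := square_sub_integrable b0 sub 1.
  by under [X in integrable _ _ (_ \o X)]eq_fun do rewrite mul1r.
rewrite /Rintegral integral_indic; try exact: square_measurable.
by rewrite setIidl//= square_measure.
Qed.

Lemma sqint_supp F x b c : 0 <= b -> 0 <= c -> square x b `<=` Q -> cont_on Q F ->
  (forall y, Q y -> `|F y| <= c) ->
  (forall y, Q y -> ~ square x b y -> F y = 0) ->
  `|sqint F| <= c * (4 * b ^+ 2).
Proof.
move=> b0 c0 sub cF Fc F0; rewrite -(sqint_indic c b0 sub).
apply: (@le_trans _ _ (sqint (fun y => `|F y|))).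
  by apply: le_normr_Rintegral; [exact: square_measurable|exact: cont_on_integrable].
apply: le_Rintegral; first exact: square_measurable.
- by apply: cont_on_integrable; exact: cont_on_norm.
- exact: square_sub_integrable.
move=> y Qy; rewrite indicE; have [yb|/negP yb] := boolP (y \in square x b).
  by rewrite mulr1 Fc.
by rewrite F0 ?normr0 ?mulr0// => yb'; apply: yb; rewrite inE.
Qed.

Lemma sqint_lower F x b c : 0 <= b -> square x b `<=` Q -> cont_on Q F ->
  (forall y, Q y -> 0 <= F y) -> (forall y, square x b y -> c <= F y) ->
  c * (4 * b ^+ 2) <= sqint F.
Proof.
move=> b0 sub cF F0 Fc; rewrite -(sqint_indic c b0 sub).
apply: le_Rintegral; first exact: square_measurable.
- exact: square_sub_integrable.
- exact: cont_on_integrable.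
move=> y Qy; rewrite indicE; have [/set_mem yb|_] := boolP (y \in square x b).
  by rewrite mulr1 Fc.
by rewrite mulr0 F0.
Qed.

Lemma slice1 (b t : R) : t *: e1 + (0, b) = (t, b) :> R * R.
Proof. by congr pair; rewrite /GRing.scale /= /GRing.scale /= ?mulr1 ?mulr0 ?addr0 ?add0r. Qed.

Lemma slice2 (b t : R) : t *: e2 + (b, 0) = (b, t) :> R * R.
Proof. by congr pair; rewrite /GRing.scale /= /GRing.scale /= ?mulr1 ?mulr0 ?addr0 ?add0r. Qed.

Lemma is_derive_line1 F (b t d : R) :
  is_derive ((t, b) : R * R) e1 F d -> is_derive t 1 (fun h => F (h, b)) d.
Proof.
rewrite -slice1 => /is_derive_slice_at.
by rewrite (_ : (fun h => F (h *: e1 + _)) = fun h => F (h, b));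
  [|apply/funext => h; rewrite slice1].
Qed.

Lemma is_derive_line2 F (b t d : R) :
  is_derive ((b, t) : R * R) e2 F d -> is_derive t 1 (fun h => F (b, h)) d.
Proof.
rewrite -slice2 => /is_derive_slice_at.
by rewrite (_ : (fun h => F (h *: e2 + _)) = fun h => F (b, h));
  [|apply/funext => h; rewrite slice2].
Qed.

Lemma cont_line1 F (b t : R) : {for (t, b), continuous F} ->
  {for t, continuous (fun h => F (h, b))}.
Proof.
move=> cF; apply: (@cvg_comp _ _ _ (fun h => (h, b)) F _ (nbhs (t, b))) cF.
exact: (cvg_pair (@cvg_id _ _) (cvg_cst b)).
Qed.

Lemma cont_line2 F (b t : R) : {for (b, t), continuous F} ->
  {for t, continuous (fun h => F (b, h))}.
Proof.
move=> cF; apply: (@cvg_comp _ _ _ (fun h => (b, h)) F _ (nbhs (b, t))) cF.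
exact: (cvg_pair (cvg_cst b) (@cvg_id _ _)).
Qed.

Lemma integral_deriv_bnd0 (g h : R -> R) (c d : R) : c < d ->
  (forall t, c <= t <= d -> {for t, continuous g}) ->
  (forall t, c <= t <= d -> {for t, continuous h}) ->
  (forall t, c <= t <= d -> is_derive t 1 g (h t)) ->
  g c = 0 -> g d = 0 ->
  (\int[lebesgue_measure]_(t in `[c, d]) (h t)%:E = 0)%E.
Proof.
move=> cd cg ch dg gc gd.
rewrite (@continuous_FTC2 _ h g c d cd).
- by rewrite gc gd subee.
- by apply: continuous_in_subspaceT => t /set_mem /=; rewrite in_itv /=; exact: ch.
- split.
  + by move=> t; rewrite in_itv /= => /andP[t1 t2]; have [] := dg t ltac:(by apply/andP; split; exact: ltW).
  + by apply: cvg_at_right_filter; apply: cg; rewrite lexx ltW.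
  + by apply: cvg_at_left_filter; apply: cg; rewrite lexx ltW.
- move=> t; rewrite in_itv /= => /andP[t1 t2]; rewrite derive1E.
  by have [_ ->] := dg t ltac:(by apply/andP; split; exact: ltW).
Qed.

Let restr F : plane -> \bar R := (EFin \o (F : plane -> R)) \_ (Q : set plane).

Let restr_integrable F : cont_on Q F -> mu2.-integrable [set: plane] (restr F).
Proof.
move=> cF; rewrite /restr -integrable_mkcond; first exact: cont_on_integrable.
exact: square_measurable.
Qed.

Let sqint_restr F : sqint F = fine (\int[mu2]_z restr F z).
Proof. by rewrite /sqint /Rintegral integral_mkcond. Qed.

Let mem_Q (s t : R) : ((s, t) : plane) \in (Q : set plane) =
  (s \in `[p.1 - a, p.1 + a]) && (t \in `[p.2 - a, p.2 + a]).
Proof. by rewrite /Q /square in_setX /= !mem_setE. Qed.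

(** Fubini with the first variable innermost; on each horizontal segment the FTC gives a difference
    of two edge values, both zero. *)
Lemma sqint_D1 U F : open U -> 0 < a -> Q `<=` U -> Ck 1 U F ->
  (forall y, Q y -> `|y.1 - p.1| = a -> F y = 0) -> sqint ('D_e1 F) = 0.
Proof.
move=> oU a0 QU cF F0.
have cD : cont_on Q ('D_e1 F) by apply: Ck_cont_on QU (Ck_D1 cF).
rewrite sqint_restr -(integral21_prod_meas1 (restr_integrable cD)).
rewrite (_ : (\int[_]_x _)%E = 0%E)//; apply: integral0_eq => t _.
rewrite /fubini_G.
have [tI|tI] := boolP (t \in `[p.2 - a, p.2 + a]); last first.
  apply: integral0_eq => s _; rewrite /restr patchE mem_Q (negbTE tI) andbF //.
have QI (s : R) : s \in `[p.1 - a, p.1 + a] -> Q (s, t).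
  by move=> sI; apply/set_mem; rewrite mem_Q sI tI.
transitivity (\int[lebesgue_measure]_(s in `[(p.1 - a)%R, (p.1 + a)%R]) ('D_e1 F (s, t))%:E)%E.
  rewrite [RHS]integral_mkcond; apply: eq_integral => s _.
  by rewrite /restr !patchE mem_Q tI andbT mem_setE.
apply: (@integral_deriv_bnd0 (fun s => F (s, t))); first lra.
- move=> s sI; apply: cont_line1; apply: (Ck_cont cF); apply: QU; exact: QI.
- move=> s sI; exact: (@cont_line1 ('D_e1 F) t s (cD _ (QI _ sI))).
- move=> s sI; apply: is_derive_line1; apply: (Ck_is_derive1 cF); apply: QU; exact: QI.
- apply: F0 => /=; first by apply: QI; rewrite in_itv /=; lra.
  by rewrite addrAC subrr sub0r normrN ger0_norm.
- apply: F0 => /=; first by apply: QI; rewrite in_itv /=; lra.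
  by rewrite addrAC subrr add0r ger0_norm.
Qed.

Lemma sqint_D2 U F : open U -> 0 < a -> Q `<=` U -> Ck 1 U F ->
  (forall y, Q y -> `|y.2 - p.2| = a -> F y = 0) -> sqint ('D_e2 F) = 0.
Proof.
move=> oU a0 QU cF F0.
have cD : cont_on Q ('D_e2 F) by apply: Ck_cont_on QU (Ck_D2 cF).
rewrite sqint_restr -(integral12_prod_meas1 (restr_integrable cD)).
rewrite (_ : (\int[_]_x _)%E = 0%E)//; apply: integral0_eq => s _.
rewrite /fubini_F.
have [sI|sI] := boolP (s \in `[p.1 - a, p.1 + a]); last first.
  by apply: integral0_eq => t _; rewrite /restr patchE mem_Q (negbTE sI).
have QI (t : R) : t \in `[p.2 - a, p.2 + a] -> Q (s, t).
  by move=> tI; apply/set_mem; rewrite mem_Q sI tI.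
transitivity (\int[lebesgue_measure]_(t in `[(p.2 - a)%R, (p.2 + a)%R]) ('D_e2 F (s, t))%:E)%E.
  rewrite [RHS]integral_mkcond; apply: eq_integral => t _.
  by rewrite /restr !patchE mem_Q sI mem_setE.
apply: (@integral_deriv_bnd0 (fun t => F (s, t))); first lra.
- move=> t tI; apply: cont_line2; apply: (Ck_cont cF); apply: QU; exact: QI.
- move=> t tI; exact: (@cont_line2 ('D_e2 F) s t (cD _ (QI _ tI))).
- move=> t tI; apply: is_derive_line2; apply: (Ck_is_derive2 cF); apply: QU; exact: QI.
- apply: F0 => /=; first by apply: QI; rewrite in_itv /=; lra.
  by rewrite addrAC subrr sub0r normrN ger0_norm.
- apply: F0 => /=; first by apply: QI; rewrite in_itv /=; lra.
  by rewrite addrAC subrr add0r ger0_norm.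
Qed.

(** Only the normal component of the field has to vanish on each pair of sides. Every integration by
    parts below is an instance of this. *)
Lemma sqint_div U F G H : open U -> 0 < a -> Q `<=` U -> Ck 1 U F -> Ck 1 U G ->
  (forall y, Q y -> `|y.1 - p.1| = a -> F y = 0) ->
  (forall y, Q y -> `|y.2 - p.2| = a -> G y = 0) ->
  (forall y, Q y -> H y = 'D_e1 F y + 'D_e2 G y) -> sqint H = 0.
Proof.
move=> oU a0 QU cF cG F0 G0 HE; rewrite (eq_sqint HE) sqintD.
- by rewrite (sqint_D1 oU a0 QU cF F0) (sqint_D2 oU a0 QU cG G0) addr0.
- exact: Ck_cont_on QU (Ck_D1 cF).
- exact: Ck_cont_on QU (Ck_D2 cG).
Qed.

End SquareIntegral.

#[local] Opaque derive e1 e2.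

(** * Mean value estimates on squares and symmetry of second derivatives *)

Section MeanValue.
Context {R : realType}.
Implicit Types (A U : set (R * R)) (f g u : R * R -> R) (p x y : R * R).

Lemma is_derive_cont1 (g : R -> R) (t d : R) : is_derive t 1 g d ->
  {for t, continuous g}.
Proof. by move=> [/derivable1_diffP/differentiable_continuous]. Qed.

Lemma mvt_line (g dg : R -> R) (b c : R) :
  (forall t, Num.min b c <= t <= Num.max b c -> is_derive t 1 g (dg t)) ->
  exists2 t, Num.min b c <= t <= Num.max b c & g c - g b = dg t * (c - b).
Proof.
have key (b' c' : R) : b' <= c' ->
    (forall t, b' <= t <= c' -> is_derive t 1 g (dg t)) ->
    exists2 t, b' <= t <= c' & g c' - g b' = dg t * (c' - b').
  move=> bc dG.
  have [||t0] := @MVT_segment R g dg b' c' bc.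
  - by move=> t; rewrite in_itv /= => /andP[t1 t2]; apply: dG; rewrite !ltW.
  - apply: continuous_in_subspaceT => t /set_mem /=; rewrite in_itv /= => tI.
    exact: is_derive_cont1 (dG t tI).
  - by rewrite in_itv /= => tI E; exists t0.
move=> dG; have [bc|cb] := leP b c.
  by move: dG; rewrite min_l// max_r// => dG; exact: key.
move: dG; rewrite min_r ?max_l ?ltW// => dG.
have [t tI E] := key c b (ltW cb) dG; exists t => //.
by rewrite -[LHS]opprB E -mulrN opprB.
Qed.

Lemma square_sub p x (a b : R) : `|x.1 - p.1| + b <= a -> `|x.2 - p.2| + b <= a ->
  square x b `<=` square p a.
Proof.
move=> h1 h2 y /squareP[y1 y2]; apply/squareP.
have := ler_normD (y.1 - x.1) (x.1 - p.1).
have := ler_normD (y.2 - x.2) (x.2 - p.2).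
by rewrite !subrKA => ? ?; split; lra.
Qed.

Lemma square_center p (a : R) : 0 <= a -> square p a p.
Proof. by move=> a0; apply/squareP; rewrite !subrr !normr0. Qed.

Lemma between_norm (b c t a q : R) : `|b - q| <= a -> `|c - q| <= a ->
  Num.min b c <= t <= Num.max b c -> `|t - q| <= a.
Proof.
rewrite !ler_norml => /andP[b1 b2] /andP[c1 c2] /andP[].
by rewrite ge_min le_max => /orP[t1|t1] /orP[t2|t2]; apply/andP; split; lra.
Qed.

(** Go from [z] to [y] along one vertical and one horizontal segment, both inside the square; hence
    the sum of coordinate differences on the right. *)
Lemma square_mean_value U u p (a C : R) y z : Ck 1 U u -> square p a `<=` U ->
  (forall y, square p a y -> `|'D_e1 u y| <= C /\ `|'D_e2 u y| <= C) ->
  square p a y -> square p a z ->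
  `|u y - u z| <= C * (`|y.1 - z.1| + `|y.2 - z.2|).
Proof.
move=> cu sub HC /squareP[y1 y2] /squareP[z1 z2].
have [t tI E1] := @mvt_line (fun t => u (t, y.2)) (fun t => 'D_e1 u (t, y.2)) z.1 y.1
  ltac:(move=> t tI; apply: is_derive_line1; apply: (Ck_is_derive1 cu); apply: sub;
        apply/squareP; split => //=; exact: between_norm tI).
have [s sI E2] := @mvt_line (fun t => u (z.1, t)) (fun t => 'D_e2 u (z.1, t)) z.2 y.2
  ltac:(move=> s sI; apply: is_derive_line2; apply: (Ck_is_derive2 cu); apply: sub;
        apply/squareP; split => //=; exact: between_norm sI).
have [C1 _] := HC (t, y.2) ltac:(apply/squareP; split => //=; exact: between_norm tI).
have [_ C2] := HC (z.1, s) ltac:(apply/squareP; split => //=; exact: between_norm sI).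
have -> : u y - u z = (u (y.1, y.2) - u (z.1, y.2)) + (u (z.1, y.2) - u (z.1, z.2)).
  by rewrite -!surjective_pairing addrA subrK.
rewrite E1 E2; apply: (le_trans (ler_normD _ _)); rewrite !normrM mulrDr.
by apply: lerD; apply: ler_wpM2r.
Qed.

Lemma near_square p U : nbhs p U -> exists2 e : R, 0 < e & square p e `<=` U.
Proof.
rewrite -nbhs_ballE => -[e /= e0 pU]; exists (e / 2); first by rewrite divr_gt0.
move=> y /squareP[y1 y2]; apply: pU; split; rewrite /ball /= distrC; lra.
Qed.

Lemma dist_via_common (e a b c d : R) : c = d -> `|a - d| < e / 2 ->
  `|b - c| < e / 2 -> `|a - b| <= e.
Proof.
move=> -> ad bc; have -> : a - b = (a - d) - (b - d) by ring.
by apply: (le_trans (ler_normB _ _)); lra.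
Qed.

Lemma mixed_difference (b c d e : R) : b - c - (d - e) = b - d - (c - e).
Proof. by ring. Qed.

(** The double difference of [u] over a square of side h at [x], evaluated by two mean values in
    either order, equates the two mixed partials at two nearby points; both partials are continuous
    at [x]. *)
Lemma schwarz U u x : open U -> Ck 2 U u -> U x ->
  'D_e1 ('D_e2 u) x = 'D_e2 ('D_e1 u) x.
Proof.
move=> oU cu Ux; apply/eqP; rewrite -subr_eq0 -normr_le0; apply/ler_addgt0Pl => e e0.
rewrite addr0.
have c12 := Ck_cont (Ck_D1 (Ck_D2 cu)) Ux.
have c21 := Ck_cont (Ck_D2 (Ck_D1 cu)) Ux.
have e20 : 0 < e / 2 by rewrite divr_gt0.
have [h h0 sub] : exists2 h : R, 0 < h & square x h `<=` [set y | [/\ U y,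
    `|'D_e1 ('D_e2 u) x - 'D_e1 ('D_e2 u) y| < e / 2 &
    `|'D_e2 ('D_e1 u) x - 'D_e2 ('D_e1 u) y| < e / 2] ].
  apply: near_square.
  have n1 := open_nbhs_nbhs (conj oU Ux).
  move/cvgrPdist_lt: c12 => /(_ _ e20) n2; move/cvgrPdist_lt: c21 => /(_ _ e20) n3.
  by apply: filterS3 n1 n2 n3 => y u1 u2 u3; split; [exact: u1|exact: u2|exact: u3].
have hh : `|h| <= h by rewrite gtr0_norm.
have x1h : `|x.1 + h - x.1| <= h by rewrite [_ + h]addrC addrK.
have x2h : `|x.2 + h - x.2| <= h by rewrite [_ + h]addrC addrK.
have x10 : `|x.1 - x.1| <= h by rewrite subrr normr0 ltW.
have x20 : `|x.2 - x.2| <= h by rewrite subrr normr0 ltW.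
have I1 (t : R) : Num.min x.1 (x.1 + h) <= t <= Num.max x.1 (x.1 + h) -> `|t - x.1| <= h.
  exact: between_norm x10 x1h.
have I2 (t : R) : Num.min x.2 (x.2 + h) <= t <= Num.max x.2 (x.2 + h) -> `|t - x.2| <= h.
  exact: between_norm x20 x2h.
have inU (s t : R) : `|s - x.1| <= h -> `|t - x.2| <= h -> U (s, t).
  by move=> s1 t1; have [] := sub (s, t) ltac:(apply/squareP; split).
have cu1 := CkW cu.
have [t tI E1] := @mvt_line (fun t => u (t, x.2 + h) - u (t, x.2))
  (fun t => 'D_e1 u (t, x.2 + h) - 'D_e1 u (t, x.2)) x.1 (x.1 + h)
  ltac:(move=> t /I1 tI; apply: is_deriveB; apply: is_derive_line1;
        apply: (Ck_is_derive1 cu1); exact: inU).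
have [s sI E2] := @mvt_line (fun s => 'D_e1 u (t, s))
  (fun s => 'D_e2 ('D_e1 u) (t, s)) x.2 (x.2 + h)
  ltac:(move=> s /I2 sI; apply: (is_derive_line2 (F := 'D_e1 u));
        apply: (Ck_is_derive2 (Ck_D1 cu)); apply: inU => //; exact: I1).
have [s' sI' E3] := @mvt_line (fun t => u (x.1 + h, t) - u (x.1, t))
  (fun t => 'D_e2 u (x.1 + h, t) - 'D_e2 u (x.1, t)) x.2 (x.2 + h)
  ltac:(move=> s' /I2 sI'; apply: is_deriveB; apply: is_derive_line2;
        apply: (Ck_is_derive2 cu1); exact: inU).
have [t' tI' E4] := @mvt_line (fun t => 'D_e2 u (t, s'))
  (fun t => 'D_e1 ('D_e2 u) (t, s')) x.1 (x.1 + h)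
  ltac:(move=> t' /I1 tI'; apply: (is_derive_line1 (F := 'D_e2 u));
        apply: (Ck_is_derive1 (Ck_D2 cu)); apply: inU => //; exact: I2).
have [_ _ b1] := sub (t, s) ltac:(apply/squareP; split; [exact: I1|exact: I2]).
have [_ b2 _] := sub (t', s') ltac:(apply/squareP; split; [exact: I1|exact: I2]).
have E : 'D_e2 ('D_e1 u) (t, s) = 'D_e1 ('D_e2 u) (t', s').
  move: E1 E3; rewrite E2 E4 ![_ + h - _]addrAC !subrr !add0r => E1 E3.
  have : ('D_e2 ('D_e1 u) (t, s) * h) * h = ('D_e1 ('D_e2 u) (t', s') * h) * h.
    exact: etrans (esym E1) (etrans (mixed_difference _ _ _ _) E3).
  by move=> /(mulIf (lt0r_neq0 h0))/(mulIf (lt0r_neq0 h0)).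
exact: dist_via_common E b2 b1.
Qed.

End MeanValue.

(** * Powers of the positive part: the cube is of class C^2 *)

Section PositivePart.
Context {R : realType}.
Implicit Types (U : set (R * R)) (f : R * R -> R) (t : R).

Definition pos t : R := Num.max 0 t.

Lemma pos_ge0 t : 0 <= pos t. Proof. by rewrite /pos le_max lexx. Qed.

Lemma pos_id t : 0 <= t -> pos t = t. Proof. by move=> t0; rewrite /pos max_r. Qed.

Lemma pos_0 t : t <= 0 -> pos t = 0. Proof. by move=> t0; rewrite /pos max_l. Qed.

Lemma pos_le1 t : t <= 1 -> pos t <= 1.
Proof. by move=> t1; rewrite /pos ge_max ler01. Qed.

Lemma pos_mul t : pos t * t = pos t ^+ 2.
Proof.
by have [t0|t0] := leP t 0; [rewrite pos_0// mul0r expr0n|rewrite pos_id ?ltW].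
Qed.

Lemma pos_continuous : continuous pos.
Proof.
have -> : pos = (fun t => 2^-1 * (t + `|t|)).
  apply/funext => t; have [t0|t0] := leP t 0.
    by rewrite pos_0// ler0_norm//; lra.
  by rewrite pos_id ?ltW// gtr0_norm//; lra.
move=> t; apply: cvgM; first exact: cvg_cst.
by apply: cvgD => //; exact: cvg_norm.
Qed.

(** Away from 0 the function is locally 0 or a square. At 0 the difference quotient equals [pos h],
    by [pos_mul], and tends to 0. *)
Lemma is_derive_pos2 t : is_derive t 1 (fun t => pos t ^+ 2) (2 * pos t).
Proof.
have [t0|t0|->] := ltgtP t 0.
- rewrite pos_0 ?ltW// mulr0.
  apply: near_eq_is_derive (is_derive_cst (0 : R) t 1).
  by near=> s; rewrite pos_0 ?expr0n// ltW//; near: s; exact: lt_nbhsl.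
- have D : is_derive t 1 (fun s : R => s * s) (2 * t).
    apply: is_derive_eq (is_deriveM (is_derive_id t 1) (is_derive_id t 1)) _.
    by rewrite /GRing.scale /=; ring.
  rewrite pos_id ?ltW//; apply: near_eq_is_derive D.
  by near=> s; rewrite pos_id ?expr2// ltW//; near: s; exact: lt_nbhsr.
- have H : (fun h : R => h^-1 *: (((fun t => pos t ^+ 2) \o shift 0) (h *: (1 : R)) -
      pos 0 ^+ 2)) @ 0^' --> (0 : R).
    have : pos h @[h --> 0^'] --> (0 : R).
      rewrite -{2}(pos_0 (lexx 0)).
      by apply: cvg_within_filter; exact: pos_continuous.
    apply: cvg_trans; apply: near_eq_cvg; near=> h => /=.
    have h0 : h != 0 by near: h; exact: nbhs_dnbhs_neq.
    rewrite addr0 [h%:A]mulr1 [pos 0]pos_0// expr0n subr0 -pos_mul /GRing.scale /=.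
    by rewrite mulrCA mulVf// mulr1.
  rewrite pos_0// mulr0; split; first by apply/cvg_ex; exists 0.
  exact: cvg_lim H.
Unshelve. all: by end_near. Qed.

Lemma is_derive_pos3 t : is_derive t 1 (fun t => pos t ^+ 3) (3 * pos t ^+ 2).
Proof.
have -> : (fun t => pos t ^+ 3) = ((fun t => pos t ^+ 2) * id : R -> R).
  by apply/funext => s /=; rewrite mulrfctE /= exprS -[in LHS]pos_mul; ring.
apply: is_derive_eq (is_deriveM (is_derive_pos2 t) (is_derive_id t 1)) _.
by rewrite /GRing.scale /= -!pos_mul; ring.
Qed.

Lemma Ck_pos1 U f : Ck 0 U f -> Ck 0 U (fun y => pos (f y)).
Proof.
move=> cf; split=> // x Ux; apply: (@cvg_comp _ _ _ f pos _ (nbhs (f x))).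
  exact: (Ck_cont cf Ux).
exact: pos_continuous.
Qed.

Lemma Ck_pos2 U f : open U -> Ck 1 U f -> Ck 1 U (fun y => pos (f y) ^+ 2).
Proof.
move=> oU cf.
apply: (@Ck_comp _ 0 U f (fun t => pos t ^+ 2) (fun t => 2 * pos t)) => //.
  by move=> x _; exact: is_derive_pos2.
exact: (CkM oU (Ck_cst 0 2 oU) (Ck_pos1 (CkW cf))).
Qed.

Lemma Ck_pos3 U f : open U -> Ck 2 U f -> Ck 2 U (fun y => pos (f y) ^+ 3).
Proof.
move=> oU cf.
apply: (@Ck_comp _ 1 U f (fun t => pos t ^+ 3) (fun t => 3 * pos t ^+ 2)) => //.
  by move=> x _; exact: is_derive_pos3.
exact: (CkM oU (Ck_cst 1 3 oU) (Ck_pos2 oU (CkW cf))).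
Qed.

End PositivePart.

(** * A C^2 radial cutoff with explicit derivative bounds *)

Section Cutoff.
Context {R : realType}.
Implicit Types (x y v : R * R) (s eps : R).

Definition sqdist x y : R := (y.1 - x.1) ^+ 2 + (y.2 - x.2) ^+ 2.

Lemma sqdist_ge0 x y : 0 <= sqdist x y.
Proof. by rewrite addr_ge0 ?sqr_ge0. Qed.

Lemma sqdist1_le x y : (y.1 - x.1) ^+ 2 <= sqdist x y.
Proof. by rewrite lerDl sqr_ge0. Qed.

Lemma sqdist2_le x y : (y.2 - x.2) ^+ 2 <= sqdist x y.
Proof. by rewrite lerDr sqr_ge0. Qed.

Lemma le_norm_sqr (a b : R) : 0 <= b -> a ^+ 2 <= b ^+ 2 -> `|a| <= b.
Proof. by move=> b0 ab; rewrite -(ger0_norm b0) -ler_sqr ?nnegrE// !real_normK ?num_real. Qed.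

Lemma sqdist_square x s y : 0 <= s -> sqdist x y <= s ^+ 2 -> square x s y.
Proof.
move=> s0 xy; apply/squareP; split; apply: le_norm_sqr => //.
  exact: le_trans (sqdist1_le x y) xy.
exact: le_trans (sqdist2_le x y) xy.
Qed.

Lemma square_sqdist x s y : square x s y -> sqdist x y <= 2 * s ^+ 2.
Proof.
move=> /squareP[y1 y2].
have s0 : 0 <= s := le_trans (normr_ge0 _) y1.
have h1 : (y.1 - x.1) ^+ 2 <= s ^+ 2.
  by rewrite -real_normK ?num_real// ler_pXn2r ?nnegrE.
have h2 : (y.2 - x.2) ^+ 2 <= s ^+ 2.
  by rewrite -real_normK ?num_real// ler_pXn2r ?nnegrE.
by rewrite /sqdist; lra.
Qed.

Lemma Ck_sqdist n x : Ck n setT (sqdist x).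
Proof.
have c1 : Ck n setT (fun y : R * R => y.1 - x.1).
  exact: (CkB openT (Ck_fst n openT) (Ck_cst n x.1 openT)).
have c2 : Ck n setT (fun y : R * R => y.2 - x.2).
  exact: (CkB openT (Ck_snd n openT) (Ck_cst n x.2 openT)).
apply: (Ck_ext (f := fun y => (y.1 - x.1) * (y.1 - x.1) + (y.2 - x.2) * (y.2 - x.2))).
- exact: openT.
- by move=> y _; rewrite /sqdist !expr2.
- exact: (CkD openT (CkM openT c1 c1) (CkM openT c2 c2)).
Qed.

Definition dsq x y v : R := 2 * ((y.1 - x.1) * v.1 + (y.2 - x.2) * v.2).

Lemma dsq_e1 x y : dsq x y e1 = 2 * (y.1 - x.1).
Proof. by rewrite /dsq /= mulr1 mulr0 addr0. Qed.

Lemma dsq_e2 x y : dsq x y e2 = 2 * (y.2 - x.2).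
Proof. by rewrite /dsq /= mulr1 mulr0 add0r. Qed.

Lemma is_derive_sub1 x y v : is_derive y v (fun z => z.1 - x.1) v.1.
Proof.
apply: is_derive_eq (is_deriveB2 (is_derive_fst y v) (is_deriveC2 x.1 y v)) _.
by rewrite subr0.
Qed.

Lemma is_derive_sub2 x y v : is_derive y v (fun z => z.2 - x.2) v.2.
Proof.
apply: is_derive_eq (is_deriveB2 (is_derive_snd y v) (is_deriveC2 x.2 y v)) _.
by rewrite subr0.
Qed.

Lemma is_derive_sqdist x y v : is_derive y v (sqdist x) (dsq x y v).
Proof.
have d1 := is_derive_sub1 x y v; have d2 := is_derive_sub2 x y v.
rewrite (_ : sqdist x = fun y => (y.1 - x.1) * (y.1 - x.1) + (y.2 - x.2) * (y.2 - x.2)).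
  apply: is_derive_eq (is_deriveD2 (is_deriveM2 d1 d1) (is_deriveM2 d2 d2)) _.
  by rewrite /dsq; ring.
by apply/funext => z; rewrite /sqdist !expr2.
Qed.

Variables (x : R * R) (s : R).
Hypothesis s0 : 0 < s.

Let T y := sqdist x y / s ^+ 2 - 1.
Let H y := 1 - pos (T y) ^+ 3.

                                                                            
                                                                            
(** As a function of the squared distance S it is 1 for S <= s^2 and 0 for S >= 2 s^2. Cubes of
    positive parts make it C^2. [cutoff1] and [cutoff2] are its first and second derivatives with
    respect to S. *)
Definition cutoff y := pos (1 - pos (sqdist x y / s ^+ 2 - 1) ^+ 3) ^+ 3.
Definition cutoff1 y := - (9 / s ^+ 2) *
  (pos (1 - pos (sqdist x y / s ^+ 2 - 1) ^+ 3) ^+ 2 *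
   pos (sqdist x y / s ^+ 2 - 1) ^+ 2).
Definition cutoff2 y := (9 / s ^+ 4) *
  (6 * pos (1 - pos (sqdist x y / s ^+ 2 - 1) ^+ 3) *
     (pos (sqdist x y / s ^+ 2 - 1) ^+ 2 * pos (sqdist x y / s ^+ 2 - 1) ^+ 2)
   - 2 * pos (1 - pos (sqdist x y / s ^+ 2 - 1) ^+ 3) ^+ 2 *
     pos (sqdist x y / s ^+ 2 - 1)).

Let CkT n : Ck n setT T.
Proof.
exact: (CkB openT (CkM openT (Ck_sqdist n x) (Ck_cst n _ openT)) (Ck_cst n 1 openT)).
Qed.

Let CkH : Ck 2 setT H.
Proof. exact: (CkB openT (Ck_cst 2 1 openT) (Ck_pos3 openT (CkT 2))). Qed.

Lemma Ck_cutoff : Ck 2 setT cutoff.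
Proof. exact: (Ck_pos3 openT CkH). Qed.

Lemma Ck_cutoff1 : Ck 1 setT cutoff1.
Proof.
exact: (CkM openT (Ck_cst 1 _ openT) (CkM openT (Ck_pos2 openT (CkW CkH))
  (Ck_pos2 openT (CkT 1)))).
Qed.

Lemma Ck_cutoff2 : Ck 0 setT cutoff2.
Proof.
have p1 := Ck_pos1 (CkT 0); have p2 := CkW (Ck_pos2 openT (CkT 1)).
have h1 := Ck_pos1 (CkW (CkW CkH)); have h2 := CkW (Ck_pos2 openT (CkW CkH)).
exact: (CkM openT (Ck_cst 0 _ openT) (CkB openT
  (CkM openT (CkM openT (Ck_cst 0 6 openT) h1) (CkM openT p2 p2))
  (CkM openT (CkM openT (Ck_cst 0 2 openT) h2) p1))).
Qed.

Let is_derive_T y v : is_derive y v T (dsq x y v / s ^+ 2).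
Proof.
apply: is_derive_eq (is_deriveB2 (is_deriveM2 (is_derive_sqdist x y v)
  (is_deriveC2 (s ^+ 2)^-1 y v)) (is_deriveC2 1 y v)) _.
ring.
Qed.

Let is_derive_H y v :
  is_derive y v H (- (3 * pos (T y) ^+ 2 * (dsq x y v / s ^+ 2))).
Proof.
apply: is_derive_eq (is_deriveB2 (is_deriveC2 1 y v)
  (is_derive_comp2 (is_derive_T y v) (is_derive_pos3 (T y)))) _.
ring.
Qed.

Lemma is_derive_cutoff y v : is_derive y v cutoff (cutoff1 y * dsq x y v).
Proof.
apply: is_derive_eq (is_derive_comp2 (is_derive_H y v) (is_derive_pos3 (H y))) _.
rewrite /cutoff1 /H /T; ring.
Qed.

Lemma is_derive_cutoff1 y v : is_derive y v cutoff1 (cutoff2 y * dsq x y v).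
Proof.
apply: is_derive_eq (is_deriveM2 (is_deriveC2 (- (9 / s ^+ 2)) y v) (is_deriveM2
  (is_derive_comp2 (is_derive_H y v) (is_derive_pos2 (H y)))
  (is_derive_comp2 (is_derive_T y v) (is_derive_pos2 (T y))))) _.
rewrite /cutoff2 /H /T.
have -> : (9 / s ^+ 4) = (9 / s ^+ 2) * (s ^+ 2)^-1.
  by rewrite -mulrA -invfM -exprD.
ring.
Qed.

Lemma cutoff_in y : sqdist x y <= s ^+ 2 ->
  [/\ cutoff y = 1, cutoff1 y = 0 & cutoff2 y = 0].
Proof.
move=> ys; have T0 : sqdist x y / s ^+ 2 - 1 <= 0.
  by rewrite subr_le0 ler_pdivrMr ?mul1r// exprn_gt0.
rewrite /cutoff /cutoff1 /cutoff2 (pos_0 T0) !expr0n /= subr0 !mulr0 subr0 mulr0.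
by rewrite pos_id// expr1n.
Qed.

Lemma cutoff_out y : 2 * s ^+ 2 <= sqdist x y ->
  [/\ cutoff y = 0, cutoff1 y = 0 & cutoff2 y = 0].
Proof.
move=> ys; have T1 : 1 <= sqdist x y / s ^+ 2 - 1.
  by rewrite lerBrDl ler_pdivlMr ?exprn_gt0.
have H0 : 1 - pos (sqdist x y / s ^+ 2 - 1) ^+ 3 <= 0.
  by rewrite subr_le0 pos_id ?(le_trans ler01)// exprn_ege1.
rewrite /cutoff /cutoff1 /cutoff2 (pos_0 H0) !expr0n /= mul0r !mulr0 !mul0r subr0 mulr0.
by [].
Qed.

Let posT_le1 y : sqdist x y <= 2 * s ^+ 2 -> pos (T y) <= 1.
Proof.
move=> ys; apply: pos_le1.
by rewrite /T lerBlDl ler_pdivrMr ?exprn_gt0.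
Qed.

Let posH_le1 y : pos (H y) <= 1.
Proof. by apply: pos_le1; rewrite /H gerBl exprn_ge0// pos_ge0. Qed.

Lemma cutoff_ge0 y : 0 <= cutoff y.
Proof. by rewrite /cutoff exprn_ge0// pos_ge0. Qed.

Lemma cutoff_le1 y : cutoff y <= 1.
Proof. by rewrite /cutoff exprn_ile1// ?pos_ge0 ?posH_le1. Qed.

Lemma cutoff1_bound y : `|cutoff1 y| <= 9 / s ^+ 2.
Proof.
have [ys|/ltW ys] := leP (2 * s ^+ 2) (sqdist x y).
  by have [_ -> _] := cutoff_out ys; rewrite normr0 divr_ge0// exprn_ge0// ltW.
have s2 : 0 <= 9 / s ^+ 2 by rewrite divr_ge0// exprn_ge0// ltW.
rewrite /cutoff1 normrM normrN (ger0_norm s2) ler_piMr//.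
rewrite ger0_norm ?mulr_ge0 ?exprn_ge0 ?pos_ge0//.
by rewrite mulr_ile1 ?exprn_ge0 ?pos_ge0// exprn_ile1 ?pos_ge0 ?posH_le1 ?posT_le1.
Qed.

(** The two terms in the bracket have opposite signs and sizes at most 6 and 2, so the bracket is at
    most 6 in absolute value. *)
Lemma cutoff2_bound y : `|cutoff2 y| <= 54 / s ^+ 4.
Proof.
have s4 : 0 <= 9 / s ^+ 4 by rewrite divr_ge0// exprn_ge0// ltW.
have [ys|/ltW ys] := leP (2 * s ^+ 2) (sqdist x y).
  by have [_ _ ->] := cutoff_out ys; rewrite normr0 divr_ge0// exprn_ge0// ltW.
rewrite /cutoff2 normrM ger0_norm//.
have -> : 54 / s ^+ 4 = 9 / s ^+ 4 * 6 :> R by ring.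
apply: ler_wpM2l => //.
have : pos (H y) <= 1 := posH_le1 y; have : 0 <= pos (H y) := pos_ge0 _.
have : pos (T y) <= 1 := posT_le1 ys; have : 0 <= pos (T y) := pos_ge0 _.
rewrite /H /T; set t := pos (_ / _ - 1); set h := pos (1 - _) => t0 t1 h0 h1.
have A0 : 0 <= h * (t ^+ 2 * t ^+ 2) by rewrite !mulr_ge0 ?exprn_ge0.
have A1 : h * (t ^+ 2 * t ^+ 2) <= 1.
  by rewrite !mulr_ile1 ?mulr_ge0 ?exprn_ge0 ?exprn_ile1.
have B0 : 0 <= h ^+ 2 * t by rewrite !mulr_ge0 ?exprn_ge0.
have B1 : h ^+ 2 * t <= 1 by rewrite mulr_ile1 ?exprn_ge0 ?exprn_ile1.
by rewrite -!mulrA ler_norml; apply/andP; split; lra.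
Qed.

(** Since (3 / 2)^2 >= 2, the cutoff is supported in the square of half-width 3 s / 2, of area 9
    s^2; this is the source of these two constants throughout. *)
Lemma cutoff_out_square y : 3 / 2 * s <= `|y.1 - x.1| \/ 3 / 2 * s <= `|y.2 - x.2| ->
  2 * s ^+ 2 <= sqdist x y.
Proof.
have s1 : 0 <= 3 / 2 * s by have := s0; lra.
have key (t : R) : 3 / 2 * s <= `|t| -> 2 * s ^+ 2 <= t ^+ 2.
  move=> st; apply: (@le_trans _ _ ((3 / 2 * s) ^+ 2)).
    by rewrite exprMn; have := exprn_gt0 2 s0; lra.
  by rewrite -[t ^+ 2]real_normK ?num_real// ler_pXn2r ?nnegrE.
by move=> [/key ys|/key ys]; apply: (le_trans ys);
  [exact: sqdist1_le|exact: sqdist2_le].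
Qed.

End Cutoff.

(** * The regularised gradient of the logarithm *)

Section Kernel.
Context {R : realType}.
Implicit Types (y v : R * R).
Variables (x : R * R) (s eps : R).
Hypotheses (s0 : 0 < s) (eps0 : 0 < eps).

Local Notation S := (sqdist x).
Local Notation cut := (cutoff x s).
Local Notation cut1 := (cutoff1 x s).
Local Notation cut2 := (cutoff2 x s).

Definition mden y : R := sqdist x y + eps ^+ 2.
Local Notation M := mden.

Lemma mden_gt0 y : 0 < M y.
Proof. by rewrite ltr_wpDl ?sqdist_ge0 ?exprn_gt0. Qed.

Lemma mden_neq0 y : M y != 0. Proof. exact: lt0r_neq0 (mden_gt0 y). Qed.

Lemma Ck_mden n : Ck n setT M.
Proof. exact: (CkD openT (Ck_sqdist n x) (Ck_cst n _ openT)). Qed.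

Lemma Ck_mdenV n : Ck n setT (fun y => (M y)^-1).
Proof. by apply: CkV; [exact: openT|move=> y _; exact: mden_neq0|exact: Ck_mden]. Qed.

Lemma is_derive_mden y v : is_derive y v M (dsq x y v).
Proof.
apply: is_derive_eq (is_deriveD2 (is_derive_sqdist x y v) (is_deriveC2 (eps ^+ 2) y v)) _.
by rewrite addr0.
Qed.

Lemma is_derive_mdenV y v :
  is_derive y v (fun y => (M y)^-1) (- (M y) ^- 2 * dsq x y v).
Proof. exact: is_deriveV2 (mden_neq0 y) (is_derive_mden y v). Qed.

(** The field ([kerA], [kerB]) is the gradient of log |y - x|, regularised at scale [eps] and cut
    off at radius [s]. Its divergence splits into [approx_id], a regularised multiple of the delta
    at [x], and [annular], which lives where the cutoff decreases. [annularD] is the derivative of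
    [annular] with respect to the squared distance. *)
Definition kerA y := (y.1 - x.1) * (cutoff x s y / mden y).
Definition kerB y := (y.2 - x.2) * (cutoff x s y / mden y).
Definition approx_id y := 2 * cutoff x s y * eps ^+ 2 * (mden y) ^- 2.
Definition annular y := 2 * sqdist x y * cutoff1 x s y / mden y.
Definition annularD y := 2 * (cutoff1 x s y * eps ^+ 2 * (mden y) ^- 2 +
  sqdist x y * cutoff2 x s y / mden y).
Let W1 y := cut1 y / M y - cut y * (M y) ^- 2.

Let Ck_x1 n : Ck n setT (fun y : R * R => y.1 - x.1).
Proof. exact: (CkB openT (Ck_fst n openT) (Ck_cst n x.1 openT)). Qed.
Let Ck_x2 n : Ck n setT (fun y : R * R => y.2 - x.2).
Proof. exact: (CkB openT (Ck_snd n openT) (Ck_cst n x.2 openT)). Qed.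

Let Ck_W0 : Ck 2 setT (fun y => cut y / M y).
Proof. exact: (CkM openT (Ck_cutoff x s) (Ck_mdenV 2)). Qed.

Lemma Ck_kerA : Ck 2 setT kerA.
Proof. exact: (CkM openT (Ck_x1 2) Ck_W0). Qed.

Lemma Ck_kerB : Ck 2 setT kerB.
Proof. exact: (CkM openT (Ck_x2 2) Ck_W0). Qed.

Lemma Ck_annular : Ck 1 setT annular.
Proof.
exact: (CkM openT (CkM openT (CkM openT (Ck_cst 1 2 openT) (Ck_sqdist 1 x))
  (Ck_cutoff1 x s)) (Ck_mdenV 1)).
Qed.

Lemma approx_idE y : approx_id y = 2 * cut y * eps ^+ 2 * ((M y)^-1 * (M y)^-1).
Proof. by rewrite /approx_id -invfM -expr2. Qed.

Lemma Ck_approx_id : Ck 2 setT approx_id.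
Proof.
have c := CkM openT (CkM openT (CkM openT (Ck_cst 2 2 openT) (Ck_cutoff x s))
  (Ck_cst 2 (eps ^+ 2) openT)) (CkM openT (Ck_mdenV 2) (Ck_mdenV 2)).
by apply: Ck_ext c; [exact: openT|move=> y _; rewrite approx_idE].
Qed.

Let is_derive_W0 y v : is_derive y v (fun y => cut y / M y) (W1 y * dsq x y v).
Proof.
apply: is_derive_eq (is_deriveM2 (is_derive_cutoff x s y v) (is_derive_mdenV y v)) _.
by rewrite /W1; ring.
Qed.

Let D_kerA y v : 'D_v kerA y = v.1 * (cut y / M y) + (y.1 - x.1) * (W1 y * dsq x y v).
Proof.
by have [_ ->] := is_deriveM2 (is_derive_sub1 x y v) (is_derive_W0 y v).
Qed.

Let D_kerB y v : 'D_v kerB y = v.2 * (cut y / M y) + (y.2 - x.2) * (W1 y * dsq x y v).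
Proof.
by have [_ ->] := is_deriveM2 (is_derive_sub2 x y v) (is_derive_W0 y v).
Qed.

(** The field is y - x times a radial function, hence a gradient. *)
Lemma ker_curl y : 'D_e2 kerA y = 'D_e1 kerB y.
Proof.
rewrite D_kerA D_kerB dsq_e1 dsq_e2 [e2.1]/(0 : R) [e1.2]/(0 : R); ring.
Qed.

(** With M = S + eps^2, the terms carrying the cutoff itself combine as 2 / M - 2 S / M^2 = 2 eps^2
    / M^2. *)
Lemma ker_div y : 'D_e1 kerA y + 'D_e2 kerB y = approx_id y + annular y.
Proof.
rewrite D_kerA D_kerB dsq_e1 dsq_e2 [e2.2]/(1 : R) [e1.1]/(1 : R).
rewrite approx_idE /annular /W1.
have E : M y * (M y)^-1 = 1 by rewrite mulfV// mden_neq0.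
have -> : M y ^- 2 = (M y)^-1 * (M y)^-1 by rewrite -invfM -expr2.
have Ee : eps ^+ 2 = M y - sqdist x y by rewrite /mden addrC addKr.
rewrite Ee -[X in X * (cut y / M y)]E.
set m := (M y)^-1 in E *; rewrite /sqdist.
have -> : cut y = cut y * (M y * m) by rewrite E mulr1.
have -> : 2 * (cut y * (M y * m)) * (M y - ((y.1 - x.1) ^+ 2 + (y.2 - x.2) ^+ 2)) * (m * m)
  = 2 * (cut y * (M y * m)) * m * (M y * m) -
    2 * (cut y * (M y * m)) * ((y.1 - x.1) ^+ 2 + (y.2 - x.2) ^+ 2) * (m * m) by ring.
rewrite E; ring.
Qed.

Lemma is_derive_annular y v : is_derive y v annular (annularD y * dsq x y v).
Proof.
apply: is_derive_eq (is_deriveM2 (is_deriveM2 (is_deriveM2 (is_deriveC2 2 y v)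
  (is_derive_sqdist x y v)) (is_derive_cutoff1 x s y v)) (is_derive_mdenV y v)) _.
have E : M y * (M y)^-1 = 1 by rewrite mulfV// mden_neq0.
have Ee : eps ^+ 2 = M y - sqdist x y by rewrite /mden addrC addKr.
have E2 : M y ^- 2 = (M y)^-1 * (M y)^-1 by rewrite -invfM -expr2.
rewrite /annularD E2 Ee; set m := (M y)^-1 in E *.
have -> : cut1 y * (M y - S y) * (m * m) = cut1 y * (M y * m) * m - cut1 y * S y * (m * m).
  by ring.
rewrite E; ring.
Qed.

Lemma ker_out y : 3 / 2 * s <= `|y.1 - x.1| \/ 3 / 2 * s <= `|y.2 - x.2| ->
  [/\ kerA y = 0, kerB y = 0, approx_id y = 0, annular y = 0 & annularD y = 0].
Proof.
move=> /(cutoff_out_square s0)/(cutoff_out s0)[c0 c1 c2].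
by rewrite /kerA /kerB /approx_id /annular /annularD c0 c1 c2 !(mulr0, mul0r, addr0).
Qed.

Lemma D_ker_out y v : 3 / 2 * s <= `|y.1 - x.1| \/ 3 / 2 * s <= `|y.2 - x.2| ->
  'D_v kerA y = 0 /\ 'D_v kerB y = 0.
Proof.
move=> /(cutoff_out_square s0)/(cutoff_out s0)[c0 c1 _].
by rewrite D_kerA D_kerB /W1 c0 c1 !(mulr0, mul0r, addr0, subr0).
Qed.

Lemma approx_id_ge0 y : 0 <= approx_id y.
Proof.
have h : 0 <= M y ^- 2 by rewrite invr_ge0 exprn_ge0// ltW// mden_gt0.
exact: (mulr_ge0 (mulr_ge0 (mulr_ge0 (ler0n _ 2) (cutoff_ge0 x s y)) (sqr_ge0 eps)) h).
Qed.

Lemma approx_id_le y (t : R) : 0 < t -> t <= sqdist x y ->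
  approx_id y <= 2 * eps ^+ 2 / t ^+ 2.
Proof.
move=> t0 ty; rewrite /approx_id; apply: ler_pM.
- exact: (mulr_ge0 (mulr_ge0 (ler0n _ 2) (cutoff_ge0 x s y)) (sqr_ge0 eps)).
- by rewrite invr_ge0 exprn_ge0// ltW// mden_gt0.
- apply: ler_wpM2r; first by rewrite exprn_ge0// ltW.
  by rewrite ler_piMr// cutoff_le1.
- rewrite lef_pV2 ?posrE ?exprn_gt0 ?mden_gt0//.
  rewrite ler_pXn2r ?nnegrE ?(ltW t0) ?(ltW (mden_gt0 _))//.
  by rewrite (le_trans ty)// lerDl exprn_ge0// ltW.
Qed.

(** On this square the cutoff is 1 and [mden] is at most 2 eps^2. Integrated over its area eps^2,
    the bound gives mass at least 1 / 2 near [x]. *)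
Lemma approx_id_lower y : eps <= s -> square x (eps / 2) y ->
  (2 * eps ^+ 2)^-1 <= approx_id y.
Proof.
move=> es /square_sqdist; rewrite exprMn => yS.
have e20 : 0 < eps ^+ 2 by rewrite exprn_gt0.
have h4 : (2^-1 : R) ^+ 2 = 1 / 4 by rewrite expr2; lra.
have yS' : sqdist x y <= eps ^+ 2 / 2 by move: yS; rewrite h4; lra.
have ys : sqdist x y <= s ^+ 2.
  apply: (le_trans yS'); apply: (@le_trans _ _ (eps ^+ 2)); first lra.
  by rewrite ler_pXn2r ?nnegrE ?(ltW eps0) ?(ltW s0).
have [c1 _ _] := cutoff_in s0 ys.
rewrite /approx_id c1 mulr1 -[leLHS]mul1r ler_pdivlMr; last first.
  by rewrite exprn_gt0// mden_gt0.
rewrite mul1r ler_pdivrMl; last by rewrite mulr_gt0.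
have Mle : M y <= 2 * eps ^+ 2 by rewrite /mden; lra.
have -> : 2 * eps ^+ 2 * (2 * eps ^+ 2) = (2 * eps ^+ 2) ^+ 2 by rewrite expr2.
have n1 : 0 <= M y by rewrite ltW// mden_gt0.
by apply: lerXn2r; rewrite ?nnegrE// mulr_ge0// ltW.
Qed.

Let sqrtM y : 0 < Num.sqrt (M y). Proof. by rewrite sqrtr_gt0 mden_gt0. Qed.

Let sqrtM2 y : Num.sqrt (M y) ^+ 2 = M y.
Proof. by rewrite sqr_sqrtr// ltW// mden_gt0. Qed.

Let sub_le_sqrtM y : `|y.1 - x.1| <= Num.sqrt (M y) /\ `|y.2 - x.2| <= Num.sqrt (M y).
Proof.
have h : sqdist x y <= M y by rewrite lerDl exprn_ge0// ltW.
by split; apply: le_norm_sqr; rewrite ?(ltW (sqrtM y))// sqrtM2 (le_trans _ h)//;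
  [exact: sqdist1_le|exact: sqdist2_le].
Qed.

Let ker_bound (t : R) y : `|t| <= Num.sqrt (M y) ->
  `|t * (cut y / M y)| <= cut y / Num.sqrt (M y).
Proof.
move=> tM; rewrite normrM (ger0_norm (divr_ge0 (cutoff_ge0 x s y) (ltW (mden_gt0 y)))).
have -> : cut y / M y = cut y * ((Num.sqrt (M y))^-1 * (Num.sqrt (M y))^-1).
  by rewrite -invfM -expr2 sqrtM2.
rewrite mulrCA; apply: ler_wpM2l; first exact: cutoff_ge0.
rewrite mulrA -[leRHS]mul1r; apply: ler_wpM2r; first by rewrite invr_ge0 ltW.
by rewrite ler_pdivrMr// mul1r.
Qed.

Lemma kerA_bound y : `|kerA y| <= cutoff x s y / Num.sqrt (mden y).
Proof. by apply: ker_bound; have [] := sub_le_sqrtM y. Qed.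

Lemma kerB_bound y : `|kerB y| <= cutoff x s y / Num.sqrt (mden y).
Proof. by apply: ker_bound; have [] := sub_le_sqrtM y. Qed.

Lemma SM_le1 y : 0 <= S y / M y <= 1.
Proof.
rewrite divr_ge0 ?sqdist_ge0 ?(ltW (mden_gt0 y))//= ler_pdivrMr ?mden_gt0// mul1r.
by rewrite lerDl exprn_ge0// ltW.
Qed.

Lemma annular_bound y : `|annular y| <= 18 / s ^+ 2.
Proof.
rewrite /annular.
have -> : 2 * S y * cut1 y / M y = 2 * cut1 y * (S y / M y) by ring.
have /andP[h0 h1] := SM_le1 y.
rewrite normrM (ger0_norm h0) (le_trans (ler_piMr (normr_ge0 _) h1))//.
rewrite normrM ger0_norm//.
have -> : 18 / s ^+ 2 = 2 * (9 / s ^+ 2) :> R by ring.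
by rewrite ler_wpM2l// cutoff1_bound.
Qed.

(** The factor 1 / [mden] is harmless because both terms vanish unless S > s^2; the bound is uniform
    in [eps], and 126 = 2 (9 + 54). *)
Lemma annularD_bound y : `|annularD y| <= 126 / s ^+ 4.
Proof.
have s20 : 0 < s ^+ 2 by rewrite exprn_gt0.
have s40 : 0 <= 126 / s ^+ 4 by rewrite divr_ge0// exprn_ge0// ltW.
have [ys|ys] := leP (S y) (s ^+ 2).
  have [_ c1 c2] := cutoff_in s0 ys.
  by rewrite /annularD c1 c2 !(mulr0, mul0r, addr0) normr0.
have B1 : `|cut1 y * eps ^+ 2 * M y ^- 2| <= 9 / s ^+ 4.
  have -> : cut1 y * eps ^+ 2 * M y ^- 2 = cut1 y * ((eps ^+ 2 / M y) * (M y)^-1).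
    by rewrite -!mulrA -invfM -expr2.
  have -> : 9 / s ^+ 4 = 9 / s ^+ 2 * (s ^+ 2)^-1 :> R by rewrite -mulrA -invfM -exprD.
  rewrite normrM; apply: ler_pM => //; first exact: cutoff1_bound.
  have e1M : 0 <= eps ^+ 2 / M y by rewrite divr_ge0 ?exprn_ge0 ?(ltW (mden_gt0 y)) ?(ltW eps0).
  rewrite ger0_norm; last by rewrite mulr_ge0// invr_ge0 ltW// mden_gt0.
  rewrite -[leRHS]mul1r; apply: ler_pM => //; first by rewrite invr_ge0 ltW// mden_gt0.
    by rewrite ler_pdivrMr ?mden_gt0// mul1r lerDr sqdist_ge0.
  rewrite lef_pV2 ?posrE ?mden_gt0//.
  by rewrite (le_trans (ltW ys))// lerDl exprn_ge0// ltW.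
have B2 : `|S y * cut2 y / M y| <= 54 / s ^+ 4.
  have -> : S y * cut2 y / M y = cut2 y * (S y / M y) by ring.
  have /andP[h0 h1] := SM_le1 y.
  rewrite normrM (ger0_norm h0) (le_trans (ler_piMr (normr_ge0 _) h1))//.
  exact: cutoff2_bound.
rewrite /annularD normrM ger0_norm//.
have -> : 126 / s ^+ 4 = 2 * (9 / s ^+ 4 + 54 / s ^+ 4) :> R by ring.
by rewrite ler_wpM2l// (le_trans (ler_normD _ _))// lerD.
Qed.

Let D_annular_bound (t : R) y : `|t| <= 3 / 2 * s \/ annularD y = 0 ->
  `|annularD y * (2 * t)| <= 378 / s ^+ 3.
Proof.
have s30 : 0 <= 378 / s ^+ 3 := divr_ge0 (ler0n _ 378) (exprn_ge0 3 (ltW s0)).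
move=> [ts|->]; last by rewrite mul0r normr0.
have -> : 378 / s ^+ 3 = 126 / s ^+ 4 * (2 * (3 / 2 * s)).
  by field; exact: lt0r_neq0.
rewrite normrM; apply: ler_pM => //; first exact: annularD_bound.
by rewrite normrM ger0_norm// ler_wpM2l.
Qed.

Lemma D1_annular_bound y : `|'D_e1 annular y| <= 378 / s ^+ 3.
Proof.
have [_ ->] := is_derive_annular y e1; rewrite dsq_e1; apply: D_annular_bound.
have [/(fun h => ker_out (or_introl h))[_ _ _ _ ->]|/ltW] := leP (3 / 2 * s) `|y.1 - x.1|.
  by right.
by left.
Qed.

Lemma D2_annular_bound y : `|'D_e2 annular y| <= 378 / s ^+ 3.
Proof.
have [_ ->] := is_derive_annular y e2; rewrite dsq_e2; apply: D_annular_bound.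
have [/(fun h => ker_out (or_intror h))[_ _ _ _ ->]|/ltW] := leP (3 / 2 * s) `|y.2 - x.2|.
  by right.
by left.
Qed.

Lemma annular_supp y : annular y != 0 \/ annularD y != 0 ->
  s ^+ 2 < sqdist x y < 2 * s ^+ 2.
Proof.
move=> h; apply/andP; split; rewrite ltNge; apply/negP.
  move=> /(cutoff_in s0)[_ c1 c2]; move: h.
  by rewrite /annular /annularD c1 c2 !(mulr0, mul0r, addr0) eqxx; case.
move=> /(cutoff_out s0)[_ c1 c2]; move: h.
by rewrite /annular /annularD c1 c2 !(mulr0, mul0r, addr0) eqxx; case.
Qed.

Lemma D_annular_supp y v : 'D_v annular y != 0 ->
  s ^+ 2 < sqdist x y < 2 * s ^+ 2.
Proof.
have [_ ->] := is_derive_annular y v => h; apply: annular_supp; right.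
by apply: contra_neq h => ->; rewrite mul0r.
Qed.

End Kernel.

(** * Kernel integrals, potentials, and recovery of point values *)

Section KernelEstimates.
Context {R : realType}.
Implicit Types (y : R * R) (U : set (R * R)) (F G u : R * R -> R).
Variables (p : R * R) (a : R).
Hypothesis a0 : 0 < a.
Let Q := square p a.
Let a_ge0 : 0 <= a. Proof. exact: ltW. Qed.

(** The square carrying the support of the cutoff at [x] of radius [s] fits into the domain of
    integration, so all kernels vanish on the edges of the latter. *)
Definition inside (x : R * R) (s : R) :=
  `|x.1 - p.1| + 3 / 2 * s <= a /\ `|x.2 - p.2| + 3 / 2 * s <= a.

Lemma insideW x (s t : R) : t <= s -> inside x s -> inside x t.
Proof. by move=> ts [h1 h2]; split; [move: h1|move: h2]; move: ts; lra. Qed.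

Lemma inside_square x (s : R) : inside x s -> square x (3 / 2 * s) `<=` Q.
Proof. by move=> [h1 h2]; exact: square_sub. Qed.

Let edge_far (b c q t : R) : `|b - q| + t <= c -> forall z : R, `|z - q| = c -> t <= `|z - b|.
Proof.
move=> h z zc; have := ler_normD (z - b) (b - q); rewrite subrKA zc; move: h; lra.
Qed.

Lemma inside_edge1 x s y : inside x s -> `|y.1 - p.1| = a -> 3 / 2 * s <= `|y.1 - x.1|.
Proof. by move=> [h _]; exact: edge_far. Qed.

Lemma inside_edge2 x s y : inside x s -> `|y.2 - p.2| = a -> 3 / 2 * s <= `|y.2 - x.2|.
Proof. by move=> [_ h]; exact: edge_far. Qed.

Lemma not_square_far (x : R * R) (s : R) y : ~ square x s y ->
  s <= `|y.1 - x.1| \/ s <= `|y.2 - x.2|.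
Proof.
move=> ny; have [h1|h1] := leP s `|y.1 - x.1|; first by left.
have [h2|h2] := leP s `|y.2 - x.2|; first by right.
by case: ny; apply/squareP; split; exact: ltW.
Qed.

Lemma Ck_cont_onT n A F : Ck n setT F -> cont_on A F.
Proof. by move=> cF; apply: (Ck_cont_on (U := setT)) cF. Qed.

Let div_cutoff_gradient (c c1 m t1 t2 : R) : m != 0 ->
  (1 * (c * m^-1) + t1 * ((c1 * (2 * t1)) * m^-1 + c * (- m ^- 2 * ((2 * m)^-1 * (2 * t1))))) +
  (1 * (c * m^-1) + t2 * ((c1 * (2 * t2)) * m^-1 + c * (- m ^- 2 * ((2 * m)^-1 * (2 * t2))))) =
  c / m * (2 - (t1 ^+ 2 + t2 ^+ 2) / m ^+ 2) + 2 * (t1 ^+ 2 + t2 ^+ 2) * c1 / m.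
Proof. by move=> m0; field. Qed.

                                                                                
                                                                             
(** Replaces polar coordinates. With m = sqrt M, the field (y - x) cutoff / m has divergence cutoff
    / m (2 - S / m^2) plus a term with [cutoff1]. The first part is at least cutoff / m, as S <=
    m^2, and the total integrates to 0. *)
Lemma sqint_inv_dist x (s eps : R) : 0 < s -> 0 < eps -> inside x s ->
  sqint p a (fun y => cutoff x s y / Num.sqrt (mden x eps y)) <= 243 * s.
Proof.
move=> s0 e0 ins.
pose m y := Num.sqrt (mden x eps y).
have m_gt0 y : 0 < m y by rewrite sqrtr_gt0 mden_gt0.
have m2 y : m y ^+ 2 = mden x eps y by rewrite sqr_sqrtr// ltW// mden_gt0.
have Ckm n : Ck n setT m.
  by apply: Ck_sqrt; [exact: openT|move=> y _; exact: mden_gt0|exact: Ck_mden].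
have CkmV n : Ck n setT (fun y => (m y)^-1).
  by apply: CkV; [exact: openT|move=> y _; exact: lt0r_neq0|exact: Ckm].
have CkcV : Ck 1 setT (fun y => cutoff x s y / m y).
  exact: (CkM openT (CkW (Ck_cutoff x s)) (CkmV 1%N)).
have Ckc1V : Ck 1 setT (fun y => 2 * sqdist x y * cutoff1 x s y / m y).
  exact: (CkM openT (CkM openT (CkM openT (Ck_cst 1 2 openT) (Ck_sqdist 1 x))
    (Ck_cutoff1 x s)) (CkmV 1%N)).
have Ckx1 : Ck 1 setT (fun y : R * R => y.1 - x.1).
  exact: (CkB openT (Ck_fst 1 openT) (Ck_cst 1 x.1 openT)).
have Ckx2 : Ck 1 setT (fun y : R * R => y.2 - x.2).
  exact: (CkB openT (Ck_snd 1 openT) (Ck_cst 1 x.2 openT)).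
have dmV y v : is_derive y v (fun y => (m y)^-1) (- (m y) ^- 2 * ((2 * m y)^-1 * dsq x y v)).
  apply: is_deriveV2; first exact: lt0r_neq0.
  exact: (is_derive_comp2 (is_derive_mden x eps y v) (is_derive1_sqrt (mden_gt0 x e0 y))).
pose H y := cutoff x s y / m y * (2 - sqdist x y / m y ^+ 2) +
  2 * sqdist x y * cutoff1 x s y / m y.
have H0 : sqint p a H = 0.
  apply: (@sqint_div _ p a a_ge0 setT (fun y => (y.1 - x.1) * (cutoff x s y / m y))
    (fun y => (y.2 - x.2) * (cutoff x s y / m y)) H openT a0).
  - exact: subsetT.
  - exact: (CkM openT Ckx1 CkcV).
  - exact: (CkM openT Ckx2 CkcV).
  - move=> y _ ya; have /(cutoff_out_square s0)/(cutoff_out s0)[-> _ _] :=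
      or_introl (3 / 2 * s <= `|y.2 - x.2|) (inside_edge1 ins ya).
    by rewrite mul0r mulr0.
  - move=> y _ ya; have /(cutoff_out_square s0)/(cutoff_out s0)[-> _ _] :=
      or_intror (3 / 2 * s <= `|y.1 - x.1|) (inside_edge2 ins ya).
    by rewrite mul0r mulr0.
  - move=> y _.
    have [_ d1] := is_deriveM2 (is_derive_sub1 x y e1)
      (is_deriveM2 (is_derive_cutoff x s y e1) (dmV y e1)).
    have [_ d2] := is_deriveM2 (is_derive_sub2 x y e2)
      (is_deriveM2 (is_derive_cutoff x s y e2) (dmV y e2)).
    apply: etrans (esym (congr2 +%R d1 d2)).
    rewrite dsq_e1 dsq_e2 /H /sqdist; apply: esym; apply: div_cutoff_gradient.
    exact: lt0r_neq0.
have c1 : cont_on Q (fun y => cutoff x s y / m y) by apply: Ck_cont_onT CkcV.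
have c2 : cont_on Q (fun y => 2 * sqdist x y * cutoff1 x s y / m y).
  by apply: Ck_cont_onT Ckc1V.
have cH : cont_on Q H.
  apply: (@Ck_cont_onT 0).
  have cc : Ck 0 setT (fun y => cutoff x s y / m y *
      (2 - sqdist x y * ((m y)^-1 * (m y)^-1)) + 2 * sqdist x y * cutoff1 x s y / m y).
    exact: (CkD openT (CkM openT (CkW CkcV) (CkB openT (Ck_cst 0 2 openT)
      (CkM openT (Ck_sqdist 0 x) (CkM openT (CkmV 0%N) (CkmV 0%N))))) (CkW Ckc1V)).
  by apply: Ck_ext cc; [exact: openT|move=> y _; rewrite /H -invfM -expr2].
apply: (@le_trans _ _ (sqint p a (fun y => H y - 2 * sqdist x y * cutoff1 x s y / m y))).
  apply: le_sqint => //; first by apply: cont_onB.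
  move=> y _; rewrite /H addrK ler_peMr ?divr_ge0 ?cutoff_ge0 ?(ltW (m_gt0 y))//.
  rewrite lerBrDr -lerBrDl -[leRHS]/(2 - 1 : R) (_ : 2 - 1 = 1 :> R); last by ring.
  by rewrite ler_pdivrMr ?exprn_gt0// mul1r m2 /mden lerDl exprn_ge0// ltW.
rewrite sqintB// H0 sub0r (le_trans (ler_norm _))// normrN.
(* Height times area: 27 / s is the product of |[cutoff1]| <= 9 / s^2 and 2 S / m <= 2 sqrt S <= 3
   s. *)
have -> : 243 * s = 27 / s * (4 * (3 / 2 * s) ^+ 2) by field; exact: lt0r_neq0.
apply: sqint_supp => //.
- by rewrite mulr_ge0 ?ltW// divr_gt0.
- by rewrite divr_ge0 ?ltW.
- exact: (inside_square ins).
- move=> y _; have [ys|/ltW ys] := leP (2 * s ^+ 2) (sqdist x y).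
    by have [_ -> _] := cutoff_out s0 ys; rewrite mulr0 mul0r normr0 divr_ge0 ?ltW.
  have -> : 2 * sqdist x y * cutoff1 x s y / m y =
    cutoff1 x s y * (2 * (sqdist x y / m y)) by ring.
  have -> : 27 / s = 9 / s ^+ 2 * (2 * (3 / 2 * s)) by field; exact: lt0r_neq0.
  rewrite normrM; apply: ler_pM => //; first exact: cutoff1_bound.
  rewrite ger0_norm ?mulr_ge0 ?invr_ge0 ?sqdist_ge0 ?(ltW (m_gt0 y))//.
  apply: ler_wpM2l => //; rewrite ler_pdivrMr//.
  have mS : Num.sqrt (sqdist x y) <= m y.
    by apply: ler_wsqrtr; rewrite lerDl exprn_ge0// ltW.
  have Ss : Num.sqrt (sqdist x y) <= 3 / 2 * s.
    have h : 0 <= 3 / 2 * s by move: s0; lra.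
    rewrite -(ger0_norm h) -sqrtr_sqr ler_sqrt ?sqr_ge0// (le_trans ys)//.
    by rewrite exprMn; have := exprn_gt0 2 s0; lra.
  rewrite -{1}(sqr_sqrtr (sqdist_ge0 x y)) expr2.
  by apply: ler_pM => //; rewrite sqrtr_ge0.
- move=> y _ /not_square_far /(cutoff_out_square s0)/(cutoff_out s0)[_ -> _].
  by rewrite mulr0 mul0r.
Qed.

(** Split at distance [t] from [x]: inside, [F] is at most [K] and the kernel integrates to at most
    243 t; outside, the kernel is at most 1 / t and only the mass of [F] counts. *)
Lemma sqint_potential x (s t eps K : R) F : 0 < t -> t <= s -> 0 < eps -> 0 <= K ->
  inside x s -> cont_on Q F -> (forall y, Q y -> 0 <= F y) ->
  (forall y, Q y -> sqdist x y <= t ^+ 2 -> F y <= K) ->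
  sqint p a (fun y => F y * (cutoff x s y / Num.sqrt (mden x eps y))) <=
  243 * K * t + t^-1 * sqint p a (fun y => F y * cutoff x s y).
Proof.
move=> t0 ts e0 K0 ins cF F0 FK.
have s0 : 0 < s := lt_le_trans t0 ts.
have m_gt0 y : 0 < Num.sqrt (mden x eps y) by rewrite sqrtr_gt0 mden_gt0.
have cm (r : R) : cont_on Q (fun y => cutoff x r y / Num.sqrt (mden x eps y)).
  apply: (@Ck_cont_onT 1); apply: (CkM openT (CkW (Ck_cutoff x r))).
  apply: CkV; [exact: openT|move=> y _; exact: lt0r_neq0|].
  by apply: Ck_sqrt; [exact: openT|move=> y _; exact: mden_gt0|exact: Ck_mden].
have cc : cont_on Q (cutoff x s) by apply: Ck_cont_onT (Ck_cutoff x s).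
have cKt : cont_on Q (fun y => K * (cutoff x t y / Num.sqrt (mden x eps y))).
  by apply: cont_onM => //; exact: cont_on_cst.
have cFt : cont_on Q (fun y => t^-1 * (F y * cutoff x s y)).
  by apply: cont_onM; [exact: cont_on_cst|exact: cont_onM].
apply: (@le_trans _ _ (sqint p a (fun y =>
    K * (cutoff x t y / Num.sqrt (mden x eps y)) + t^-1 * (F y * cutoff x s y)))).
  apply: le_sqint => //; [exact: cont_onM|exact: cont_onD|].
  move=> y Qy; have Fc : 0 <= F y * cutoff x s y by rewrite mulr_ge0 ?F0 ?cutoff_ge0.
  have [yt|/ltW yt] := leP (sqdist x y) (t ^+ 2).
    rewrite -[leLHS]addr0; apply: lerD; last by rewrite mulr_ge0// invr_ge0 ltW.
    apply: ler_pM; rewrite ?F0 ?FK ?divr_ge0 ?cutoff_ge0 ?(ltW (m_gt0 y))//.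
    have [-> _ _] := cutoff_in t0 yt; rewrite ler_pM2r ?invr_gt0//.
    exact: cutoff_le1.
  rewrite -[leLHS]add0r; apply: lerD.
    by rewrite mulr_ge0// divr_ge0 ?cutoff_ge0// ltW.
  rewrite mulrA mulrC; apply: ler_wpM2r => //.
  rewrite lef_pV2 ?posrE//.
  rewrite -(ger0_norm (ltW t0)) -sqrtr_sqr ler_sqrt ?ltW ?mden_gt0//.
  by rewrite (le_lt_trans yt)// ltrDl exprn_gt0.
rewrite sqintD// sqintZ// sqintZ//; last exact: cont_onM.
rewrite lerD2r -mulrA mulrCA; apply: ler_wpM2l => //.
by apply: sqint_inv_dist => //; exact: insideW ins.
Qed.

(** If h x > 0, then h >= h x / 2 near [x], where [approx_id] has mass at least 1 / 2, while away
    from [x] it is O(eps^2). Hence h x / 4 <= B + O(eps^2), and [eps] is arbitrary. The loss of a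
    constant factor spares the exact mass of [approx_id]. *)
Lemma approx_id_pointwise_pos x (s B : R) h : 0 < s -> inside x s -> cont_on Q h ->
  (forall eps, 0 < eps -> eps <= s ->
     `|sqint p a (fun y => h y * approx_id x s eps y)| <= B) ->
  h x <= 4 * B.
Proof.
move=> s0 ins ch hB.
have s32 : 0 <= 3 / 2 * s by move: s0; lra.
have Qx : Q x by apply: (inside_square ins); exact: square_center.
have B0 : 0 <= B := le_trans (normr_ge0 _) (hB s s0 (lexx s)).
have [hx|hx] := leP (h x) 0; first by rewrite (le_trans hx)// mulr_ge0.
have [Hb HbP] := cont_on_bounded (@square_compact _ p a) ch.
have [r r0 rh] : exists2 r, 0 < r & square x r `<=` [set y | h x / 2 <= h y].
  apply: near_square.
  have hx2 : 0 < h x / 2 by rewrite divr_gt0.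
  move: (ch x Qx) => /cvgrPdist_lt /(_ _ hx2).
  by apply: filterS => y /=; rewrite ltr_norml => /andP[h1 h2]; move: h2; lra.
(* Collects the error away from [x], where [approx_id] is at most 2 eps^2 / r^4, over the whole
   square of area 4 a^2. *)
pose K := (Hb + h x / 2) * (2 / r ^+ 4) * (4 * a ^+ 2).
have Hb0 : 0 <= Hb := le_trans (normr_ge0 _) (HbP x Qx).
have K0 : 0 <= K.
  rewrite /K !mulr_ge0 ?invr_ge0 ?exprn_ge0 ?(ltW r0) ?(ltW a0)//.
  by rewrite addr_ge0// divr_ge0 ?(ltW hx).
have key eps : 0 < eps -> eps <= s -> h x / 4 <= B + K * eps ^+ 2.
  move=> e0 es.
  have ca : cont_on Q (approx_id x s eps) by apply: Ck_cont_onT (Ck_approx_id x s e0).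
  have ap1 : 1 / 2 <= sqint p a (approx_id x s eps).
    have -> : 1 / 2 = (2 * eps ^+ 2)^-1 * (4 * (eps / 2) ^+ 2) :> R.
      by field; exact: lt0r_neq0.
    apply: sqint_lower => //.
    - by rewrite divr_ge0 ?ltW.
    - apply: square_sub; have [h1 h2] := ins; [move: h1|move: h2]; move: es e0; lra.
    - by move=> y _; exact: approx_id_ge0.
    - by move=> y; exact: approx_id_lower.
  have lb : sqint p a (fun y => h x / 2 * approx_id x s eps y -
      (Hb + h x / 2) * (2 * eps ^+ 2 / r ^+ 4)) <=
      sqint p a (fun y => h y * approx_id x s eps y).
    apply: le_sqint => //.
    - by apply: cont_onB; [apply: cont_onM => //|]; exact: cont_on_cst.
    - exact: cont_onM.
    - move=> y Qy.
      have ay := approx_id_ge0 x s e0 y.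
      have [yr|yr] := pselect (square x r y).
        rewrite lerBlDr -[leLHS]addr0; apply: lerD.
          by apply: ler_wpM2r => //; exact: rh.
        rewrite !mulr_ge0 ?invr_ge0 ?exprn_ge0 ?(ltW r0) ?(ltW e0)//.
        by rewrite addr_ge0// divr_ge0 ?(ltW hx).
      have ry : r ^+ 2 <= sqdist x y.
        rewrite leNgt; apply/negP => /ltW /sqdist_square; apply: contra_not yr.
        by apply; exact: ltW.
      have r20 : 0 < r ^+ 2 by rewrite exprn_gt0.
      have := approx_id_le s e0 r20 ry; rewrite -exprM => ale.
      rewrite lerBlDr -lerBlDl -mulrBl.
      apply: (@le_trans _ _ ((h x / 2 + Hb) * approx_id x s eps y)).
        apply: ler_wpM2r => //; rewrite lerD2l lerNl.
        by have := HbP y Qy; rewrite ler_norml => /andP[].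
      rewrite [h x / 2 + _]addrC; apply: ler_wpM2l => //.
      by rewrite addr_ge0// divr_ge0 ?(ltW hx).
  have := hB eps e0 es; rewrite ler_norml => /andP[_ ub].
  have := le_trans lb ub.
  rewrite sqintB; [|exact: a_ge0|by apply: cont_onM => //; exact: cont_on_cst|exact: cont_on_cst].
  rewrite sqintZ//.
  have -> : sqint p a (fun=> (Hb + h x / 2) * (2 * eps ^+ 2 / r ^+ 4)) = K * eps ^+ 2.
    rewrite /sqint Rintegral_cst; last exact: square_measurable.
    by rewrite (@square_measure R p a)//= /K; ring.
  have : h x / 2 * (1 / 2) <= h x / 2 * sqint p a (approx_id x s eps).
    by apply: ler_wpM2l => //; rewrite divr_ge0 ?(ltW hx).
  by move: K0 => _; lra.
suff : h x / 4 <= B by lra.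
apply/ler_addgt0Pl => e e0.
have [K1|K1] := leP K 0.
  have K00 : K = 0 by apply/eqP; rewrite eq_le K1.
  by have := key s s0 (lexx s); rewrite K00 mul0r addr0; move: e0; lra.
(* Chosen so that K eps^2 <= e. *)
pose eps := Num.min s (Num.sqrt (e / K)).
have eK : 0 < e / K by rewrite divr_gt0.
have eps0 : 0 < eps by rewrite lt_min s0 sqrtr_gt0.
have := key eps eps0; rewrite ge_min lexx => /(_ isT) /le_trans; apply.
rewrite addrC lerD2r mulrC -ler_pdivlMr//.
rewrite -[leRHS]sqr_sqrtr ?(ltW eK)//; apply: lerXn2r; rewrite ?nnegrE ?sqrtr_ge0 ?(ltW eps0)//.
by rewrite ge_min lexx orbT.
Qed.

Lemma approx_id_pointwise x (s B : R) h : 0 < s -> inside x s -> cont_on Q h ->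
  (forall eps, 0 < eps -> eps <= s ->
     `|sqint p a (fun y => h y * approx_id x s eps y)| <= B) ->
  `|h x| <= 4 * B.
Proof.
move=> s0 ins ch hB; rewrite ler_norml; apply/andP; split; last first.
  exact: approx_id_pointwise_pos hB.
rewrite lerNl; apply: (@approx_id_pointwise_pos x s B (fun y => - h y)) => //.
  exact: cont_onN.
move=> eps e0 es.
have -> : sqint p a (fun y => - h y * approx_id x s eps y) =
  sqint p a (fun y => -1 * (h y * approx_id x s eps y)).
  by apply: eq_sqint => y _; rewrite mulN1r mulNr.
rewrite sqintZ//; first by rewrite mulN1r normrN; exact: hB.
by apply: cont_onM => //; apply: Ck_cont_onT (Ck_approx_id x s e0).
Qed.

End KernelEstimates.

(** * Integral identities for the gradient and for the Hopf differential *)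

Section InteriorEstimates.
Context {R : realType}.
Implicit Types (y : R * R) (F G u : R * R -> R).
Variables (U : set (R * R)) (p : R * R) (a : R).
Hypotheses (oU : open U) (a0 : 0 < a) (QU : square p a `<=` U).
Let a_ge0 : 0 <= a. Proof. exact: ltW. Qed.

Let CkT n F : Ck n setT F -> Ck n U F.
Proof. by apply: Ck_subset => y _. Qed.

Section Identities.

(** Expansion of a divergence with all partials abstracted to real variables; symmetry of second
    derivatives and the curl and divergence of the kernel enter as hypotheses. The next three
    identities are of the same kind. *)
Lemma div_identity1 (u11 u12 u21 u22 u1 u2 A1 A2 B1 B2 an1 ap an A B u0 : R) :
  u12 = u21 -> A2 = B1 -> ap = A1 + B2 - an ->
  u1 * ap + (u11 + u22) * A - u0 * an1 =
  u11 * A + u1 * A1 - (u12 * B + u2 * B1) - (u1 * an + u0 * an1) +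
  (u22 * A + u2 * A2 + (u21 * B + u1 * B2)).
Proof. by move=> -> -> ->; ring. Qed.

Lemma div_identity2 (u11 u12 u21 u22 u1 u2 A1 A2 B1 B2 an2 ap an A B u0 : R) :
  u12 = u21 -> A2 = B1 -> ap = A1 + B2 - an ->
  u2 * ap + (u11 + u22) * B - u0 * an2 =
  u11 * B + u1 * B1 + (u12 * A + u2 * A1) +
  (u22 * B + u2 * B2 - (u21 * A + u1 * A2) - (u2 * an + u0 * an2)).
Proof. by move=> -> -> ->; ring. Qed.

Lemma hopfA_identity (v1 v2 v11 v12 v21 v22 f f1 f2 N1 N2 A A1 A2 A12 A21
    B B1 B2 B12 B21 an an1 an2 ap : R) :
  v12 = v21 -> A2 = B1 -> ap = A1 + B2 - an -> A12 = A21 -> B12 = B21 ->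
  f = - (v11 + v22) -> f1 = f * v1 + N1 -> f2 = f * v2 + N2 ->
  (v11 - v22 - 2^-1 * (v1 * v1 - v2 * v2)) * ap - (N1 * A - N2 * B) - v1 * an1 + v2 * an2
    - 2^-1 * (v1 * v1 - v2 * v2) * an =
  ((0 * (v1 * B2) + 2 * (v11 * B2 + v1 * B12)) +
   (0 * (v2 * A2) + 2 * (v12 * A2 + v2 * A12)) - (f1 * A + f * A1)
   - ((0 * (v1 * v1 - v2 * v2) + 2^-1 * ((v11 * v1 + v1 * v11) - (v12 * v2 + v2 * v12))) * A
       + 2^-1 * (v1 * v1 - v2 * v2) * A1)
   + ((v11 * v2 + v1 * v12) * B + v1 * v2 * B1) - (v11 * an + v1 * an1)) +
  ((f2 * B + f * B2) - (0 * (v2 * A1) + 2 * (v22 * A1 + v2 * A21))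
   - (0 * (v1 * B1) + 2 * (v21 * B1 + v1 * B21))
   - ((0 * (v1 * v1 - v2 * v2) + 2^-1 * ((v21 * v1 + v1 * v21) - (v22 * v2 + v2 * v22))) * B
       + 2^-1 * (v1 * v1 - v2 * v2) * B2)
   - ((v21 * v2 + v1 * v22) * A + v1 * v2 * A2) + (v22 * an + v2 * an2)).
Proof. by move=> -> -> -> -> -> E -> ->; rewrite E; field. Qed.

Lemma hopfB_identity (v1 v2 v11 v12 v21 v22 f f1 f2 N1 N2 A A1 A2 A12 A21
    B B1 B2 B12 B21 an an1 an2 ap : R) :
  v12 = v21 -> A2 = B1 -> ap = A1 + B2 - an -> A12 = A21 -> B12 = B21 ->
  f = - (v11 + v22) -> f1 = f * v1 + N1 -> f2 = f * v2 + N2 ->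
  (- 2 * v12 + v1 * v2) * ap + (N1 * B + N2 * A) + v2 * an1 + v1 * an2 + v1 * v2 * an =
  ((0 * (v1 * A2) + 2 * (v11 * A2 + v1 * A12)) -
   (0 * (v2 * B2) + 2 * (v12 * B2 + v2 * B12)) + (f1 * B + f * B1)
   + ((0 * (v1 * v1 - v2 * v2) + 2^-1 * ((v11 * v1 + v1 * v11) - (v12 * v2 + v2 * v12))) * B
       + 2^-1 * (v1 * v1 - v2 * v2) * B1)
   + ((v11 * v2 + v1 * v12) * A + v1 * v2 * A1) + (v12 * an + v2 * an1)) +
  ((f2 * A + f * A2) - (0 * (v1 * A1) + 2 * (v21 * A1 + v1 * A21))
   + (0 * (v2 * B1) + 2 * (v22 * B1 + v2 * B21))
   - ((0 * (v1 * v1 - v2 * v2) + 2^-1 * ((v21 * v1 + v1 * v21) - (v22 * v2 + v2 * v22))) * A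
       + 2^-1 * (v1 * v1 - v2 * v2) * A2)
   + ((v21 * v2 + v1 * v22) * B + v1 * v2 * B2) + (v21 * an + v1 * an2)).
Proof. by move=> -> -> -> -> -> E -> ->; rewrite E; field. Qed.

Variables (x : R * R) (s eps : R).
Hypotheses (s0 : 0 < s) (e0 : 0 < eps) (ins : inside p a x s).

Local Notation kA := (kerA x s eps).
Local Notation kB := (kerB x s eps).
Local Notation ap := (approx_id x s eps).
Local Notation an := (annular x s eps).

Let cA : Ck 2 U kA. Proof. exact: CkT (Ck_kerA x s e0). Qed.
Let cB : Ck 2 U kB. Proof. exact: CkT (Ck_kerB x s e0). Qed.
Let cN : Ck 1 U an. Proof. exact: CkT (Ck_annular x s e0). Qed.

Let edge1 y : `|y.1 - p.1| = a -> [/\ kA y = 0, kB y = 0 & an y = 0].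
Proof.
by move=> /(inside_edge1 ins) h; have [-> -> _ -> _] := ker_out eps s0 (or_introl h).
Qed.

Let edge2 y : `|y.2 - p.2| = a -> [/\ kA y = 0, kB y = 0 & an y = 0].
Proof.
by move=> /(inside_edge2 ins) h; have [-> -> _ -> _] := ker_out eps s0 (or_intror h).
Qed.

(** Representation of a partial derivative by the Laplacian against the kernel and by values of [u]
    on the annulus. The field is chosen so that the mixed second derivatives of [u] cancel and the
    kernel is differentiated only through its divergence and curl. *)
Lemma D1_approx_id u : Ck 2 U u ->
  sqint p a (fun y => 'D_e1 u y * ap y + laplacian u y * kA y - u y * 'D_e1 an y) = 0.
Proof.
move=> cu.
have cu1 := Ck_D1 cu; have cu2 := Ck_D2 cu.
have cA1 := CkW cA; have cB1 := CkW cB.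
apply: (@sqint_div _ p a a_ge0 U
  (fun y => 'D_e1 u y * kA y - 'D_e2 u y * kB y - u y * an y)
  (fun y => 'D_e2 u y * kA y + 'D_e1 u y * kB y) _ oU a0 QU).
- exact: (CkB oU (CkB oU (CkM oU cu1 cA1) (CkM oU cu2 cB1)) (CkM oU (CkW cu) cN)).
- exact: (CkD oU (CkM oU cu2 cA1) (CkM oU cu1 cB1)).
- by move=> y _ /edge1[-> -> ->]; rewrite !mulr0 !subr0.
- by move=> y _ /edge2[-> -> _]; rewrite !mulr0 addr0.
move=> y Qy; have Uy := QU Qy.
have [_ dF] := is_deriveB2 (is_deriveB2
  (is_deriveM2 (Ck_is_derive1 cu1 Uy) (Ck_is_derive1 cA1 Uy))
  (is_deriveM2 (Ck_is_derive1 cu2 Uy) (Ck_is_derive1 cB1 Uy)))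
  (is_deriveM2 (Ck_is_derive1 cu Uy) (Ck_is_derive1 cN Uy)).
have [_ dG] := is_deriveD2
  (is_deriveM2 (Ck_is_derive2 cu2 Uy) (Ck_is_derive2 cA1 Uy))
  (is_deriveM2 (Ck_is_derive2 cu1 Uy) (Ck_is_derive2 cB1 Uy)).
apply: etrans (esym (congr2 +%R dF dG)).
have div : ap y = 'D_e1 kA y + 'D_e2 kB y - an y by rewrite ker_div// addrK.
exact: (div_identity1 ('D_e1 ('D_e1 u) y) ('D_e2 ('D_e2 u) y) ('D_e1 u y)
  ('D_e2 u y) ('D_e1 an y) (kA y) (kB y) (u y) (schwarz oU cu Uy) (ker_curl x s e0 y) div).
Qed.

Lemma D2_approx_id u : Ck 2 U u ->
  sqint p a (fun y => 'D_e2 u y * ap y + laplacian u y * kB y - u y * 'D_e2 an y) = 0.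
Proof.
move=> cu.
have cu1 := Ck_D1 cu; have cu2 := Ck_D2 cu.
have cA1 := CkW cA; have cB1 := CkW cB.
apply: (@sqint_div _ p a a_ge0 U
  (fun y => 'D_e1 u y * kB y + 'D_e2 u y * kA y)
  (fun y => 'D_e2 u y * kB y - 'D_e1 u y * kA y - u y * an y) _ oU a0 QU).
- exact: (CkD oU (CkM oU cu1 cB1) (CkM oU cu2 cA1)).
- exact: (CkB oU (CkB oU (CkM oU cu2 cB1) (CkM oU cu1 cA1)) (CkM oU (CkW cu) cN)).
- by move=> y _ /edge1[-> -> _]; rewrite !mulr0 addr0.
- by move=> y _ /edge2[-> -> ->]; rewrite !mulr0 !subr0.
move=> y Qy; have Uy := QU Qy.
have [_ dF] := is_deriveD2
  (is_deriveM2 (Ck_is_derive1 cu1 Uy) (Ck_is_derive1 cB1 Uy))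
  (is_deriveM2 (Ck_is_derive1 cu2 Uy) (Ck_is_derive1 cA1 Uy)).
have [_ dG] := is_deriveB2 (is_deriveB2
  (is_deriveM2 (Ck_is_derive2 cu2 Uy) (Ck_is_derive2 cB1 Uy))
  (is_deriveM2 (Ck_is_derive2 cu1 Uy) (Ck_is_derive2 cA1 Uy)))
  (is_deriveM2 (Ck_is_derive2 cu Uy) (Ck_is_derive2 cN Uy)).
apply: etrans (esym (congr2 +%R dF dG)).
have div : ap y = 'D_e1 kA y + 'D_e2 kB y - an y by rewrite ker_div// addrK.
exact: (div_identity2 ('D_e1 ('D_e1 u) y) ('D_e2 ('D_e2 u) y) ('D_e1 u y)
  ('D_e2 u y) ('D_e2 an y) (kA y) (kB y) (u y) (schwarz oU cu Uy) (ker_curl x s e0 y) div).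
Qed.

                                                                       
                                                                        
(** Real part of 4 (u_zz - u_z^2 / 2), the Hopf differential, with d/dz = (d/dx1 - i d/dx2) / 2;
    [hopfB] is the imaginary part. *)
Definition hopfA u y : R := 'D_e1 ('D_e1 u) y - 'D_e2 ('D_e2 u) y -
  2^-1 * ('D_e1 u y * 'D_e1 u y - 'D_e2 u y * 'D_e2 u y).
Definition hopfB u y : R := - 2 * 'D_e1 ('D_e2 u) y + 'D_e1 u y * 'D_e2 u y.

Variables (v f N1 N2 : R * R -> R).
Hypotheses (cv : Ck 2 U v) (cf : Ck 1 U f).
Hypothesis vf : forall y, U y -> f y = - laplacian v y.
Hypothesis f1 : forall y, U y -> 'D_e1 f y = f y * 'D_e1 v y + N1 y.
Hypothesis f2 : forall y, U y -> 'D_e2 f y = f y * 'D_e2 v y + N2 y.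

Let cv1 := Ck_D1 cv.
Let cv2 := Ck_D2 cv.
Let cA1 := CkW cA.
Let cB1 := CkW cB.
Let cA11 := Ck_D1 cA.
Let cA12 := Ck_D2 cA.
Let cB11 := Ck_D1 cB.
Let cB12 := Ck_D2 cB.
Let half : Ck 1 U (fun=> 2^-1 : R). Proof. exact: Ck_cst. Qed.
Let two : Ck 1 U (fun=> 2 : R). Proof. exact: Ck_cst. Qed.

Let cq : Ck 1 U (fun y => 2^-1 * ('D_e1 v y * 'D_e1 v y - 'D_e2 v y * 'D_e2 v y)).
Proof. exact: (CkM oU half (CkB oU (CkM oU cv1 cv1) (CkM oU cv2 cv2))). Qed.
Let c12 : Ck 1 U (fun y => 'D_e1 v y * 'D_e2 v y).
Proof. exact: (CkM oU cv1 cv2). Qed.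

(** Real part of a Cauchy-Pompeiu formula: with f = - Delta v and grad f = f grad v + N, the d-bar
    derivative of the Hopf differential is - (N1 - i N2) / 2, which the kernel integrates. The
    annular terms contain only first derivatives of [v]. *)
Lemma hopfA_approx_id :
  sqint p a (fun y => hopfA v y * ap y - (N1 y * kA y - N2 y * kB y)
    - 'D_e1 v y * 'D_e1 an y + 'D_e2 v y * 'D_e2 an y
    - 2^-1 * ('D_e1 v y * 'D_e1 v y - 'D_e2 v y * 'D_e2 v y) * an y) = 0.
Proof.
(* Third derivatives of [v] need not exist. The field therefore contains [v] only through first
   derivatives and [f], with derivatives of the kernel as coefficients where second derivatives of
   [v] would be expected. *)
apply: (@sqint_div _ p a a_ge0 U
  (fun y => 2 * ('D_e1 v y * 'D_e2 kB y) + 2 * ('D_e2 v y * 'D_e2 kA y) - f y * kA y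
    - 2^-1 * ('D_e1 v y * 'D_e1 v y - 'D_e2 v y * 'D_e2 v y) * kA y
    + 'D_e1 v y * 'D_e2 v y * kB y - 'D_e1 v y * an y)
  (fun y => f y * kB y - 2 * ('D_e2 v y * 'D_e1 kA y) - 2 * ('D_e1 v y * 'D_e1 kB y)
    - 2^-1 * ('D_e1 v y * 'D_e1 v y - 'D_e2 v y * 'D_e2 v y) * kB y
    - 'D_e1 v y * 'D_e2 v y * kA y + 'D_e2 v y * an y) _ oU a0 QU).
- exact: (CkB oU (CkD oU (CkB oU (CkB oU (CkD oU (CkM oU two (CkM oU cv1 cB12))
    (CkM oU two (CkM oU cv2 cA12))) (CkM oU cf cA1)) (CkM oU cq cA1)) (CkM oU c12 cB1))
    (CkM oU cv1 cN)).
- exact: (CkD oU (CkB oU (CkB oU (CkB oU (CkB oU (CkM oU cf cB1)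
    (CkM oU two (CkM oU cv2 cA11))) (CkM oU two (CkM oU cv1 cB11))) (CkM oU cq cB1))
    (CkM oU c12 cA1)) (CkM oU cv2 cN)).
- move=> y _ ye; have [-> -> ->] := edge1 ye.
  have [-> ->] := D_ker_out s0 e0 e2 (or_introl (inside_edge1 ins ye)).
  by rewrite !mulr0 !(subr0, addr0).
- move=> y _ ye; have [-> -> ->] := edge2 ye.
  have [-> ->] := D_ker_out s0 e0 e1 (or_intror (inside_edge2 ins ye)).
  by rewrite !mulr0 !(subr0, addr0).
move=> y Qy; have Uy := QU Qy.
have v1 := Ck_is_derive1 cv1 Uy; have v2 := Ck_is_derive1 cv2 Uy.
have w1 := Ck_is_derive2 cv1 Uy; have w2 := Ck_is_derive2 cv2 Uy.
have t1 := is_deriveC2 (2 : R) y e1; have t2 := is_deriveC2 (2 : R) y e2.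
have h1 := is_deriveC2 (2^-1 : R) y e1; have h2 := is_deriveC2 (2^-1 : R) y e2.
have [_ dF] := is_deriveB2 (is_deriveD2 (is_deriveB2 (is_deriveB2 (is_deriveD2
  (is_deriveM2 t1 (is_deriveM2 v1 (Ck_is_derive1 cB12 Uy)))
  (is_deriveM2 t1 (is_deriveM2 v2 (Ck_is_derive1 cA12 Uy))))
  (is_deriveM2 (Ck_is_derive1 cf Uy) (Ck_is_derive1 cA1 Uy)))
  (is_deriveM2 (is_deriveM2 h1 (is_deriveB2 (is_deriveM2 v1 v1) (is_deriveM2 v2 v2)))
     (Ck_is_derive1 cA1 Uy)))
  (is_deriveM2 (is_deriveM2 v1 v2) (Ck_is_derive1 cB1 Uy)))
  (is_deriveM2 v1 (Ck_is_derive1 cN Uy)).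
have [_ dG] := is_deriveD2 (is_deriveB2 (is_deriveB2 (is_deriveB2 (is_deriveB2
  (is_deriveM2 (Ck_is_derive2 cf Uy) (Ck_is_derive2 cB1 Uy))
  (is_deriveM2 t2 (is_deriveM2 w2 (Ck_is_derive2 cA11 Uy))))
  (is_deriveM2 t2 (is_deriveM2 w1 (Ck_is_derive2 cB11 Uy))))
  (is_deriveM2 (is_deriveM2 h2 (is_deriveB2 (is_deriveM2 w1 w1) (is_deriveM2 w2 w2)))
     (Ck_is_derive2 cB1 Uy)))
  (is_deriveM2 (is_deriveM2 w1 w2) (Ck_is_derive2 cA1 Uy)))
  (is_deriveM2 w2 (Ck_is_derive2 cN Uy)).
apply: etrans (esym (congr2 +%R dF dG)).
have div : ap y = 'D_e1 kA y + 'D_e2 kB y - an y by rewrite ker_div// addrK.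
exact: (hopfA_identity (v11 := 'D_e1 ('D_e1 v) y) (v22 := 'D_e2 ('D_e2 v) y)
  (kA y) (kB y) ('D_e1 an y) ('D_e2 an y) (schwarz oU cv Uy) (ker_curl x s e0 y) div (schwarz oU cA Uy)
  (schwarz oU cB Uy) (vf Uy) (f1 Uy) (f2 Uy)).
Qed.

Lemma hopfB_approx_id :
  sqint p a (fun y => hopfB v y * ap y + (N1 y * kB y + N2 y * kA y)
    + 'D_e2 v y * 'D_e1 an y + 'D_e1 v y * 'D_e2 an y + 'D_e1 v y * 'D_e2 v y * an y) = 0.
Proof.
apply: (@sqint_div _ p a a_ge0 U
  (fun y => 2 * ('D_e1 v y * 'D_e2 kA y) - 2 * ('D_e2 v y * 'D_e2 kB y) + f y * kB y
    + 2^-1 * ('D_e1 v y * 'D_e1 v y - 'D_e2 v y * 'D_e2 v y) * kB y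
    + 'D_e1 v y * 'D_e2 v y * kA y + 'D_e2 v y * an y)
  (fun y => f y * kA y - 2 * ('D_e1 v y * 'D_e1 kA y) + 2 * ('D_e2 v y * 'D_e1 kB y)
    - 2^-1 * ('D_e1 v y * 'D_e1 v y - 'D_e2 v y * 'D_e2 v y) * kA y
    + 'D_e1 v y * 'D_e2 v y * kB y + 'D_e1 v y * an y) _ oU a0 QU).
- exact: (CkD oU (CkD oU (CkD oU (CkD oU (CkB oU (CkM oU two (CkM oU cv1 cA12))
    (CkM oU two (CkM oU cv2 cB12))) (CkM oU cf cB1)) (CkM oU cq cB1)) (CkM oU c12 cA1))
    (CkM oU cv2 cN)).
- exact: (CkD oU (CkD oU (CkB oU (CkD oU (CkB oU (CkM oU cf cA1)
    (CkM oU two (CkM oU cv1 cA11))) (CkM oU two (CkM oU cv2 cB11))) (CkM oU cq cA1))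
    (CkM oU c12 cB1)) (CkM oU cv1 cN)).
- move=> y _ ye; have [-> -> ->] := edge1 ye.
  have [-> ->] := D_ker_out s0 e0 e2 (or_introl (inside_edge1 ins ye)).
  by rewrite !mulr0 !(subr0, addr0).
- move=> y _ ye; have [-> -> ->] := edge2 ye.
  have [-> ->] := D_ker_out s0 e0 e1 (or_intror (inside_edge2 ins ye)).
  by rewrite !mulr0 !(subr0, addr0).
move=> y Qy; have Uy := QU Qy.
have v1 := Ck_is_derive1 cv1 Uy; have v2 := Ck_is_derive1 cv2 Uy.
have w1 := Ck_is_derive2 cv1 Uy; have w2 := Ck_is_derive2 cv2 Uy.
have t1 := is_deriveC2 (2 : R) y e1; have t2 := is_deriveC2 (2 : R) y e2.
have h1 := is_deriveC2 (2^-1 : R) y e1; have h2 := is_deriveC2 (2^-1 : R) y e2.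
have [_ dF] := is_deriveD2 (is_deriveD2 (is_deriveD2 (is_deriveD2 (is_deriveB2
  (is_deriveM2 t1 (is_deriveM2 v1 (Ck_is_derive1 cA12 Uy)))
  (is_deriveM2 t1 (is_deriveM2 v2 (Ck_is_derive1 cB12 Uy))))
  (is_deriveM2 (Ck_is_derive1 cf Uy) (Ck_is_derive1 cB1 Uy)))
  (is_deriveM2 (is_deriveM2 h1 (is_deriveB2 (is_deriveM2 v1 v1) (is_deriveM2 v2 v2)))
     (Ck_is_derive1 cB1 Uy)))
  (is_deriveM2 (is_deriveM2 v1 v2) (Ck_is_derive1 cA1 Uy)))
  (is_deriveM2 v2 (Ck_is_derive1 cN Uy)).
have [_ dG] := is_deriveD2 (is_deriveD2 (is_deriveB2 (is_deriveD2 (is_deriveB2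
  (is_deriveM2 (Ck_is_derive2 cf Uy) (Ck_is_derive2 cA1 Uy))
  (is_deriveM2 t2 (is_deriveM2 w1 (Ck_is_derive2 cA11 Uy))))
  (is_deriveM2 t2 (is_deriveM2 w2 (Ck_is_derive2 cB11 Uy))))
  (is_deriveM2 (is_deriveM2 h2 (is_deriveB2 (is_deriveM2 w1 w1) (is_deriveM2 w2 w2)))
     (Ck_is_derive2 cA1 Uy)))
  (is_deriveM2 (is_deriveM2 w1 w2) (Ck_is_derive2 cB1 Uy)))
  (is_deriveM2 w1 (Ck_is_derive2 cN Uy)).
apply: etrans (esym (congr2 +%R dF dG)).
have div : ap y = 'D_e1 kA y + 'D_e2 kB y - an y by rewrite ker_div// addrK.
exact: (hopfB_identity (v11 := 'D_e1 ('D_e1 v) y) (v22 := 'D_e2 ('D_e2 v) y)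
  (kA y) (kB y) ('D_e1 an y) ('D_e2 an y) (schwarz oU cv Uy) (ker_curl x s e0 y) div (schwarz oU cA Uy)
  (schwarz oU cB Uy) (vf Uy) (f1 Uy) (f2 Uy)).
Qed.

End Identities.
End InteriorEstimates.

(** * Pointwise bounds deduced from the identities *)

Section InteriorBounds.
Context {R : realType}.
Implicit Types (y : R * R) (F G u : R * R -> R).

Lemma hopfA_annular_bound (b1 b2 d1 d2 n C k1 k2 : R) :
  `|b1| <= C -> `|b2| <= C -> `|d1| <= k1 -> `|d2| <= k1 -> `|n| <= k2 ->
  `|- (b1 * d1) + b2 * d2 - 2^-1 * (b1 * b1 - b2 * b2) * n| <= 2 * C * k1 + C ^+ 2 * k2.
Proof.
move=> h1 h2 h3 h4 h5.
have C0 : 0 <= C := le_trans (normr_ge0 _) h1.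
have t1 : `|b1 * d1| <= C * k1 by rewrite normrM ler_pM.
have t2 : `|b2 * d2| <= C * k1 by rewrite normrM ler_pM.
have t3 : `|2^-1 * (b1 * b1 - b2 * b2) * n| <= C ^+ 2 * k2.
  rewrite normrM ler_pM// normrM gtr0_norm//.
  have s1 : `|b1 * b1| <= C ^+ 2 by rewrite normrM expr2 ler_pM.
  have s2 : `|b2 * b2| <= C ^+ 2 by rewrite normrM expr2 ler_pM.
  by have := ler_normB (b1 * b1) (b2 * b2); lra.
have := ler_normB (- (b1 * d1) + b2 * d2) (2^-1 * (b1 * b1 - b2 * b2) * n).
have := ler_normD (- (b1 * d1)) (b2 * d2); rewrite normrN; lra.
Qed.

Lemma hopfB_annular_bound (b1 b2 d1 d2 n C k1 k2 : R) :
  `|b1| <= C -> `|b2| <= C -> `|d1| <= k1 -> `|d2| <= k1 -> `|n| <= k2 ->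
  `|b2 * d1 + b1 * d2 + b1 * b2 * n| <= 2 * C * k1 + C ^+ 2 * k2.
Proof.
move=> h1 h2 h3 h4 h5.
have C0 : 0 <= C := le_trans (normr_ge0 _) h1.
have t1 : `|b2 * d1| <= C * k1 by rewrite normrM ler_pM.
have t2 : `|b1 * d2| <= C * k1 by rewrite normrM ler_pM.
have t3 : `|b1 * b2 * n| <= C ^+ 2 * k2 by rewrite normrM ler_pM// normrM expr2 ler_pM.
have := ler_normD (b2 * d1 + b1 * d2) (b1 * b2 * n).
have := ler_normD (b2 * d1) (b1 * d2); lra.
Qed.

Lemma divXn_ge0 (k t : R) n : 0 <= k -> 0 < t -> 0 <= k / t ^+ n.
Proof. by move=> k0 t0; rewrite divr_ge0// exprn_ge0// ltW. Qed.

Lemma reorderA (P N t1 t2 t3 : R) : P - N - t1 + t2 - t3 = P + - N + (- t1 + t2 - t3).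
Proof. by ring. Qed.

Lemma reorderB (P N t1 t2 t3 : R) : P + N + t1 + t2 + t3 = P + N + (t1 + t2 + t3).
Proof. by ring. Qed.

Lemma pair_bound (n1 n2 g k1 k2 c : R) : `|n1| + `|n2| <= g -> `|k1| <= c -> `|k2| <= c ->
  `|n1 * k1| + `|n2 * k2| <= g * c.
Proof.
move=> ng h1 h2; have c0 : 0 <= c := le_trans (normr_ge0 _) h1.
apply: (@le_trans _ _ ((`|n1| + `|n2|) * c)); last by rewrite ler_wpM2r.
by rewrite mulrDl !normrM lerD// ler_wpM2l.
Qed.

Lemma gradient_const (C s : R) : 0 < s ->
  3402 * C / s = (C * (378 / s ^+ 3)) * (9 * s ^+ 2).
Proof. by move=> s0; field; exact: lt0r_neq0. Qed.

Lemma hopf_const (C s : R) : 0 < s -> 6804 * C / s + 162 * C ^+ 2 =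
  (2 * C * (378 / s ^+ 3) + C ^+ 2 * (18 / s ^+ 2)) * (9 * s ^+ 2).
Proof. by move=> s0; field; exact: lt0r_neq0. Qed.

Lemma hopf_const_ge0 (C s : R) : 0 <= C -> 0 < s ->
  0 <= 2 * C * (378 / s ^+ 3) + C ^+ 2 * (18 / s ^+ 2).
Proof.
move=> C0 s0; exact: (addr_ge0 (mulr_ge0 (mulr_ge0 (ler0n _ 2) C0)
  (divXn_ge0 3 (ler0n _ 378) s0)) (mulr_ge0 (sqr_ge0 C) (divXn_ge0 2 (ler0n _ 18) s0))).
Qed.

Variables (U : set (R * R)) (p : R * R) (a : R).
Hypotheses (oU : open U) (a0 : 0 < a) (QU : square p a `<=` U).
Let Q := square p a.
Let a_ge0 : 0 <= a. Proof. exact: ltW. Qed.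

Variables (x : R * R) (s : R).
Hypotheses (s0 : 0 < s) (ins : inside p a x s).

(** The common shape of the four identities: [P] is the quantity against [approx_id], [L] the source
    against the kernel, [T] the annular remainder, supported in area 9 s^2. *)
Lemma sqint_kernel_bound eps G P L T (B c : R) : 0 < eps -> 0 <= c ->
  cont_on Q G -> cont_on Q P -> cont_on Q L -> cont_on Q T ->
  sqint p a (fun y => P y + L y + T y) = 0 ->
  (forall y, Q y -> `|L y| <= G y * (cutoff x s y / Num.sqrt (mden x eps y))) ->
  sqint p a (fun y => G y * (cutoff x s y / Num.sqrt (mden x eps y))) <= B ->
  (forall y, Q y -> `|T y| <= c) ->
  (forall y, ~~ (s ^+ 2 < sqdist x y < 2 * s ^+ 2) -> T y = 0) ->
  `|sqint p a P| <= B + c * (9 * s ^+ 2).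
Proof.
move=> e0 c0 cG cP cL cT E LG GB Tc T0.
have cGk : cont_on Q (fun y => G y * (cutoff x s y / Num.sqrt (mden x eps y))).
  apply: cont_onM => //; apply: (@Ck_cont_onT _ 1).
  apply: (CkM openT (CkW (Ck_cutoff x s))).
  apply: CkV; [exact: openT|by move=> y _; rewrite lt0r_neq0// sqrtr_gt0 mden_gt0|].
  by apply: Ck_sqrt; [exact: openT|move=> y _; exact: mden_gt0|exact: Ck_mden].
have hL : `|sqint p a L| <= B by apply: le_trans GB; exact: le_norm_sqint.
have hT : `|sqint p a T| <= c * (9 * s ^+ 2).
  have -> : 9 * s ^+ 2 = 4 * (3 / 2 * s) ^+ 2 by field.
  apply: (@sqint_supp _ p a a_ge0 T x) => //.
  - by have := s0; lra.
  - exact: (inside_square ins).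
  - move=> y _ /not_square_far /(cutoff_out_square s0) ys; apply: T0.
    by rewrite [X in _ && X]ltNge ys andbF.
move: E; rewrite sqintD//; last exact: cont_onD.
rewrite sqintD// => E.
have -> : sqint p a P = - (sqint p a L + sqint p a T).
  by apply/eqP; rewrite -subr_eq0 opprK addrA E.
by rewrite normrN (le_trans (ler_normD _ _))// lerD.
Qed.

Let Ckcont n F : Ck n U F -> cont_on Q F.
Proof. exact: Ck_cont_on QU. Qed.

Let Dzero eps y v : 0 < eps -> ~~ (s ^+ 2 < sqdist x y < 2 * s ^+ 2) ->
  'D_v (annular x s eps) y = 0 /\ annular x s eps y = 0.
Proof.
move=> e0 ny; split; apply: contraNeq ny.
  by move=> /(D_annular_supp s0 e0).
by move=> h; apply: (annular_supp s0 (eps := eps)); left.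
Qed.

(** An interior gradient estimate in which [u] itself matters only on the annulus. This is essential
    at a blow-up point, where no bound on [u] is available. The constant 3402 is 378 times 9. *)
Lemma gradient_bound u G (C B : R) : Ck 2 U u -> cont_on Q G ->
  (forall y, Q y -> `|laplacian u y| <= G y) -> 0 <= C ->
  (forall y, s ^+ 2 < sqdist x y < 2 * s ^+ 2 -> `|u y| <= C) ->
  (forall eps, 0 < eps -> eps <= s ->
    sqint p a (fun y => G y * (cutoff x s y / Num.sqrt (mden x eps y))) <= B) ->
  `|'D_e1 u x| <= 4 * (B + 3402 * C / s) /\ `|'D_e2 u x| <= 4 * (B + 3402 * C / s).
Proof.
move=> cu cG uG C0 uC GB.
have cL : cont_on Q (laplacian u).
  exact: (cont_onD (Ckcont (Ck_D1 (Ck_D1 cu))) (Ckcont (Ck_D2 (Ck_D2 cu)))).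
(* Treats both partials at once: [D] is the partial, [k] the kernel component paired with the
   Laplacian. *)
have key D (k : R -> R * R -> R) (v : R * R) : cont_on Q D ->
    (forall eps, 0 < eps -> cont_on Q (k eps)) ->
    (forall eps, 0 < eps -> cont_on Q ('D_v (annular x s eps))) ->
    (forall eps y, 0 < eps -> `|k eps y| <= cutoff x s y / Num.sqrt (mden x eps y)) ->
    (forall eps y, 0 < eps -> `|'D_v (annular x s eps) y| <= 378 / s ^+ 3) ->
    (forall eps, 0 < eps -> sqint p a (fun y => D y * approx_id x s eps y +
       laplacian u y * k eps y - u y * 'D_v (annular x s eps) y) = 0) ->
    `|D x| <= 4 * (B + 3402 * C / s).
  move=> cD ck cd kb db E.
  apply: (approx_id_pointwise a0 s0 ins cD) => eps e0 es.
  rewrite (gradient_const C s0).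
  apply: (@sqint_kernel_bound eps G _ (fun y => laplacian u y * k eps y)
    (fun y => - (u y * 'D_v (annular x s eps) y)) _ _ e0
    (mulr_ge0 C0 (divXn_ge0 3 (ler0n _ 378) s0)) cG).
  - exact: (cont_onM cD (Ck_cont_onT (Ck_approx_id x s e0))).
  - exact: (cont_onM cL (ck _ e0)).
  - exact: (cont_onN (cont_onM (Ckcont cu) (cd _ e0))).
  - exact: E.
  - by move=> y Qy; rewrite normrM; apply: (ler_pM (normr_ge0 _) (normr_ge0 _) (uG y Qy) (kb eps y e0)).
  - exact: GB.
  - move=> y Qy; rewrite normrN normrM.
    have [yi|/(Dzero v e0)[-> _]] := boolP (s ^+ 2 < sqdist x y < 2 * s ^+ 2).
      exact: (ler_pM (normr_ge0 _) (normr_ge0 _) (uC y yi) (db eps y e0)).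
    rewrite normr0 mulr0; exact: (mulr_ge0 C0 (divXn_ge0 3 (ler0n _ 378) s0)).
  - by move=> y /(Dzero v e0)[-> _]; rewrite mulr0 oppr0.
split.
- apply: (key ('D_e1 u) (kerA x s) e1).
  + exact: Ckcont (Ck_D1 cu).
  + by move=> eps e0; apply: Ck_cont_onT (Ck_kerA x s e0).
  + by move=> eps e0; apply: Ck_cont_onT (Ck_D1 (Ck_annular x s e0)).
  + by move=> eps y e0; exact: kerA_bound.
  + by move=> eps y e0; exact: D1_annular_bound.
  + by move=> eps e0; exact: (D1_approx_id oU a0 QU s0 e0 ins cu).
- apply: (key ('D_e2 u) (kerB x s) e2).
  + exact: Ckcont (Ck_D2 cu).
  + by move=> eps e0; apply: Ck_cont_onT (Ck_kerB x s e0).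
  + by move=> eps e0; apply: Ck_cont_onT (Ck_D2 (Ck_annular x s e0)).
  + by move=> eps y e0; exact: kerB_bound.
  + by move=> eps y e0; exact: D2_annular_bound.
  + by move=> eps e0; exact: (D2_approx_id oU a0 QU s0 e0 ins cu).
Qed.

Variables (v f N1 N2 G : R * R -> R) (C B : R).
Hypotheses (cv : Ck 2 U v) (cf : Ck 1 U f).
Hypothesis vf : forall y, U y -> f y = - laplacian v y.
Hypothesis f1 : forall y, U y -> 'D_e1 f y = f y * 'D_e1 v y + N1 y.
Hypothesis f2 : forall y, U y -> 'D_e2 f y = f y * 'D_e2 v y + N2 y.
Hypotheses (cN1 : cont_on Q N1) (cN2 : cont_on Q N2) (cG : cont_on Q G).
Hypothesis NG : forall y, Q y -> `|N1 y| + `|N2 y| <= G y.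
Hypothesis C0 : 0 <= C.
Hypothesis vC : forall y, s ^+ 2 < sqdist x y < 2 * s ^+ 2 ->
  `|'D_e1 v y| <= C /\ `|'D_e2 v y| <= C.
Hypothesis GB : forall eps, 0 < eps -> eps <= s ->
  sqint p a (fun y => G y * (cutoff x s y / Num.sqrt (mden x eps y))) <= B.

(** Here [G] dominates the defect N, so [B] is small compared with second derivatives of [v] when V
    varies slowly; 6804 = 2 * 378 * 9 and 162 = 18 * 9 come from the annulus. *)
Lemma hopfA_bound : `|hopfA v x| <= 4 * (B + (6804 * C / s + 162 * C ^+ 2)).
Proof.
have c1 := Ckcont (Ck_D1 cv); have c2 := Ckcont (Ck_D2 cv).
have cq : cont_on Q (fun y => 2^-1 * ('D_e1 v y * 'D_e1 v y - 'D_e2 v y * 'D_e2 v y)).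
  exact: (cont_onM (@cont_on_cst R Q 2^-1) (cont_onB (cont_onM c1 c1) (cont_onM c2 c2))).
have cH : cont_on Q (hopfA v).
  exact: (cont_onB (cont_onB (Ckcont (Ck_D1 (Ck_D1 cv))) (Ckcont (Ck_D2 (Ck_D2 cv)))) cq).
apply: (approx_id_pointwise a0 s0 ins cH) => eps e0 es; rewrite (hopf_const C s0).
have ckA : cont_on Q (kerA x s eps) by apply: Ck_cont_onT (Ck_kerA x s e0).
have ckB : cont_on Q (kerB x s eps) by apply: Ck_cont_onT (Ck_kerB x s e0).
have cn : cont_on Q (annular x s eps) by apply: Ck_cont_onT (Ck_annular x s e0).
have cn1 : cont_on Q ('D_e1 (annular x s eps)).
  by apply: Ck_cont_onT (Ck_D1 (Ck_annular x s e0)).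
have cn2 : cont_on Q ('D_e2 (annular x s eps)).
  by apply: Ck_cont_onT (Ck_D2 (Ck_annular x s e0)).
apply: (@sqint_kernel_bound eps G _
  (fun y => - (N1 y * kerA x s eps y - N2 y * kerB x s eps y))
  (fun y => - ('D_e1 v y * 'D_e1 (annular x s eps) y) + 'D_e2 v y * 'D_e2 (annular x s eps) y
   - 2^-1 * ('D_e1 v y * 'D_e1 v y - 'D_e2 v y * 'D_e2 v y) * annular x s eps y)
  _ _ e0 (hopf_const_ge0 C0 s0) cG).
- exact: (cont_onM cH (Ck_cont_onT (Ck_approx_id x s e0))).
- exact: (cont_onN (cont_onB (cont_onM cN1 ckA) (cont_onM cN2 ckB))).
- exact: (cont_onB (cont_onD (cont_onN (cont_onM c1 cn1)) (cont_onM c2 cn2)) (cont_onM cq cn)).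
- rewrite -(hopfA_approx_id oU a0 QU s0 e0 ins cv cf vf f1 f2).
  by apply: eq_sqint => y _; rewrite -reorderA.
- move=> y Qy; rewrite normrN (le_trans (ler_normB _ _))//.
  by apply: pair_bound; [exact: NG|exact: kerA_bound|exact: kerB_bound].
- exact: GB.
- move=> y _; have [yi|ny] := boolP (s ^+ 2 < sqdist x y < 2 * s ^+ 2); last first.
    have [-> ->] := Dzero e1 e0 ny; have [-> _] := Dzero e2 e0 ny.
    by rewrite !mulr0 !oppr0 !addr0 normr0; exact: hopf_const_ge0.
  have [v1 v2] := vC yi.
  exact: (hopfA_annular_bound v1 v2 (D1_annular_bound x s0 e0 y)
    (D2_annular_bound x s0 e0 y) (annular_bound x s0 e0 y)).
- move=> y ny; have [-> ->] := Dzero e1 e0 ny; have [-> _] := Dzero e2 e0 ny.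
  by rewrite !mulr0 !oppr0 !addr0.
Qed.

Lemma hopfB_bound : `|hopfB v x| <= 4 * (B + (6804 * C / s + 162 * C ^+ 2)).
Proof.
have c1 := Ckcont (Ck_D1 cv); have c2 := Ckcont (Ck_D2 cv).
have cH : cont_on Q (hopfB v).
  exact: (cont_onD (cont_onM (@cont_on_cst R Q (- 2)) (Ckcont (Ck_D1 (Ck_D2 cv)))) (cont_onM c1 c2)).
apply: (approx_id_pointwise a0 s0 ins cH) => eps e0 es; rewrite (hopf_const C s0).
have ckA : cont_on Q (kerA x s eps) by apply: Ck_cont_onT (Ck_kerA x s e0).
have ckB : cont_on Q (kerB x s eps) by apply: Ck_cont_onT (Ck_kerB x s e0).
have cn : cont_on Q (annular x s eps) by apply: Ck_cont_onT (Ck_annular x s e0).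
have cn1 : cont_on Q ('D_e1 (annular x s eps)).
  by apply: Ck_cont_onT (Ck_D1 (Ck_annular x s e0)).
have cn2 : cont_on Q ('D_e2 (annular x s eps)).
  by apply: Ck_cont_onT (Ck_D2 (Ck_annular x s e0)).
apply: (@sqint_kernel_bound eps G _
  (fun y => N1 y * kerB x s eps y + N2 y * kerA x s eps y)
  (fun y => 'D_e2 v y * 'D_e1 (annular x s eps) y + 'D_e1 v y * 'D_e2 (annular x s eps) y
   + 'D_e1 v y * 'D_e2 v y * annular x s eps y)
  _ _ e0 (hopf_const_ge0 C0 s0) cG).
- exact: (cont_onM cH (Ck_cont_onT (Ck_approx_id x s e0))).
- exact: (cont_onD (cont_onM cN1 ckB) (cont_onM cN2 ckA)).
- exact: (cont_onD (cont_onD (cont_onM c2 cn1) (cont_onM c1 cn2)) (cont_onM (cont_onM c1 c2) cn)).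
- rewrite -(hopfB_approx_id oU a0 QU s0 e0 ins cv cf vf f1 f2).
  by apply: eq_sqint => y _; rewrite -reorderB.
- move=> y Qy; rewrite (le_trans (ler_normD _ _))//.
  by apply: pair_bound; [exact: NG|exact: kerB_bound|exact: kerA_bound].
- exact: GB.
- move=> y _; have [yi|ny] := boolP (s ^+ 2 < sqdist x y < 2 * s ^+ 2); last first.
    have [-> ->] := Dzero e1 e0 ny; have [-> _] := Dzero e2 e0 ny.
    by rewrite !mulr0 !addr0 normr0; exact: hopf_const_ge0.
  have [v1 v2] := vC yi.
  exact: (hopfB_annular_bound v1 v2 (D1_annular_bound x s0 e0 y)
    (D2_annular_bound x s0 e0 y) (annular_bound x s0 e0 y)).
- move=> y ny; have [-> ->] := Dzero e1 e0 ny; have [-> _] := Dzero e2 e0 ny.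
  by rewrite !mulr0 !addr0.
Qed.

End InteriorBounds.

(** * The maximum principle and the comparison |w| <= mu v *)

Section MaximumPrinciple.
Context {R : realType}.
Implicit Types (Omega : set (R * R)) (f u v w : R * R -> R).

Lemma bounded_square Omega : bounded_set Omega ->
  exists2 M : R, 0 < M & closure Omega `<=` square (0, 0) M.
Proof.
move=> [M [_ HM]]; pose N := `|M| + 1.
have N0 : 0 < N by rewrite ltr_pwDr.
exists N => //.
have MN : M < N by rewrite /N (le_lt_trans (ler_norm M))// ltrDl.
have cl : closed (square ((0, 0) : R * R) N).
  by apply: compact_closed; [exact: norm_hausdorff|exact: square_compact].
rewrite ((closure_id _).1 cl); apply: closure_subset => y /(HM N MN) yN.
apply/squareP; rewrite /= !subr0; split; apply: le_trans yN.
  by rewrite prod_normE le_max lexx.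
by rewrite prod_normE le_max lexx orbT.
Qed.

Lemma closure_compact Omega : bounded_set Omega -> compact (closure Omega).
Proof.
move=> /bounded_square[M M0 sub].
exact: subclosed_compact (@closed_closure _ _) (@square_compact R (0, 0) M) sub.
Qed.

(** Otherwise [dg], zero at [t], would be negative just to the right of [t], and by the mean value
    theorem [g] would drop below its minimum. *)
Lemma second_derivative_at_min (g dg : R -> R) (t d e : R) : 0 < e ->
  (forall s, `|s - t| < e -> is_derive s 1 g (dg s)) -> is_derive t 1 dg d ->
  (forall s, `|s - t| < e -> g t <= g s) -> 0 <= d.
Proof.
move=> e0 dG ddG gmin; rewrite leNgt; apply/negP => d0.
have tI : t \in `]t - e, t + e[ by rewrite in_itv /=; apply/andP; split; lra.
have eI s : s \in `]t - e, t + e[ -> `|s - t| < e.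
  by rewrite in_itv /= ltr_norml => /andP[s1 s2]; apply/andP; split; lra.
have dg0 : dg t = 0.
  have := @derive1_at_max _ (fun s => - g s) (t - e) (t + e) t.
  have te : t - e <= t + e by lra.
  have dr s : s \in `]t - e, t + e[ -> derivable (fun s => - g s) s 1.
    by move=> /eI /dG [? _]; exact: derivableN.
  have mx s : s \in `]t - e, t + e[ -> - g s <= - g t.
    by move=> /eI /gmin; rewrite lerN2.
  move=> /(_ te dr tI mx) [_ h1].
  have [dgt h2] := dG t (eI t tI).
  have : 'D_1 (fun s => - g s) t = - dg t by rewrite -h2; exact: deriveN.
  by rewrite h1 => /eqP; rewrite eq_sym oppr_eq0 => /eqP.
have [/cvg_ex[/= l hl] hd] := ddG.
have ld : l = d by rewrite -hd; apply/esym; exact: cvg_lim hl.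
move: hl; rewrite ld => hl.
have d2 : d < d / 2 by lra.
have := cvgr_lt (f := fun h : R => h^-1 *: (dg (h *: (1 : R) + t) - dg t)) d hl (d / 2) ltac:(lra).
rewrite /= => H.
have [r /= r0 rP] : exists2 r : R, 0 < r & forall h, 0 < h -> h < r -> dg (h + t) < 0.
  move: H; rewrite near_withinE => /nbhs_ballP[r /= r0 rP]; exists r => // h h0 hr.
  have := rP h; rewrite /ball /= sub0r normrN gtr0_norm// => /(_ hr).
  have hn : h != 0 by rewrite gt_eqF.
  move=> /(_ hn); rewrite dg0 subr0 [h%:A]mulr1 /GRing.scale /= ltr_pdivrMl// => /lt_trans; apply.
  by rewrite pmulr_rlt0//; lra.
pose h := Num.min (r / 2) (e / 2).
have h0 : 0 < h by rewrite lt_min !divr_gt0.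
have hr : h < r by rewrite gt_min; apply/orP; left; lra.
have he : h < e by rewrite gt_min; apply/orP; right; lra.
have [|||c] := @MVT R g dg t (t + h).
- by rewrite ltrDl.
- move=> s; rewrite in_itv /= => /andP[s1 s2]; apply: dG.
  by rewrite ltr_norml; apply/andP; split; lra.
- apply: continuous_in_subspaceT => s /set_mem /=; rewrite in_itv /= => /andP[s1 s2].
  apply: (@is_derive_cont1 _ g s (dg s)); apply: dG.
  by rewrite ltr_norml; apply/andP; split; lra.
rewrite in_itv /= => /andP[c1 c2] E.
have gth : g t <= g (t + h) by apply: gmin; rewrite ltr_norml; apply/andP; split; lra.
have dgc : dg c < 0 by have := rP (c - t); rewrite subrK; apply; lra.
have : dg c * (t + h - t) < 0 by rewrite [t + h]addrC addrK nmulr_rlt0.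
by rewrite -E subr_lt0 ltNge gth.
Qed.

Lemma lap_at_min Omega u c : open Omega -> Ck 2 Omega u -> Omega c ->
  (forall y, Omega y -> u c <= u y) -> 0 <= laplacian u c.
Proof.
move=> oO cu Oc umin.
have [e e0 sub] := near_square (open_nbhs_nbhs (conj oO Oc)).
have in1 t : `|t - c.1| < e -> Omega (t, c.2).
  by move=> te; apply: sub; apply/squareP; rewrite /= subrr normr0 !ltW.
have in2 t : `|t - c.2| < e -> Omega (c.1, t).
  by move=> te; apply: sub; apply/squareP; rewrite /= subrr normr0 !ltW.
have cE : c = (c.1, c.2) by case: c {Oc umin sub in1 in2}.
have Oc' : Omega (c.1, c.2) by rewrite -cE.
rewrite /laplacian addr_ge0//.
  have D := is_derive_line1 (Ck_is_derive1 (Ck_D1 cu) Oc').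
  rewrite [X in 'D_e1 _ X]cE.
  apply: (second_derivative_at_min e0 _ D (g := fun t => u (t, c.2))).
    by move=> s /in1 Os; exact: is_derive_line1 (Ck_is_derive1 cu Os).
  by move=> s /in1 Os; rewrite -cE; exact: umin.
have D := is_derive_line2 (Ck_is_derive2 (Ck_D2 cu) Oc').
rewrite [X in 'D_e2 _ X]cE.
apply: (second_derivative_at_min e0 _ D (g := fun t => u (c.1, t))).
  by move=> s /in2 Os; exact: is_derive_line2 (Ck_is_derive2 cu Os).
by move=> s /in2 Os; rewrite -cE; exact: umin.
Qed.

Lemma addrACA_sub (b c d e : R) : b - c + (d - e) = b + d - (c + e).
Proof. by ring. Qed.

Lemma laplacianB Omega u v y : open Omega -> Ck 2 Omega u -> Ck 2 Omega v -> Omega y ->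
  laplacian (fun z => u z - v z) y = laplacian u y - laplacian v y.
Proof.
move=> oO cu cv Oy; rewrite /laplacian.
have e1' : 'D_e1 ('D_e1 (fun z => u z - v z)) y =
    'D_e1 (fun z => 'D_e1 u z - 'D_e1 v z) y.
  apply: near_eq_derive; apply: (open_near_eq oO) Oy => z Oz.
  by have [_ ->] := is_deriveB2 (Ck_is_derive1 cu Oz) (Ck_is_derive1 cv Oz).
have e2' : 'D_e2 ('D_e2 (fun z => u z - v z)) y =
    'D_e2 (fun z => 'D_e2 u z - 'D_e2 v z) y.
  apply: near_eq_derive; apply: (open_near_eq oO) Oy => z Oz.
  by have [_ ->] := is_deriveB2 (Ck_is_derive2 cu Oz) (Ck_is_derive2 cv Oz).
rewrite e1' e2'.
have [_ ->] := is_deriveB2 (Ck_is_derive1 (Ck_D1 cu) Oy) (Ck_is_derive1 (Ck_D1 cv) Oy).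
have [_ ->] := is_deriveB2 (Ck_is_derive2 (Ck_D2 cu) Oy) (Ck_is_derive2 (Ck_D2 cv) Oy).
exact: addrACA_sub.
Qed.

Lemma scale_sum (k b c d e : R) : 0 * d + k * b + (0 * e + k * c) = k * (b + c).
Proof. by ring. Qed.

Lemma laplacianZ Omega u (k : R) y : open Omega -> Ck 2 Omega u -> Omega y ->
  laplacian (fun z => k * u z) y = k * laplacian u y.
Proof.
move=> oO cu Oy; rewrite /laplacian.
have e1' : 'D_e1 ('D_e1 (fun z => k * u z)) y = 'D_e1 (fun z => k * 'D_e1 u z) y.
  apply: near_eq_derive; apply: (open_near_eq oO) Oy => z Oz.
  have [_ ->] := is_deriveM2 (is_deriveC2 k z e1) (Ck_is_derive1 cu Oz).
  by rewrite mul0r add0r.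
have e2' : 'D_e2 ('D_e2 (fun z => k * u z)) y = 'D_e2 (fun z => k * 'D_e2 u z) y.
  apply: near_eq_derive; apply: (open_near_eq oO) Oy => z Oz.
  have [_ ->] := is_deriveM2 (is_deriveC2 k z e2) (Ck_is_derive2 cu Oz).
  by rewrite mul0r add0r.
rewrite e1' e2'.
have [_ ->] := is_deriveM2 (is_deriveC2 k y e1) (Ck_is_derive1 (Ck_D1 cu) Oy).
have [_ ->] := is_deriveM2 (is_deriveC2 k y e2) (Ck_is_derive2 (Ck_D2 cu) Oy).
exact: scale_sum.
Qed.

Lemma laplacian_sqdist (x y : R * R) : laplacian (sqdist x) y = 4.
Proof.
rewrite /laplacian.
have -> : 'D_e1 (sqdist x) = (fun z => 2 * (z.1 - x.1)).
  by apply/funext => z; have [_ ->] := is_derive_sqdist x z e1; rewrite dsq_e1.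
have -> : 'D_e2 (sqdist x) = (fun z => 2 * (z.2 - x.2)).
  by apply/funext => z; have [_ ->] := is_derive_sqdist x z e2; rewrite dsq_e2.
have [_ ->] := is_deriveM2 (is_deriveC2 2 y e1) (is_derive_sub1 x y e1).
have [_ ->] := is_deriveM2 (is_deriveC2 2 y e2) (is_derive_sub2 x y e2).
have h1 : (e1 : R * R).1 = 1 by [].
have h2 : (e2 : R * R).2 = 1 by [].
by apply: etrans (scale_sum _ _ _ _ _) _; rewrite h1 h2; ring.
Qed.

(** Subtracting eps |y|^2 makes the Laplacian strictly negative, which excludes an interior
    minimum. *)
Lemma superharmonic_ge0 Omega u : open Omega -> bounded_set Omega -> Ck 2 Omega u ->
  {within closure Omega, continuous u} ->
  (forall y, Omega y -> laplacian u y <= 0) -> (forall y, bdry Omega y -> 0 <= u y) ->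
  forall y, closure Omega y -> 0 <= u y.
Proof.
move=> oO bO cu ccu lu bu z cz; rewrite leNgt; apply/negP => uz.
have [M M0 sub] := bounded_square bO.
have S0 := @sqdist_ge0 R (0, 0).
have SM y : closure Omega y -> sqdist (0, 0) y <= 2 * M ^+ 2.
  by move=> /sub /square_sqdist.
have M2 : 0 < 2 * M ^+ 2 by rewrite mulr_gt0// exprn_gt0.
(* The perturbation then never exceeds - u z / 2 on the closure, so the minimum of [h] stays below
   every boundary value. *)
pose eps := - u z / (2 * (2 * M ^+ 2)).
have e0 : 0 < eps by rewrite divr_gt0 ?oppr_gt0// mulr_gt0.
have eM : eps * (2 * M ^+ 2) = - u z / 2.
  by rewrite /eps; field; rewrite gt_eqF.
pose h y := u y - eps * sqdist (0, 0) y.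
have cS : continuous (sqdist ((0, 0) : R * R)).
  by move=> y; exact: (Ck_cont (Ck_sqdist 0 _) (x := y) I).
have ch : {within closure Omega, continuous h}.
  have cSw : {within closure Omega, continuous (sqdist ((0, 0) : R * R))}.
    exact: continuous_subspaceT.
  move=> y; exact: (cvgB (ccu y) (cvgM (cvg_cst eps) (cSw y))).
have [c /set_mem clc hc] := compact_EVT_min (ex_intro _ z cz) (closure_compact bO) ch.
have hcz : h c < - (eps * (2 * M ^+ 2)).
  apply: (@le_lt_trans _ _ (h z)); first by apply: hc; exact: mem_set.
  have : 0 <= eps * sqdist (0, 0) z by rewrite mulr_ge0 ?(ltW e0).
  by rewrite /h eM; lra.
have Oc : Omega c.
  have [//|nOc] := pselect (Omega c); exfalso.
  have := bu c (conj clc nOc).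
  have : eps * sqdist (0, 0) c <= eps * (2 * M ^+ 2).
    by rewrite ler_wpM2l ?(ltW e0)// SM.
  by move: hcz; rewrite /h; lra.
have cS2 : Ck 2 Omega (fun y => eps * sqdist (0, 0) y).
  apply: (CkM oO (Ck_cst 2 eps oO)); apply: Ck_subset (Ck_sqdist 2 (0, 0)).
  exact: subsetT.
have Ch : Ck 2 Omega h by exact: (CkB oO cu cS2).
have hmin y : Omega y -> h c <= h y.
  by move=> Oy; apply: hc; apply: mem_set; exact: subset_closure.
have := lap_at_min oO Ch Oc hmin.
rewrite (laplacianB oO cu cS2 Oc) (laplacianZ (Omega := Omega) _ oO _ Oc); last first.
  by apply: Ck_subset (Ck_sqdist 2 (0, 0)); exact: subsetT.
rewrite laplacian_sqdist; have := lu c Oc; move: e0; lra.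
Qed.

(** A continuous function exceeding [c] in absolute value at one point does so on a square of
    positive measure, against the essential supremum. *)
Lemma Linfty_norm_bound Omega f (c : R) y : open Omega ->
  (forall y, Omega y -> {for y, continuous f}) -> 0 < c ->
  Linfty_norm Omega f = c%:E -> Omega y -> `|f y| <= c.
Proof.
move=> oO cf c0; rewrite /Linfty_norm unlock.
case: ifP => [_|_ /eqP]; last by rewrite eqe lt_eqF.
move=> fc Oy; rewrite leNgt; apply/negP => cy.
have := ess_sup_ge mu2 (abse \o (EFin \o (f \_ Omega))); rewrite fc => -[N [mN N0 sub]].
have [e e0 esub] : exists2 e, 0 < e & square y e `<=` [set z | Omega z /\ c < `|f z|].
  apply: near_square; apply: filterI; first exact: open_nbhs_nbhs.
  have cn : {for y, continuous (fun z => `|f z|)} by exact: (cvg_norm (cf y Oy)).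
  exact: (cn _ (lt_nbhsr cy)).
have : (mu2 (square y e) <= mu2 N)%E.
  apply: le_measure; rewrite ?inE//; first exact: square_measurable.
  move=> z /esub[Oz fz]; apply: sub => /=.
  by rewrite patchE mem_set//= lee_fin leNgt fz.
rewrite N0 square_measure ?(ltW e0)// lee_fin leNgt => /negP; apply.
by rewrite mulr_gt0// exprn_gt0.
Qed.

Lemma superharmonic_comparison (mu q u b c : R) : 0 < mu -> 0 <= q -> u <= 1 ->
  - b = q -> - c = mu * q * u -> mu * b - c <= 0.
Proof.
move=> mu0 q0 u1 bq cq.
have : 0 <= mu * q * (1 - u) by rewrite !mulr_ge0 ?subr_ge0// ltW.
rewrite mulrBr mulr1 -cq -bq mulrN; lra.
Qed.

(** Since - Delta (mu v - w) = mu q (1 - w) >= 0, and likewise for -w, both mu v - w and mu v + w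
    are superharmonic with zero boundary values. *)
Lemma eigenfunction_le_potential Omega v w (q : R * R -> R) (mu : R) :
  open Omega -> bounded_set Omega -> 0 < mu ->
  dirichlet_solution Omega q v -> (forall y, Omega y -> 0 <= q y) ->
  dirichlet_solution Omega (fun y => mu * q y * w y) w ->
  (forall y, Omega y -> `|w y| <= 1) ->
  forall y, closure Omega y -> `|w y| <= mu * v y.
Proof.
move=> oO bO mu0 [cv ccv lv bv] q0 [cw ccw lw bw] w1.
have cmv : Ck 2 Omega (fun y => mu * v y) := CkM oO (Ck_cst 2 mu oO) cv.
have cN : Ck 2 Omega (fun y => - w y) := CkN oO cw.
have lN y : Omega y -> laplacian (fun y => - w y) y = - laplacian w y.
  move=> Oy; have -> : (fun y => - w y) = (fun y => -1 * w y).
    by apply/funext => z; rewrite mulN1r.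
  by rewrite (laplacianZ _ oO cw Oy) mulN1r.
have ccmv : {within closure Omega, continuous (fun y => mu * v y)}.
  by move=> y; exact: (cvgM (cvg_cst mu) (ccv y)).
have key (u : R * R -> R) : Ck 2 Omega u -> {within closure Omega, continuous u} ->
    (forall y, Omega y -> - laplacian u y = mu * q y * u y) ->
    (forall y, bdry Omega y -> u y = 0) -> (forall y, Omega y -> u y <= 1) ->
    forall y, closure Omega y -> 0 <= mu * v y - u y.
  move=> cu ccu lu bu u1.
  apply: (superharmonic_ge0 oO bO (CkB oO cmv cu)).
  - by move=> y; exact: (cvgB (ccmv y) (ccu y)).
  - move=> y Oy; rewrite (laplacianB oO cmv cu Oy) (laplacianZ _ oO cv Oy).
    exact: (superharmonic_comparison mu0 (q0 y Oy) (u1 y Oy) (lv y Oy) (lu y Oy)).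
  - by move=> y by_; rewrite bu// bv// mulr0 subr0.
move=> y cy; rewrite ler_norml; apply/andP; split.
  rewrite lerNl -subr_ge0; apply: (key (fun y => - w y)) => //.
  - by move=> z; exact: (cvgN (ccw z)).
  - by move=> z Oz; rewrite lN// mulrN lw.
  - by move=> z bz; rewrite bw// oppr0.
  - by move=> z Oz; rewrite lerNl; have := w1 z Oz; rewrite ler_norml => /andP[].
rewrite -subr_ge0; apply: (key w) => // z Oz.
by have := w1 z Oz; rewrite ler_norml => /andP[].
Qed.

End MaximumPrinciple.

(** * Euclidean distance versus squares *)

Section EuclideanDistance.
Context {R : realType}.
Implicit Types (x y z : R * R) (s : R).

Definition edist x y : R := Num.sqrt (sqdist x y).

Lemma edist_ge0 x y : 0 <= edist x y. Proof. exact: sqrtr_ge0. Qed.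

Lemma edist_sqr x y : edist x y ^+ 2 = sqdist x y.
Proof. by rewrite sqr_sqrtr// sqdist_ge0. Qed.

Lemma sqdistC x y : sqdist x y = sqdist y x.
Proof. by rewrite /sqdist; ring. Qed.

Lemma edistC x y : edist x y = edist y x.
Proof. by rewrite /edist sqdistC. Qed.

Lemma le_edist x y s : 0 <= s -> (edist x y <= s) = (sqdist x y <= s ^+ 2).
Proof.
by move=> s0; rewrite -edist_sqr ler_pXn2r// nnegrE edist_ge0.
Qed.

Lemma ge_edist x y s : 0 <= s -> (s <= edist x y) = (s ^+ 2 <= sqdist x y).
Proof.
by move=> s0; rewrite -edist_sqr ler_pXn2r// nnegrE edist_ge0.
Qed.

Lemma edist_triangle x y z : edist x z <= edist x y + edist y z.
Proof.
rewrite le_edist ?addr_ge0 ?edist_ge0// sqrrD !edist_sqr.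
pose a1 := y.1 - x.1; pose a2 := y.2 - x.2; pose b1 := z.1 - y.1; pose b2 := z.2 - y.2.
have CS : a1 * b1 + a2 * b2 <= edist x y * edist y z.
  apply: (le_trans (ler_norm _)).
  rewrite -ler_sqr ?nnegrE ?mulr_ge0 ?edist_ge0// real_normK ?num_real//.
  rewrite exprMn !edist_sqr /sqdist -/a1 -/a2 -/b1 -/b2 -subr_ge0.
  rewrite (_ : _ - _ = (a1 * b2 - a2 * b1) ^+ 2) ?sqr_ge0//; ring.
have -> : sqdist x z = sqdist x y + 2 * (a1 * b1 + a2 * b2) + sqdist y z.
  by rewrite /sqdist /a1 /a2 /b1 /b2; ring.
by rewrite lerD2r lerD2l -[leRHS]mulr_natl ler_wpM2l.
Qed.

Lemma edist_coord x y : `|y.1 - x.1| <= edist x y /\ `|y.2 - x.2| <= edist x y.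
Proof.
by split; apply: le_norm_sqr; rewrite ?edist_ge0// edist_sqr ?sqdist1_le ?sqdist2_le.
Qed.

Lemma edist_le_coord x y s : `|y.1 - x.1| <= s -> `|y.2 - x.2| <= s -> edist x y <= 2 * s.
Proof.
move=> h1 h2; have s0 : 0 <= s := le_trans (normr_ge0 _) h1.
rewrite le_edist ?mulr_ge0//.
have sq : square x s y by apply/squareP.
by apply: (le_trans (square_sqdist sq)); rewrite exprMn; have := sqr_ge0 s; lra.
Qed.

(** The number 142 / 100 is a rational upper bound for sqrt 2. *)
Lemma annulus_edist x y s : 0 < s -> s ^+ 2 < sqdist x y < 2 * s ^+ 2 ->
  s <= edist x y <= 142 / 100 * s.
Proof.
move=> s0 /andP[h1 h2]; rewrite ge_edist ?(ltW s0)// (ltW h1) /=.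
have s1 : 0 <= 142 / 100 * s by move: s0; lra.
rewrite le_edist//; apply: (le_trans (ltW h2)); rewrite exprMn.
by have := exprn_gt0 2 s0; lra.
Qed.

Lemma eball_edist x y s : eball x s y <-> edist x y < s.
Proof.
suff -> : edist x y = enorm (y - x) by [].
by rewrite /edist /enorm /dotp /sqdist !expr2.
Qed.

End EuclideanDistance.

(** * The mass of - Delta v, controlled from an annulus *)

Section CutoffMass.
Context {R : realType}.
Implicit Types (y : R * R) (v : R * R -> R).
Variables (U : set (R * R)) (p : R * R) (a : R).
Hypotheses (oU : open U) (a0 : 0 < a) (QU : square p a `<=` U).
Local Notation Q := (square p a).
Variables (x : R * R) (s : R).
Hypotheses (s0 : 0 < s) (ins : inside p a x s).

Let E1 y := cutoff1 x s y * (2 * (y.1 - x.1)).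
Let E2 y := cutoff1 x s y * (2 * (y.2 - x.2)).
(** The Laplacian of the cutoff: for a function f of the squared distance S it is 4 (S f'' + f'). *)
Let lapc y := 4 * (cutoff2 x s y * sqdist x y + cutoff1 x s y).

Let CkT n F : Ck n setT F -> Ck n U F.
Proof. by apply: Ck_subset => y _. Qed.

Let cE1 : Ck 1 U E1.
Proof.
exact: (CkT (CkM openT (Ck_cutoff1 x s) (CkM openT (Ck_cst 1 2 openT)
  (CkB openT (Ck_fst 1 openT) (Ck_cst 1 x.1 openT))))).
Qed.

Let cE2 : Ck 1 U E2.
Proof.
exact: (CkT (CkM openT (Ck_cutoff1 x s) (CkM openT (Ck_cst 1 2 openT)
  (CkB openT (Ck_snd 1 openT) (Ck_cst 1 x.2 openT))))).
Qed.

Let clap : Ck 0 setT lapc.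
Proof.
exact: (CkM openT (Ck_cst 0 4 openT) (CkD openT (CkM openT (Ck_cutoff2 x s) (Ck_sqdist 0 x))
  (CkW (Ck_cutoff1 x s)))).
Qed.

Lemma mass_identity (v0 v1 v2 v11 v22 c c1 c2 t1 t2 S w1 w2 : R) : S = t1 ^+ 2 + t2 ^+ 2 ->
  w1 = 1 -> w2 = 1 ->
  - (v11 + v22) * c + v0 * (4 * (c2 * S + c1)) =
  (v1 * (c1 * (2 * t1)) + v0 * (c2 * (2 * t1) * (2 * t1) + c1 * (0 * t1 + 2 * w1))
    - (v11 * c + v1 * (c1 * (2 * t1)))) +
  (v2 * (c1 * (2 * t2)) + v0 * (c2 * (2 * t2) * (2 * t2) + c1 * (0 * t2 + 2 * w2))
    - (v22 * c + v2 * (c1 * (2 * t2)))).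
Proof. by move=> -> -> ->; ring. Qed.

Lemma cutoff_mass v : Ck 2 U v ->
  sqint p a (fun y => - laplacian v y * cutoff x s y + v y * lapc y) = 0.
Proof.
move=> cv; have cc : Ck 1 U (cutoff x s) := CkT (CkW (Ck_cutoff x s)).
have cv1 := Ck_D1 cv; have cv2 := Ck_D2 cv.
apply: (@sqint_div _ p a (ltW a0) U (fun y => v y * E1 y - 'D_e1 v y * cutoff x s y)
  (fun y => v y * E2 y - 'D_e2 v y * cutoff x s y) _ oU a0 QU).
- exact: (CkB oU (CkM oU (CkW cv) cE1) (CkM oU cv1 cc)).
- exact: (CkB oU (CkM oU (CkW cv) cE2) (CkM oU cv2 cc)).
- move=> y _ ya; have /(cutoff_out_square s0)/(cutoff_out s0)[c0 c1 _] :=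
    or_introl (3 / 2 * s <= `|y.2 - x.2|) (inside_edge1 ins ya).
  by rewrite /E1 c0 c1 mul0r !mulr0 subr0.
- move=> y _ ya; have /(cutoff_out_square s0)/(cutoff_out s0)[c0 c1 _] :=
    or_intror (3 / 2 * s <= `|y.1 - x.1|) (inside_edge2 ins ya).
  by rewrite /E2 c0 c1 mul0r !mulr0 subr0.
move=> y Qy; have Uy := QU Qy.
have de1 := is_derive_cutoff1 x s y e1; rewrite dsq_e1 in de1.
have de2 := is_derive_cutoff1 x s y e2; rewrite dsq_e2 in de2.
have dc1 := is_derive_cutoff x s y e1; rewrite dsq_e1 in dc1.
have dc2 := is_derive_cutoff x s y e2; rewrite dsq_e2 in dc2.
have [_ d1] := is_deriveB2 (is_deriveM2 (Ck_is_derive1 cv Uy)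
  (is_deriveM2 de1 (is_deriveM2 (is_deriveC2 2 y e1) (is_derive_sub1 x y e1))))
  (is_deriveM2 (Ck_is_derive1 cv1 Uy) dc1).
have [_ d2] := is_deriveB2 (is_deriveM2 (Ck_is_derive2 cv Uy)
  (is_deriveM2 de2 (is_deriveM2 (is_deriveC2 2 y e2) (is_derive_sub2 x y e2))))
  (is_deriveM2 (Ck_is_derive2 cv2 Uy) dc2).
apply: etrans (esym (congr2 +%R d1 d2)).
exact: (mass_identity (v y) ('D_e1 v y) ('D_e2 v y) ('D_e1 ('D_e1 v) y) ('D_e2 ('D_e2 v) y)
  (cutoff x s y) (cutoff1 x s y) (cutoff2 x s y) (erefl (sqdist x y))
  (erefl : (e1 : R * R).1 = 1) (erefl : (e2 : R * R).2 = 1)).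
Qed.

(** Both derivatives move onto the cutoff, whose Laplacian lives on the annulus and is at most 468 /
    s^2, with 468 = 4 (54 * 2 + 9); times the area 9 s^2 this gives 4212. *)
Lemma cutoff_mass_bound v (C : R) : Ck 2 U v -> 0 <= C ->
  (forall y, s ^+ 2 < sqdist x y < 2 * s ^+ 2 -> `|v y| <= C) ->
  sqint p a (fun y => - laplacian v y * cutoff x s y) <= 4212 * C.
Proof.
move=> cv C0 vC.
have cl : cont_on Q (fun y => v y * lapc y).
  exact: (cont_onM (Ck_cont_on QU cv) (Ck_cont_onT clap)).
have cL : cont_on Q (fun y => - laplacian v y * cutoff x s y).
  apply: cont_onM; last exact: Ck_cont_onT (Ck_cutoff x s).
  exact: (cont_onN (cont_onD (Ck_cont_on QU (Ck_D1 (Ck_D1 cv)))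
    (Ck_cont_on QU (Ck_D2 (Ck_D2 cv))))).
have lap0 y : ~~ (s ^+ 2 < sqdist x y < 2 * s ^+ 2) -> lapc y = 0.
  rewrite negb_and -!leNgt => /orP[/(cutoff_in s0)|/(cutoff_out s0)] [_ c1 c2];
  by rewrite /lapc c1 c2 mul0r addr0 mulr0.
have s20 : 0 < s ^+ 2 by rewrite exprn_gt0.
have K0 : 0 <= 468 / s ^+ 2 by exact: (divr_ge0 (ler0n _ 468) (ltW s20)).
have lapb y : s ^+ 2 < sqdist x y < 2 * s ^+ 2 -> `|lapc y| <= 468 / s ^+ 2.
  move=> /andP[_ yS]; rewrite /lapc.
  have h1 : `|cutoff2 x s y * sqdist x y| <= 54 / s ^+ 4 * (2 * s ^+ 2).
    rewrite normrM (ger0_norm (sqdist_ge0 x y)).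
    by apply: ler_pM; rewrite ?sqdist_ge0 ?(ltW yS)// cutoff2_bound.
  have h2 := cutoff1_bound x s0 y.
  have E : 468 / s ^+ 2 = 4 * (54 / s ^+ 4 * (2 * s ^+ 2) + 9 / s ^+ 2).
    by field; exact: lt0r_neq0.
  rewrite E normrM [ `|4|]ger0_norm ?ler0n//; apply: ler_wpM2l; first exact: ler0n.
  exact: (le_trans (ler_normD _ _) (lerD h1 h2)).
have := cutoff_mass cv; rewrite sqintD//; last exact: ltW.
move=> /eqP; rewrite addr_eq0 => /eqP ->.
apply: (le_trans (ler_norm _)); rewrite normrN.
have -> : 4212 * C = C * (468 / s ^+ 2) * (4 * (3 / 2 * s) ^+ 2).
  by field; exact: lt0r_neq0.
apply: (@sqint_supp _ p a (ltW a0) _ x _ _ _ (mulr_ge0 C0 K0) (inside_square ins) cl).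
- by have := s0; lra.
- move=> y _; have [yi|/lap0 ->] := boolP (s ^+ 2 < sqdist x y < 2 * s ^+ 2).
    rewrite normrM; exact: (ler_pM (normr_ge0 _) (normr_ge0 _) (vC y yi) (lapb y yi)).
  rewrite mulr0 normr0; exact: (mulr_ge0 C0 K0).
- move=> y _ /not_square_far /(cutoff_out_square s0) ys.
  by rewrite lap0 ?mulr0// negb_and -!leNgt ys orbT.
Qed.

End CutoffMass.

(** * A small Hopf differential forces the bubble *)

Section BubbleApproximation.
Context {R : realType}.
Implicit Types (y z : R * R).

Lemma ln_lipschitz (b c : R) : 1 <= b -> 1 <= c -> `|ln b - ln c| <= `|b - c|.
Proof.
have key (s t : R) : 1 <= s -> s <= t -> 0 <= ln t - ln s <= t - s.
  move=> s1 st; have s0 : 0 < s by apply: lt_le_trans s1.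
  have t0 : 0 < t by apply: lt_le_trans st.
  rewrite subr_ge0 ler_ln ?posrE// st /= -ln_div ?posrE//.
  have -> : t / s = 1 + (t - s) / s by field; exact: lt0r_neq0.
  have h : 0 <= (t - s) / s by rewrite divr_ge0 ?subr_ge0// ltW.
  apply: (@le_trans _ _ ((t - s) / s)); first by apply: le_ln1Dx; apply: lt_le_trans h.
  by rewrite ler_pdivrMr// ler_peMr// subr_ge0.
move=> b1 c1; have [bc|cb] := leP b c.
  have /andP[h1 h2] := key b c b1 bc.
  by rewrite distrC ger0_norm// distrC ger0_norm ?subr_ge0.
have /andP[h1 h2] := key c b c1 (ltW cb).
by rewrite ger0_norm// ger0_norm// subr_ge0 ltW.
Qed.

Lemma bubbleE (d : R) y z : 0 < d ->
  bubble (d^-1 *: (y - z)) = - 2 * ln (1 + sqdist z y / (8 * d ^+ 2)).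
Proof.
move=> d0.
have S0 : 0 <= sqdist z y / (8 * d ^+ 2).
  by rewrite divr_ge0 ?sqdist_ge0// mulr_ge0// exprn_ge0// ltW.
have E : enorm (d^-1 *: (y - z)) ^+ 2 = sqdist z y / d ^+ 2.
  rewrite /enorm sqr_sqrtr; last first.
    by rewrite /dotp -!expr2 addr_ge0 ?sqr_ge0.
  rewrite /dotp /sqdist /= /GRing.scale /=.
  by field; exact: lt0r_neq0.
rewrite /bubble E.
have -> : 8^-1 * (sqdist z y / d ^+ 2) = sqdist z y / (8 * d ^+ 2).
  by field; exact: lt0r_neq0.
have p1 : 0 < 1 + sqdist z y / (8 * d ^+ 2) by rewrite ltr_pwDl.
rewrite div1r lnV ?posrE ?exprn_gt0// lnXn//.
by rewrite -mulr_natl; ring.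
Qed.

Variables (U : set (R * R)) (v kap : R * R -> R) (p : R * R) (d L C eta : R).
Hypotheses (oU : open U) (cv : Ck 2 U v) (d0 : 0 < d) (L0 : 0 <= L) (C0 : 0 <= C)
  (eta0 : 0 <= eta).
Hypothesis sub : square p (L * d) `<=` U.
Local Notation Q := (square p (L * d)).
Hypothesis v1C : forall y, Q y -> `|'D_e1 v y| <= C / d.
Hypothesis v2C : forall y, Q y -> `|'D_e2 v y| <= C / d.
Hypothesis AC : forall y, Q y -> `|hopfA v y| <= eta / d ^+ 2.
Hypothesis BC : forall y, Q y -> `|hopfB v y| <= eta / d ^+ 2.
Hypothesis vmax : forall y, Q y -> v y <= v p.
Hypothesis lapv : forall y, Q y -> - laplacian v y = kap y * expR (v y - v p) / d ^+ 2.
Hypothesis kap1 : forall y, Q y -> `|kap y - 1| <= eta.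
Hypothesis v1p : 'D_e1 v p = 0.
Hypothesis v2p : 'D_e2 v p = 0.

Let Qp : Q p. Proof. by apply: square_center; rewrite mulr_ge0// ltW. Qed.

(** With this [g] the Hopf differential becomes linear: [hopfA] + i [hopfB] = - 8 g_zz / g. For the
    exact bubble [g] is the polynomial 1 + |y - p|^2 / (8 d^2). *)
Let g y := expR (- 2^-1 * (v y - v p)).
Let h y := expR (2^-1 * (v y - v p)).
Let E := expR (C * L).

Let gh y : g y * h y = 1.
Proof. by rewrite /g /h -expRD mulNr addNr expR0. Qed.

Let h2 y : expR (v y - v p) = h y * h y.
Proof. by rewrite /h -expRD; congr expR; field. Qed.

Let h_le1 y : Q y -> 0 <= h y <= 1.
Proof.
move=> Qy; rewrite /h expR_ge0 /= -[leRHS]expR0 ler_expR.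
by have := vmax Qy; lra.
Qed.

Let g_ge1 y : Q y -> 1 <= g y.
Proof.
by move=> Qy; rewrite /g -[leLHS]expR0 ler_expR; have := vmax Qy; lra.
Qed.

Let Q_dist y z : Q y -> Q z -> `|y.1 - p.1| + `|y.2 - p.2| <= 2 * (L * d).
Proof. by move=> /squareP[y1 y2] _; lra. Qed.

Let g_leE y : Q y -> g y <= E.
Proof.
move=> Qy; rewrite /g /E ler_expR.
have := square_mean_value (CkW cv) sub (fun z Qz => conj (v1C Qz) (v2C Qz)) Qy Qp.
have : C / d * (`|y.1 - p.1| + `|y.2 - p.2|) <= C / d * (2 * (L * d)).
  by apply: ler_wpM2l; [rewrite divr_ge0// ltW|exact: Q_dist Qy Qp].
have -> : C / d * (2 * (L * d)) = 2 * (C * L) by field; exact: lt0r_neq0.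
rewrite -[v y - v p]opprB normrN => h1 h3; have := le_trans h3 h1.
by have := ler_norm (v p - v y); lra.
Qed.

Let E_ge1 : 1 <= E. Proof. by rewrite /E -expR0 ler_expR mulr_ge0. Qed.

Let cvp n : (n <= 2)%N -> Ck n U (fun y => v y - v p).
Proof. by move=> n2; exact: (CkB oU (Ck_le n2 cv) (Ck_cst n _ oU)). Qed.

Let cg : Ck 2 U g.
Proof. exact: (Ck_expR oU (CkM oU (Ck_cst 2 _ oU) (cvp (leqnn 2)))). Qed.

Let ch : Ck 2 U h.
Proof. exact: (Ck_expR oU (CkM oU (Ck_cst 2 _ oU) (cvp (leqnn 2)))). Qed.

Let is_derive_v1 y : U y -> is_derive y e1 (fun y => v y - v p) ('D_e1 v y).
Proof.
move=> Uy; apply: is_derive_eq (is_deriveB2 (Ck_is_derive1 cv Uy) (is_deriveC2 (v p) y e1)) _.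
exact: subr0.
Qed.

Let is_derive_v2 y : U y -> is_derive y e2 (fun y => v y - v p) ('D_e2 v y).
Proof.
move=> Uy; apply: is_derive_eq (is_deriveB2 (Ck_is_derive2 cv Uy) (is_deriveC2 (v p) y e2)) _.
exact: subr0.
Qed.

Lemma expR_scaled_derive (f : R * R -> R) (c b : R) y w : is_derive y w f b ->
  is_derive y w (fun y => expR (c * f y)) (c * b * expR (c * f y)).
Proof.
move=> fb; apply: is_derive_eq (is_derive_expR2 (is_deriveM2 (is_deriveC2 c y w) fb)) _.
by rewrite mul0r add0r mulrC.
Qed.

Let dg1 y : U y -> is_derive y e1 g (- 2^-1 * 'D_e1 v y * g y).
Proof. by move=> Uy; exact: expR_scaled_derive (is_derive_v1 Uy). Qed.
Let dg2 y : U y -> is_derive y e2 g (- 2^-1 * 'D_e2 v y * g y).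
Proof. by move=> Uy; exact: expR_scaled_derive (is_derive_v2 Uy). Qed.
Let dh1 y : U y -> is_derive y e1 h (2^-1 * 'D_e1 v y * h y).
Proof. by move=> Uy; exact: expR_scaled_derive (is_derive_v1 Uy). Qed.
Let dh2 y : U y -> is_derive y e2 h (2^-1 * 'D_e2 v y * h y).
Proof. by move=> Uy; exact: expR_scaled_derive (is_derive_v2 Uy). Qed.

                                                                           
(** This is d^2 Delta g if [kap] = 1. It is an almost first integral: its gradient involves only the
    Hopf differential and [kap] - 1. *)
Let q y := 4^-1 * d ^+ 2 * (('D_e1 v y * 'D_e1 v y + 'D_e2 v y * 'D_e2 v y) * g y) +
  2^-1 * h y.

Let cq : Ck 1 U q.
Proof.
have c1 := Ck_D1 cv; have c2 := Ck_D2 cv.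
exact: (CkD oU (CkM oU (Ck_cst 1 _ oU) (CkM oU (CkD oU (CkM oU c1 c1) (CkM oU c2 c2)) (CkW cg)))
  (CkM oU (Ck_cst 1 _ oU) (CkW ch))).
Qed.

Lemma first_integral1 (k v1 v2 v11 v12 v22 G H A B : R) : G * H = 1 ->
  A = v11 - v22 - 2^-1 * (v1 * v1 - v2 * v2) -> B = - 2 * v12 + v1 * v2 ->
  - (v11 + v22) = k * (H * H) / d ^+ 2 ->
  (0 * ((v1 * v1 + v2 * v2) * G) + 4^-1 * d ^+ 2 *
     (((v11 * v1 + v1 * v11) + (v12 * v2 + v2 * v12)) * G +
       (v1 * v1 + v2 * v2) * (- 2^-1 * v1 * G))) +
  (0 * H + 2^-1 * (2^-1 * v1 * H)) =
  4^-1 * (G * (d ^+ 2 * A * v1 - d ^+ 2 * B * v2) + v1 * (1 - k) * H).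
Proof.
move=> GH -> -> lap; have d2 : d ^+ 2 != 0 by rewrite expf_neq0// lt0r_neq0.
have E1 : k * H = - (d ^+ 2 * G * (v11 + v22)).
  rewrite -mulrN lap.
  have -> : d ^+ 2 * G * (k * (H * H) / d ^+ 2) = k * H * (G * H) * (d ^+ 2 / d ^+ 2) by ring.
  by rewrite divff// GH !mulr1.
have -> : v1 * (1 - k) * H = v1 * H - v1 * (k * H) by ring.
by rewrite E1; field.
Qed.

Lemma first_integral2 (k v1 v2 v11 v12 v21 v22 G H A B : R) : G * H = 1 -> v12 = v21 ->
  A = v11 - v22 - 2^-1 * (v1 * v1 - v2 * v2) -> B = - 2 * v12 + v1 * v2 ->
  - (v11 + v22) = k * (H * H) / d ^+ 2 ->
  (0 * ((v1 * v1 + v2 * v2) * G) + 4^-1 * d ^+ 2 *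
     (((v21 * v1 + v1 * v21) + (v22 * v2 + v2 * v22)) * G +
       (v1 * v1 + v2 * v2) * (- 2^-1 * v2 * G))) +
  (0 * H + 2^-1 * (2^-1 * v2 * H)) =
  4^-1 * (G * (- (d ^+ 2 * A) * v2 - d ^+ 2 * B * v1) + v2 * (1 - k) * H).
Proof.
move=> GH <- -> -> lap; have d2 : d ^+ 2 != 0 by rewrite expf_neq0// lt0r_neq0.
have E1 : k * H = - (d ^+ 2 * G * (v11 + v22)).
  rewrite -mulrN lap.
  have -> : d ^+ 2 * G * (k * (H * H) / d ^+ 2) = k * H * (G * H) * (d ^+ 2 / d ^+ 2) by ring.
  by rewrite divff// GH !mulr1.
have -> : v2 * (1 - k) * H = v2 * H - v2 * (k * H) by ring.
by rewrite E1; field.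
Qed.

Lemma first_integral_bound (G H A B v1 v2 k Eb : R) : 0 <= G <= Eb -> 1 <= Eb ->
  0 <= H <= 1 -> `|A| <= eta / d ^+ 2 -> `|B| <= eta / d ^+ 2 ->
  `|v1| <= C / d -> `|v2| <= C / d -> `|k - 1| <= eta ->
  `|4^-1 * (G * (d ^+ 2 * A * v1 - d ^+ 2 * B * v2) + v1 * (1 - k) * H)| <=
  Eb * C * eta / d.
Proof.
move=> /andP[G0 GE] E1 /andP[H0 H1] hA hB h1 h2' hk.
have d20 : 0 < d ^+ 2 by rewrite exprn_gt0.
have Cd : 0 <= C / d := le_trans (normr_ge0 _) h1.
have A' : `|d ^+ 2 * A| <= eta.
  by rewrite normrM (gtr0_norm d20) mulrC -ler_pdivlMr.
have B' : `|d ^+ 2 * B| <= eta.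
  by rewrite normrM (gtr0_norm d20) mulrC -ler_pdivlMr.
have t1 : `|d ^+ 2 * A * v1| <= eta * (C / d) by rewrite normrM ler_pM.
have t2 : `|d ^+ 2 * B * v2| <= eta * (C / d) by rewrite normrM ler_pM.
have t3 : `|G * (d ^+ 2 * A * v1 - d ^+ 2 * B * v2)| <= Eb * (2 * (eta * (C / d))).
  rewrite normrM (ger0_norm G0) ler_pM//.
  by have := ler_normB (d ^+ 2 * A * v1) (d ^+ 2 * B * v2); lra.
have t4 : `|v1 * (1 - k) * H| <= C / d * eta * Eb.
  rewrite !normrM (ger0_norm H0) distrC ler_pM ?mulr_ge0//; last exact: le_trans E1.
  by rewrite ler_pM.
have P0 : 0 <= Eb * C * eta / d.
  by rewrite !mulr_ge0 ?invr_ge0 ?(ltW d0)// (le_trans ler01).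
rewrite normrM gtr0_norm//.
have := ler_normD (G * (d ^+ 2 * A * v1 - d ^+ 2 * B * v2)) (v1 * (1 - k) * H).
move: t3 t4; rewrite (_ : Eb * (2 * (eta * (C / d))) = 2 * (Eb * C * eta / d)); last by ring.
rewrite (_ : C / d * eta * Eb = Eb * C * eta / d); last by ring.
by move: P0; lra.
Qed.

Let dq1 y : Q y -> `|'D_e1 q y| <= E * C * eta / d.
Proof.
move=> Qy; have Uy := sub Qy.
have v1 := Ck_is_derive1 (Ck_D1 cv) Uy; have v2 := Ck_is_derive1 (Ck_D2 cv) Uy.
have [_ ->] := is_deriveD2 (is_deriveM2 (is_deriveC2 (4^-1 * d ^+ 2) y e1) (is_deriveM2
  (is_deriveD2 (is_deriveM2 v1 v1) (is_deriveM2 v2 v2)) (dg1 Uy)))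
  (is_deriveM2 (is_deriveC2 2^-1 y e1) (dh1 Uy)).
have lap := lapv Qy; rewrite h2 in lap.
rewrite (first_integral1 (gh y) (erefl (hopfA v y)) (erefl (hopfB v y)) lap).
apply: first_integral_bound => //; [|exact: h_le1|exact: AC|exact: BC|exact: v1C|exact: v2C|exact: kap1].
by rewrite g_leE// andbT (le_trans ler01)// g_ge1.
Qed.

Let dq2 y : Q y -> `|'D_e2 q y| <= E * C * eta / d.
Proof.
move=> Qy; have Uy := sub Qy.
have v1 := Ck_is_derive2 (Ck_D1 cv) Uy; have v2 := Ck_is_derive2 (Ck_D2 cv) Uy.
have [_ ->] := is_deriveD2 (is_deriveM2 (is_deriveC2 (4^-1 * d ^+ 2) y e2) (is_deriveM2
  (is_deriveD2 (is_deriveM2 v1 v1) (is_deriveM2 v2 v2)) (dg2 Uy)))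
  (is_deriveM2 (is_deriveC2 2^-1 y e2) (dh2 Uy)).
have lap := lapv Qy; rewrite h2 in lap.
rewrite (first_integral2 (gh y) (schwarz oU cv Uy) (erefl (hopfA v y)) (erefl (hopfB v y)) lap).
rewrite -mulrN.
apply: first_integral_bound => //; rewrite ?normrN; [|exact: h_le1|exact: AC|exact: BC|exact: v2C|exact: v1C|exact: kap1].
by rewrite g_leE// andbT (le_trans ler01)// g_ge1.
Qed.

(** At [p] the gradient of [v] vanishes and [h] is 1, which fixes the value 1 / 2 of the first
    integral. *)
Let q_half y : Q y -> `|q y - 2^-1| <= 2 * L * (E * C * eta).
Proof.
move=> Qy.
have qp : q p = 2^-1.
  by rewrite /q v1p v2p !mul0r addr0 mul0r mulr0 add0r /h subrr mulr0 expR0 mulr1.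
have := square_mean_value cq sub (fun z Qz => conj (dq1 Qz) (dq2 Qz)) Qy Qp.
rewrite qp => /le_trans; apply.
have P0 : 0 <= E * C * eta / d.
  by rewrite !mulr_ge0 ?invr_ge0 ?(ltW d0)// (le_trans ler01).
apply: (le_trans (ler_wpM2l P0 (Q_dist Qy Qp))).
rewrite (_ : E * C * eta / d * (2 * (L * d)) = 2 * L * (E * C * eta))//.
by field; exact: lt0r_neq0.
Qed.

(** The deviation of [g] from the exact solution; it vanishes at [p] together with its gradient. *)
Let k y := g y - (1 + (8 * d ^+ 2)^-1 * sqdist p y).
Let k1 y := - 2^-1 * 'D_e1 v y * g y - (8 * d ^+ 2)^-1 * (2 * (y.1 - p.1)).
Let k2 y := - 2^-1 * 'D_e2 v y * g y - (8 * d ^+ 2)^-1 * (2 * (y.2 - p.2)).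

Let dk1 y : U y -> is_derive y e1 k (k1 y).
Proof.
move=> Uy; apply: is_derive_eq (is_deriveB2 (dg1 Uy) (is_deriveD2 (is_deriveC2 1 y e1)
  (is_deriveM2 (is_deriveC2 (8 * d ^+ 2)^-1 y e1) (is_derive_sqdist p y e1)))) _.
by rewrite mul0r !add0r dsq_e1.
Qed.

Let dk2 y : U y -> is_derive y e2 k (k2 y).
Proof.
move=> Uy; apply: is_derive_eq (is_deriveB2 (dg2 Uy) (is_deriveD2 (is_deriveC2 1 y e2)
  (is_deriveM2 (is_deriveC2 (8 * d ^+ 2)^-1 y e2) (is_derive_sqdist p y e2)))) _.
by rewrite mul0r !add0r dsq_e2.
Qed.

Let ck1 : Ck 1 U k1.
Proof.
exact: (CkB oU (CkM oU (CkM oU (Ck_cst 1 _ oU) (Ck_D1 cv)) (CkW cg))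
  (CkM oU (Ck_cst 1 _ oU) (CkM oU (Ck_cst 1 2 oU)
    (CkB oU (Ck_fst 1 oU) (Ck_cst 1 p.1 oU))))).
Qed.

Let ck2 : Ck 1 U k2.
Proof.
exact: (CkB oU (CkM oU (CkM oU (Ck_cst 1 _ oU) (Ck_D2 cv)) (CkW cg))
  (CkM oU (Ck_cst 1 _ oU) (CkM oU (Ck_cst 1 2 oU)
    (CkB oU (Ck_snd 1 oU) (Ck_cst 1 p.2 oU))))).
Qed.

Let ck : Ck 1 U k.
Proof.
apply: (CkB oU (CkW cg) (CkD oU (Ck_cst 1 1 oU) (CkM oU (Ck_cst 1 _ oU) _))).
by apply: Ck_subset (Ck_sqdist 1 p); exact: subsetT.
Qed.

Let eta2 := eta * (L * E * C + 1 + E).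

Lemma norm_le_eq (X Y K : R) : X = Y -> `|Y| <= K -> `|X| <= K.
Proof. by move=> ->. Qed.

(** The trace-free part of the Hessian of [g] is the Hopf differential times [g] up to a factor, and
    its trace is determined by [q] and [kap]; the polynomial subtracted in [k] has Hessian 1 / (4
    d^2) times the identity. *)
Lemma hessian_bound (G H A B v1 v2 v11 v12 v21 v22 kk qq Eb e11 e21 e12 e22 t1 t2 : R) :
  G * H = 1 -> 0 <= G <= Eb -> 0 <= H <= 1 ->
  A = v11 - v22 - 2^-1 * (v1 * v1 - v2 * v2) -> B = - 2 * v12 + v1 * v2 -> v12 = v21 ->
  - (v11 + v22) = kk * (H * H) / d ^+ 2 ->
  qq = 4^-1 * d ^+ 2 * ((v1 * v1 + v2 * v2) * G) + 2^-1 * H ->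
  `|A| <= eta / d ^+ 2 -> `|B| <= eta / d ^+ 2 -> `|kk - 1| <= eta ->
  `|qq - 2^-1| <= 2 * L * (Eb * C * eta) ->
  e11 = 1 -> e21 = 0 -> e12 = 0 -> e22 = 1 -> let K := eta * (L * Eb * C + 1 + Eb) / d ^+ 2 in
  [/\ `|((0 * v1 + - 2^-1 * v11) * G + - 2^-1 * v1 * (- 2^-1 * v1 * G)) -
        (0 * (2 * t1) + (8 * d ^+ 2)^-1 * (0 * t1 + 2 * e11))| <= K,
      `|((0 * v1 + - 2^-1 * v21) * G + - 2^-1 * v1 * (- 2^-1 * v2 * G)) -
        (0 * (2 * t1) + (8 * d ^+ 2)^-1 * (0 * t1 + 2 * e21))| <= K,
      `|((0 * v2 + - 2^-1 * v12) * G + - 2^-1 * v2 * (- 2^-1 * v1 * G)) -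
        (0 * (2 * t2) + (8 * d ^+ 2)^-1 * (0 * t2 + 2 * e12))| <= K &
      `|((0 * v2 + - 2^-1 * v22) * G + - 2^-1 * v2 * (- 2^-1 * v2 * G)) -
        (0 * (2 * t2) + (8 * d ^+ 2)^-1 * (0 * t2 + 2 * e22))| <= K].
Proof.
move=> GH /andP[G0 GE] /andP[H0 H1] EA EB <- lap Eq hA hB hk hq -> -> -> -> K.
have d20 : 0 < d ^+ 2 by rewrite exprn_gt0.
have d2 : d ^+ 2 != 0 by rewrite lt0r_neq0.
have A' : `|d ^+ 2 * A| <= eta.
  by rewrite normrM (gtr0_norm d20) mulrC -ler_pdivlMr.
have B' : `|d ^+ 2 * B| <= eta.
  by rewrite normrM (gtr0_norm d20) mulrC -ler_pdivlMr.
have E1 : d ^+ 2 * G * (v11 + v22) = - (kk * H).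
  rewrite -[v11 + v22]opprK mulrN lap; congr (- _).
  have -> : d ^+ 2 * G * (kk * (H * H) / d ^+ 2) = kk * H * (G * H) * (d ^+ 2 / d ^+ 2) by ring.
  by rewrite divff// GH !mulr1.
have E0 : 0 <= Eb := le_trans G0 GE.
have LE : 0 <= L * Eb * C * eta by rewrite !mulr_ge0.
have tA : `|G * (d ^+ 2 * A)| <= Eb * eta by rewrite normrM (ger0_norm G0) ler_pM.
have tB : `|G * (d ^+ 2 * B)| <= Eb * eta by rewrite normrM (ger0_norm G0) ler_pM.
have tk : `|(kk - 1) * H| <= eta by rewrite normrM (ger0_norm H0) -[leRHS]mulr1 ler_pM.
have Ee : 0 <= Eb * eta by rewrite mulr_ge0.
have main (X t : R) : X = t / d ^+ 2 -> `|t| <= eta * (L * Eb * C + 1 + Eb) -> `|X| <= K.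
  by move=> -> ht; rewrite normrM [ `|_^-1|]gtr0_norm ?invr_gt0// ler_pM2r ?invr_gt0.
have hq' : `|2^-1 * (qq - 2^-1)| <= L * Eb * C * eta.
  by rewrite normrM gtr0_norm// -ler_pdivlMl// invrK; move: hq; lra.
split.
- apply: (main _ (2^-1 * (qq - 2^-1) + 4^-1 * ((kk - 1) * H) - 4^-1 * (G * (d ^+ 2 * A)))).
    apply: (canRL (mulfK d2)).
    have -> : (kk - 1) * H = - (d ^+ 2 * G * (v11 + v22)) - H by rewrite E1; ring.
    by rewrite Eq EA; field; exact: lt0r_neq0.
  have := ler_normB (2^-1 * (qq - 2^-1) + 4^-1 * ((kk - 1) * H)) (4^-1 * (G * (d ^+ 2 * A))).
  have := ler_normD (2^-1 * (qq - 2^-1)) (4^-1 * ((kk - 1) * H)).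
  rewrite [ `|4^-1 * ((kk - 1) * H)|]normrM [ `|4^-1 * (G * _)|]normrM gtr0_norm//.
  by move: hq' tA tk LE Ee eta0; lra.
- apply: (main _ (4^-1 * (G * (d ^+ 2 * B)))).
    by apply: (canRL (mulfK d2)); rewrite EB; field; exact: lt0r_neq0.
  by rewrite normrM gtr0_norm//; move: tB LE Ee eta0; lra.
- apply: (main _ (4^-1 * (G * (d ^+ 2 * B)))).
    by apply: (canRL (mulfK d2)); rewrite EB; field; exact: lt0r_neq0.
  by rewrite normrM gtr0_norm//; move: tB LE Ee eta0; lra.
- apply: (main _ (2^-1 * (qq - 2^-1) + 4^-1 * ((kk - 1) * H) + 4^-1 * (G * (d ^+ 2 * A)))).
    apply: (canRL (mulfK d2)).
    have -> : (kk - 1) * H = - (d ^+ 2 * G * (v11 + v22)) - H by rewrite E1; ring.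
    by rewrite Eq EA; field; exact: lt0r_neq0.
  have := ler_normD (2^-1 * (qq - 2^-1) + 4^-1 * ((kk - 1) * H)) (4^-1 * (G * (d ^+ 2 * A))).
  have := ler_normD (2^-1 * (qq - 2^-1)) (4^-1 * ((kk - 1) * H)).
  rewrite [ `|4^-1 * ((kk - 1) * H)|]normrM [ `|4^-1 * (G * _)|]normrM gtr0_norm//.
  by move: hq' tA tk LE Ee eta0; lra.
Qed.

Let hess y : Q y -> [/\ `|'D_e1 k1 y| <= eta2 / d ^+ 2, `|'D_e2 k1 y| <= eta2 / d ^+ 2,
  `|'D_e1 k2 y| <= eta2 / d ^+ 2 & `|'D_e2 k2 y| <= eta2 / d ^+ 2].
Proof.
move=> Qy; have Uy := sub Qy.
have c8 w := is_deriveC2 (8 * d ^+ 2)^-1 y w; have cc w := is_deriveC2 (2 : R) y w.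
have ch' w := is_deriveC2 (- 2^-1 : R) y w.
have [_ d11] := is_deriveB2 (is_deriveM2 (is_deriveM2 (ch' e1)
  (Ck_is_derive1 (Ck_D1 cv) Uy)) (dg1 Uy))
  (is_deriveM2 (c8 e1) (is_deriveM2 (cc e1) (is_derive_sub1 p y e1))).
have [_ d21] := is_deriveB2 (is_deriveM2 (is_deriveM2 (ch' e2)
  (Ck_is_derive2 (Ck_D1 cv) Uy)) (dg2 Uy))
  (is_deriveM2 (c8 e2) (is_deriveM2 (cc e2) (is_derive_sub1 p y e2))).
have [_ d12] := is_deriveB2 (is_deriveM2 (is_deriveM2 (ch' e1)
  (Ck_is_derive1 (Ck_D2 cv) Uy)) (dg1 Uy))
  (is_deriveM2 (c8 e1) (is_deriveM2 (cc e1) (is_derive_sub2 p y e1))).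
have [_ d22] := is_deriveB2 (is_deriveM2 (is_deriveM2 (ch' e2)
  (Ck_is_derive2 (Ck_D2 cv) Uy)) (dg2 Uy))
  (is_deriveM2 (c8 e2) (is_deriveM2 (cc e2) (is_derive_sub2 p y e2))).
have lap := lapv Qy; rewrite h2 in lap.
have gI : 0 <= g y <= E by rewrite g_leE// andbT (le_trans ler01)// g_ge1.
have [b11 b21 b12 b22] := hessian_bound (y.1 - p.1) (y.2 - p.2) (gh y) gI (h_le1 Qy) (erefl (hopfA v y)) (erefl (hopfB v y))
  (schwarz oU cv Uy) lap (erefl (q y)) (AC Qy) (BC Qy) (kap1 Qy) (q_half Qy)
  (erefl : (e1 : R * R).1 = 1) (erefl : (e2 : R * R).1 = 0)
  (erefl : (e1 : R * R).2 = 0) (erefl : (e2 : R * R).2 = 1).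
split; [exact: (norm_le_eq d11 b11)|exact: (norm_le_eq d21 b21)
  |exact: (norm_le_eq d12 b12)|exact: (norm_le_eq d22 b22)].
Qed.

(** Integrate the Hessian bound for [k] twice from [p], then take logarithms, which are 1-Lipschitz
    on [1, oo); both [g] and the polynomial are at least 1. *)
Lemma bubble_approx y : Q y ->
  `|v y - v p - bubble (d^-1 *: (y - p))| <= 8 * L ^+ 2 * (eta * (L * E * C + 1 + E)).
Proof.
move=> Qy.
have eta20 : 0 <= eta2.
  have E0 : 0 <= E := le_trans ler01 E_ge1.
  by rewrite /eta2 mulr_ge0// !addr_ge0// !mulr_ge0.
have P0 : 0 <= eta2 / d ^+ 2 by rewrite divr_ge0// exprn_ge0// ltW.
have k1p : k1 p = 0 by rewrite /k1 v1p subrr !(mulr0, mul0r) subr0.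
have k2p : k2 p = 0 by rewrite /k2 v2p subrr !(mulr0, mul0r) subr0.
have K1 z : Q z -> `|k1 z| <= eta2 * (2 * L) / d.
  move=> Qz; have := square_mean_value ck1 sub
    (fun z Qz => let: And4 h11 h21 _ _ := hess Qz in conj h11 h21) Qz Qp.
  rewrite k1p subr0 => /le_trans; apply.
  apply: (le_trans (ler_wpM2l P0 (Q_dist Qz Qp))).
  rewrite (_ : eta2 / d ^+ 2 * (2 * (L * d)) = eta2 * (2 * L) / d)//.
  by field; exact: lt0r_neq0.
have K2 z : Q z -> `|k2 z| <= eta2 * (2 * L) / d.
  move=> Qz; have := square_mean_value ck2 sub
    (fun z Qz => let: And4 _ _ h12 h22 := hess Qz in conj h12 h22) Qz Qp.
  rewrite k2p subr0 => /le_trans; apply.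
  apply: (le_trans (ler_wpM2l P0 (Q_dist Qz Qp))).
  rewrite (_ : eta2 / d ^+ 2 * (2 * (L * d)) = eta2 * (2 * L) / d)//.
  by field; exact: lt0r_neq0.
have kp : k p = 0.
  by rewrite /k /g subrr mulr0 expR0 /sqdist !subrr expr0n /= addr0 mulr0 addr0 subrr.
have D1k z : Q z -> `|'D_e1 k z| <= eta2 * (2 * L) / d.
  by move=> Qz; have [_ ->] := dk1 (sub Qz); exact: K1.
have D2k z : Q z -> `|'D_e2 k z| <= eta2 * (2 * L) / d.
  by move=> Qz; have [_ ->] := dk2 (sub Qz); exact: K2.
have Kb : `|k y| <= 4 * L ^+ 2 * eta2.
  have := square_mean_value ck sub (fun z Qz => conj (D1k z Qz) (D2k z Qz)) Qy Qp.
  rewrite kp subr0 => /le_trans; apply.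
  have P1 : 0 <= eta2 * (2 * L) / d.
    exact: (divr_ge0 (mulr_ge0 eta20 (mulr_ge0 (ler0n _ 2) L0)) (ltW d0)).
  apply: (le_trans (ler_wpM2l P1 (Q_dist Qy Qp))).
  rewrite (_ : eta2 * (2 * L) / d * (2 * (L * d)) = 4 * L ^+ 2 * eta2)//.
  by field; exact: lt0r_neq0.
rewrite (bubbleE y p d0).
have -> : v y - v p = - 2 * ln (g y) by rewrite /g expRK; field.
have S0 : 0 <= sqdist p y / (8 * d ^+ 2).
  by rewrite divr_ge0 ?sqdist_ge0// mulr_ge0// exprn_ge0// ltW.
rewrite -mulrBr normrM normrN [ `|2|]ger0_norm//.
have := @ln_lipschitz (g y) (1 + sqdist p y / (8 * d ^+ 2)) (g_ge1 Qy) ltac:(by rewrite lerDl).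
have -> : g y - (1 + sqdist p y / (8 * d ^+ 2)) = k y by rewrite /k mulrC.
move=> h3; rewrite (_ : 8 * L ^+ 2 * _ = 2 * (4 * L ^+ 2 * eta2)); last by rewrite /eta2; ring.
by apply: ler_wpM2l => //; exact: le_trans h3 Kb.
Qed.

End BubbleApproximation.

(** * Uniform estimates around one blow-up point *)

Section NearBlowup.
Context {R : realType}.
Implicit Types (x y z : R * R) (F G u : R * R -> R).
Variables (U : set (R * R)) (V : R * R -> R) (p : R * R) (rho Vm VM VD C0 Lam : R).
Local Notation Q := (square p (4 * rho)).
Hypotheses (oU : open U) (rho0 : 0 < rho) (QU : Q `<=` U) (cV : Ck 1 U V)
  (Vm0 : 0 < Vm) (C00 : 0 <= C0).
Hypothesis Vbounds : forall y, Q y -> Vm <= V y <= VM.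
Hypothesis Vgrad : forall y, Q y -> `|'D_e1 V y| + `|'D_e2 V y| <= VD.

(** Divided by the scale, it bounds the potential of the density: the first term is the peak, the
    second the bounded mass farther out. *)
Definition osc_const : R := 243 * (VM / Vm) + 4212 * C0.
Definition annulus_const : R :=
  4 * (243 * (Lam * VM * expR C0) * (rho / 4) + 3402 * C0 / (rho / 4)).
Definition hopf_bound_const (t : R) : R :=
  4 * (VD / Vm * (osc_const / t) +
    (6804 * annulus_const / rho + 162 * annulus_const ^+ 2)).
Definition grad_bound_const (t : R) : R := 4 * (osc_const / t + 3402 * C0 / rho).

Variables (lam d : R) (v : R * R -> R) (pk : R * R).
Hypotheses (lam0 : 0 < lam) (lamL : lam <= Lam) (d0 : 0 < d) (cv : Ck 2 U v).
Hypothesis eqv : forall y, U y -> - laplacian v y = lam * V y * expR (v y).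
Hypothesis pkp : edist p pk <= rho / 16.
Hypothesis vmax : forall y, edist pk y <= 2 * rho -> v y <= v pk.
Hypothesis dE : lam * V pk * expR (v pk) * d ^+ 2 = 1.
Hypothesis vC : forall y, rho / 8 <= edist p y <= 3 * rho -> `|v y| <= C0.

(** The working scale is capped by [rho] because [d] is not yet known to be small; [peak_bound] will
    serve to prove that. *)
Let t := Num.min d rho.
Let t0 : 0 < t. Proof. by rewrite /t lt_min d0. Qed.
Let t_rho : t <= rho. Proof. by rewrite /t ge_min lexx orbT. Qed.
Let t_d : t <= d. Proof. by rewrite /t ge_min lexx. Qed.
Let a0 : 0 < 4 * rho. Proof. by rewrite mulr_gt0. Qed.

Lemma ball_square y : edist p y <= 4 * rho -> Q y.
Proof.
move=> py; have [h1 h2] := edist_coord p y.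
by apply/squareP; split; [exact: le_trans h1 py|exact: le_trans h2 py].
Qed.

Lemma inside_ball x (s : R) : edist p x + 3 / 2 * s <= 4 * rho -> inside p (4 * rho) x s.
Proof.
have [h1 h2] := edist_coord p x.
by split; [move: h1|move: h2]; lra.
Qed.

Let Qp : Q p. Proof. by apply: square_center; exact: ltW. Qed.
Let Qpk : Q pk. Proof. by apply: ball_square; move: pkp rho0; lra. Qed.
Let VM0 : 0 < VM.
Proof. by have /andP[h1 h2] := Vbounds Qp; exact: (lt_le_trans Vm0 (le_trans h1 h2)). Qed.
Let V0 y : Q y -> 0 < V y.
Proof. by move=> /Vbounds/andP[h1 _]; exact: lt_le_trans h1. Qed.
Let VD0 : 0 <= VD.
Proof. by apply: le_trans (Vgrad Qp); rewrite addr_ge0. Qed.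
Definition density y := lam * V y * expR (v y).

Lemma density_Ck : Ck 1 U density.
Proof. exact: (CkM oU (CkM oU (Ck_cst 1 lam oU) cV) (Ck_expR oU (CkW cv))). Qed.

Let cf : cont_on Q density. Proof. exact: Ck_cont_on QU density_Ck. Qed.

Lemma density_ge0 y : Q y -> 0 <= density y.
Proof. by move=> Qy; rewrite /density !mulr_ge0 ?expR_ge0 ?(ltW lam0)// ltW// V0. Qed.

(** By the choice of [d] the density at [pk] is exactly d^-2; elsewhere e^v is no larger and V
    changes by a factor of at most VM / Vm. *)
Lemma density_peak y : Q y -> edist pk y <= 2 * rho -> density y <= VM / Vm / d ^+ 2.
Proof.
move=> Qy pky.
have Vpk := V0 Qpk; have /andP[Vmpk _] := Vbounds Qpk; have /andP[_ VyM] := Vbounds Qy.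
have -> : VM / Vm / d ^+ 2 = lam * (V pk / Vm * VM) * expR (v pk).
  have d2 : d ^+ 2 != 0 by rewrite expf_neq0// lt0r_neq0.
  apply: (canLR (mulfK d2)).
  rewrite (_ : _ * _ * _ * _ = (lam * V pk * expR (v pk) * d ^+ 2) * (VM / Vm)).
    by rewrite dE mul1r.
  by field; exact: lt0r_neq0.
apply: ler_pM; rewrite ?expR_ge0 ?ler_expR ?vmax ?mulr_ge0 ?(ltW lam0) ?(ltW (V0 Qy))//.
apply: ler_wpM2l; first exact: ltW.
by apply: (le_trans VyM); rewrite ler_peMl ?(ltW VM0)// ler_pdivlMr// mul1r.
Qed.

Lemma density_annulus y : rho / 8 <= edist p y <= 3 * rho ->
  density y <= Lam * VM * expR C0.
Proof.
move=> py; have /andP[_ py3] := py.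
have Qy : Q y by apply: ball_square; move: py3 rho0; lra.
have /andP[_ VyM] := Vbounds Qy.
rewrite /density; apply: ler_pM; rewrite ?expR_ge0 ?mulr_ge0 ?(ltW lam0) ?(ltW (V0 Qy))//.
  by apply: ler_pM; rewrite ?(ltW lam0) ?(ltW (V0 Qy)).
by rewrite ler_expR (le_trans (ler_norm _))// vC.
Qed.

Lemma density_mass x : edist p x <= rho / 2 ->
  sqint p (4 * rho) (fun y => density y * cutoff x rho y) <= 4212 * C0.
Proof.
move=> px.
have ins : inside p (4 * rho) p (2 * rho).
  apply: inside_ball; rewrite /edist /sqdist !subrr expr0n /= addr0 sqrtr0.
  by move: rho0; lra.
have r20 : 0 < 2 * rho by rewrite mulr_gt0.
(* The larger cutoff at [p] is 1 on the support of the one at [x], and its annulus lies between 2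
   rho and 3 rho, where [v] is bounded. *)
have ann y : (2 * rho) ^+ 2 < sqdist p y < 2 * (2 * rho) ^+ 2 -> `|v y| <= C0.
  move=> /(annulus_edist r20)/andP[h1 h2]; apply: vC.
  by apply/andP; split; [move: h1|move: h2]; move: rho0; lra.
apply: le_trans (cutoff_mass_bound oU a0 QU r20 ins cv C00 ann).
apply: le_sqint; first exact: ltW.
- exact: (cont_onM cf (Ck_cont_onT (Ck_cutoff x rho))).
- apply: cont_onM; last exact: Ck_cont_onT (Ck_cutoff p (2 * rho)).
  exact: (cont_onN (cont_onD (Ck_cont_on QU (Ck_D1 (Ck_D1 cv)))
    (Ck_cont_on QU (Ck_D2 (Ck_D2 cv))))).
move=> y Qy; rewrite eqv; last exact: QU.
apply: ler_wpM2l; first exact: density_ge0.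
have [ys|/ltW ys] := leP (2 * rho ^+ 2) (sqdist x y).
  by have [-> _ _] := cutoff_out rho0 ys; exact: cutoff_ge0.
have xy : edist x y <= 142 / 100 * rho.
  rewrite le_edist; last by move: rho0; lra.
  by apply: (le_trans ys); rewrite exprMn; have := exprn_gt0 2 rho0; lra.
have py : sqdist p y <= (2 * rho) ^+ 2.
  rewrite -le_edist; last exact: ltW.
  by have := edist_triangle p x y; move: px xy rho0; lra.
by have [-> _ _] := cutoff_in r20 py; exact: cutoff_le1.
Qed.

Lemma density_potential x (eps : R) : edist p x <= rho / 2 -> 0 < eps ->
  sqint p (4 * rho) (fun y => density y * (cutoff x rho y / Num.sqrt (mden x eps y))) <=
  osc_const / t.
Proof.
move=> px e0.
have ins : inside p (4 * rho) x rho by apply: inside_ball; move: px rho0; lra.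
pose K := VM / Vm / d ^+ 2.
have VV0 : 0 <= VM / Vm := divr_ge0 (ltW VM0) (ltW Vm0).
have K0 : 0 <= K by rewrite divr_ge0// exprn_ge0// ltW.
have fK y : Q y -> sqdist x y <= t ^+ 2 -> density y <= K.
  move=> Qy; rewrite -le_edist ?(ltW t0)// => xy; apply: density_peak => //.
  have := edist_triangle pk p y; have := edist_triangle p x y.
  rewrite (edistC pk p); move: px xy pkp t_rho rho0; lra.
apply: (le_trans (sqint_potential a0 t0 t_rho e0 K0 ins cf density_ge0 fK)).
have tV : 0 <= t^-1 by rewrite invr_ge0 ltW.
rewrite /osc_const [leRHS]mulrDl; apply: lerD.
  rewrite -[243 * K * t]mulrA -[243 * _ / t]mulrA; apply: ler_wpM2l; first exact: ler0n.
  rewrite /K -mulrA; apply: ler_wpM2l => //.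
  rewrite mulrC ler_pdivrMr ?exprn_gt0// mulrC ler_pdivlMr// -expr2.
  by apply: lerXn2r; rewrite ?nnegrE ?(ltW t0) ?(ltW d0).
by rewrite mulrC; apply: ler_wpM2r => //; exact: density_mass.
Qed.

Lemma gradient_center x : edist p x <= rho / 2 ->
  `|'D_e1 v x| <= grad_bound_const t /\ `|'D_e2 v x| <= grad_bound_const t.
Proof.
move=> px.
have ins : inside p (4 * rho) x rho by apply: inside_ball; move: px rho0; lra.
apply: (gradient_bound oU a0 QU rho0 ins cv cf) => //.
- move=> y Qy; have Uy := QU Qy; rewrite -normrN eqv// ger0_norm//.
  exact: density_ge0.
- move=> y /(annulus_edist rho0)/andP[h1 h2]; apply: vC.
  have := edist_triangle p x y; have := edist_triangle x p y; rewrite (edistC x p).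
  by move=> *; apply/andP; split; move: h1 h2 px rho0; lra.
- by move=> eps e0 _; exact: density_potential.
Qed.

(** The smaller radius rho / 4 keeps the support away from [p], where the density is bounded
    outright; the resulting bound does not depend on [d]. *)
Lemma gradient_annulus x : rho / 2 <= edist p x <= 2 * rho ->
  `|'D_e1 v x| <= annulus_const /\ `|'D_e2 v x| <= annulus_const.
Proof.
move=> /andP[px1 px2].
have s0 : 0 < rho / 4 by rewrite divr_gt0.
have ins : inside p (4 * rho) x (rho / 4) by apply: inside_ball; move: px2 rho0; lra.
have near_x y : edist x y <= 142 / 100 * (rho / 4) -> rho / 8 <= edist p y <= 3 * rho.
  move=> xy; have := edist_triangle p x y; have := edist_triangle p y x.
  by rewrite (edistC y x) => *; apply/andP; split; move: xy px1 px2 rho0; lra.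
have F0 : 0 <= Lam * VM * expR C0.
  by rewrite !mulr_ge0 ?expR_ge0 ?(ltW VM0)// (le_trans (ltW lam0)).
apply: (gradient_bound oU a0 QU s0 ins cv cf) => //.
- move=> y Qy; have Uy := QU Qy; rewrite -normrN eqv// ger0_norm//.
  exact: density_ge0.
- by move=> y /(annulus_edist s0)/andP[_ h2]; apply: vC; exact: near_x.
move=> eps e0 _.
have ck : cont_on Q (fun y => cutoff x (rho / 4) y / Num.sqrt (mden x eps y)).
  apply: (@Ck_cont_onT _ 1); apply: (CkM openT (CkW (Ck_cutoff x _))).
  apply: CkV; [exact: openT|by move=> y _; rewrite lt0r_neq0// sqrtr_gt0 mden_gt0|].
  by apply: Ck_sqrt; [exact: openT|move=> y _; exact: mden_gt0|exact: Ck_mden].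
have kb := sqint_inv_dist a0 s0 e0 ins.
apply: (@le_trans _ _ (sqint p (4 * rho) (fun y => Lam * VM * expR C0 *
    (cutoff x (rho / 4) y / Num.sqrt (mden x eps y))))).
  apply: le_sqint; first exact: ltW.
  - exact: cont_onM.
  - exact: (cont_onM (@cont_on_cst R Q _) ck).
  move=> y Qy; have [ys|/ltW ys] := leP (2 * (rho / 4) ^+ 2) (sqdist x y).
    by have [-> _ _] := cutoff_out s0 ys; rewrite !mul0r !mulr0.
  apply: ler_wpM2r; first by rewrite divr_ge0 ?cutoff_ge0 ?sqrtr_ge0.
  apply: density_annulus; apply: near_x.
  rewrite le_edist; last by move: rho0; lra.
  by apply: (le_trans ys); rewrite [leRHS]exprMn; have := exprn_gt0 2 s0; lra.
rewrite sqintZ//; last exact: ltW.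
rewrite (_ : 243 * (Lam * VM * expR C0) * (rho / 4) =
  Lam * VM * expR C0 * (243 * (rho / 4))); last by ring.
by apply: ler_wpM2l.
Qed.

Let N1 y := lam * expR (v y) * 'D_e1 V y.
Let N2 y := lam * expR (v y) * 'D_e2 V y.

Lemma density_derive (w V0' V1 ev v1 : R) :
  (0 * V0' + w * V1) * ev + w * V0' * (ev * v1) = w * V0' * ev * v1 + w * ev * V1.
Proof. by ring. Qed.

Let f1 y : U y -> 'D_e1 density y = density y * 'D_e1 v y + N1 y.
Proof.
move=> Uy; have [_ ->] := is_deriveM2 (is_deriveM2 (is_deriveC2 lam y e1)
  (Ck_is_derive1 cV Uy)) (is_derive_expR2 (Ck_is_derive1 cv Uy)).
exact: density_derive.
Qed.

Let f2 y : U y -> 'D_e2 density y = density y * 'D_e2 v y + N2 y.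
Proof.
move=> Uy; have [_ ->] := is_deriveM2 (is_deriveM2 (is_deriveC2 lam y e2)
  (Ck_is_derive2 cV Uy)) (is_derive_expR2 (Ck_is_derive2 cv Uy)).
exact: density_derive.
Qed.

(** The defect N = lam e^v grad V is dominated by VD / Vm times the density, whose potential is O(1
    / t). The Hopf differential is thus O(1 / t), although second derivatives of [v] are expected to
    be of order t^-2. *)
Lemma hopf_center x : edist p x <= rho / 2 ->
  `|hopfA v x| <= hopf_bound_const t /\ `|hopfB v x| <= hopf_bound_const t.
Proof.
move=> px.
have ins : inside p (4 * rho) x rho by apply: inside_ball; move: px rho0; lra.
have cev : cont_on Q (fun y => lam * expR (v y)).
  exact: (cont_onM (@cont_on_cst R Q lam) (Ck_cont_on QU (Ck_expR oU cv))).
have cN1 : cont_on Q N1 := cont_onM cev (Ck_cont_on QU (Ck_D1 cV)).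
have cN2 : cont_on Q N2 := cont_onM cev (Ck_cont_on QU (Ck_D2 cV)).
have cG : cont_on Q (fun y => VD / Vm * density y) := cont_onM (@cont_on_cst R Q _) cf.
have VDm0 : 0 <= VD / Vm := divr_ge0 VD0 (ltW Vm0).
have NG y : Q y -> `|N1 y| + `|N2 y| <= VD / Vm * density y.
  move=> Qy; have le0 : 0 <= lam * expR (v y) by rewrite mulr_ge0 ?expR_ge0 ?ltW.
  rewrite /N1 /N2 !normrM -!(normrM lam) !(ger0_norm le0) -mulrDr.
  rewrite (_ : VD / Vm * density y = lam * expR (v y) * (VD * (V y / Vm))); last first.
    by rewrite /density; ring.
  apply: ler_wpM2l => //; apply: (le_trans (Vgrad Qy)).
  by rewrite ler_peMr// ler_pdivlMr// mul1r; have /andP[] := Vbounds Qy.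
have C10 : 0 <= annulus_const.
  have F0 : 0 <= Lam * VM * expR C0.
    by rewrite !mulr_ge0 ?expR_ge0 ?(ltW VM0)// (le_trans (ltW lam0)).
  have r4 : 0 <= rho / 4 by rewrite divr_ge0// ltW.
  exact: (mulr_ge0 (ler0n _ 4) (addr_ge0 (mulr_ge0 (mulr_ge0 (ler0n _ 243) F0) r4)
    (divr_ge0 (mulr_ge0 (ler0n _ 3402) C00) r4))).
have ann y : rho ^+ 2 < sqdist x y < 2 * rho ^+ 2 ->
    `|'D_e1 v y| <= annulus_const /\ `|'D_e2 v y| <= annulus_const.
  move=> /(annulus_edist rho0)/andP[h1 h2]; apply: gradient_annulus.
  have := edist_triangle p x y; have := edist_triangle x p y; rewrite (edistC x p).
  by move=> *; apply/andP; split; move: h1 h2 px rho0; lra.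
have GB eps : 0 < eps -> eps <= rho ->
    sqint p (4 * rho) (fun y => VD / Vm * density y *
      (cutoff x rho y / Num.sqrt (mden x eps y))) <= VD / Vm * (osc_const / t).
  move=> e0 _.
  have ck : cont_on Q (fun y => cutoff x rho y / Num.sqrt (mden x eps y)).
    apply: (@Ck_cont_onT _ 1); apply: (CkM openT (CkW (Ck_cutoff x _))).
    apply: CkV; [exact: openT|by move=> y _; rewrite lt0r_neq0// sqrtr_gt0 mden_gt0|].
    by apply: Ck_sqrt; [exact: openT|move=> y _; exact: mden_gt0|exact: Ck_mden].
  rewrite (_ : sqint p (4 * rho) _ = sqint p (4 * rho) (fun y => VD / Vm *
      (density y * (cutoff x rho y / Num.sqrt (mden x eps y))))); last first.
    by apply: eq_sqint => y _; rewrite -mulrA.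
  rewrite sqintZ; [|exact: ltW|exact: cont_onM].
  by apply: ler_wpM2l => //; exact: density_potential.
have vf y : U y -> density y = - laplacian v y by move=> Uy; rewrite eqv.
split.
- exact: (hopfA_bound oU a0 QU rho0 ins cv density_Ck vf f1 f2 cN1 cN2 cG NG C10 ann GB).
- exact: (hopfB_bound oU a0 QU rho0 ins cv density_Ck vf f1 f2 cN1 cN2 cG NG C10 ann GB).
Qed.

(** Integrate the gradient bound from [pk] to the region where |v| <= C0. A lower bound on [d] would
    thus keep the peak bounded. *)
Lemma peak_bound : v pk <= C0 + grad_bound_const t * (3 * rho / 16).
Proof.
have r0 : 0 <= 3 * rho / 16 by move: rho0; lra.
(* As [pk] is within rho / 16 of [p], this point is at distance at least rho / 8 from [p]. *)
pose z := (pk.1 + 3 * rho / 16, pk.2).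
have pz : edist pk z = 3 * rho / 16.
  rewrite /edist /sqdist /z /= subrr expr0n /= addr0 [_ + _ - _]addrAC subrr add0r.
  by rewrite sqrtr_sqr ger0_norm.
have Qz : square pk (3 * rho / 16) z.
  by have [h1 h2] := edist_coord pk z; rewrite pz in h1 h2; apply/squareP.
have near y : square pk (3 * rho / 16) y -> edist p y <= rho / 2.
  move=> /squareP[h1 h2]; have := edist_le_coord h1 h2; have := edist_triangle p pk y.
  by move: pkp rho0; lra.
have sub : square pk (3 * rho / 16) `<=` U.
  by move=> y /near py; apply: QU; apply: ball_square; move: py rho0; lra.
have := square_mean_value (CkW cv) sub (fun y Qy => gradient_center (near y Qy))
  (square_center pk r0) Qz.
have vz : `|v z| <= C0.
  apply: vC; have := edist_triangle p pk z; have := edist_triangle pk p z.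
  by rewrite pz (edistC pk p) => *; apply/andP; split; move: pkp rho0; lra.
have z1 : `|pk.1 - z.1| = 3 * rho / 16.
  by rewrite distrC /z /= [_ + _ - _]addrAC subrr add0r ger0_norm.
have z2 : `|pk.2 - z.2| = 0 by rewrite /z /= subrr normr0.
rewrite z1 z2 addr0 => h.
have := ler_norm (v pk - v z); have := ler_norm (v z); move: h vz.
by set A := v z; set B := v pk; set D := _ * _; lra.
Qed.

(** Gradient bound for a function whose source is at most [K] within [tau] of [x] and is dominated
    by the density elsewhere; meant for w / mu - c v. *)
Lemma gradient_center_of x u G (Cu K tau c : R) : edist p x <= rho / 2 -> 0 < tau <= rho ->
  0 <= K -> 0 <= c -> Ck 2 U u -> cont_on Q G ->
  (forall y, Q y -> `|laplacian u y| <= G y) -> 0 <= Cu ->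
  (forall y, rho / 8 <= edist p y <= 3 * rho -> `|u y| <= Cu) ->
  (forall y, Q y -> G y <= c * density y) ->
  (forall y, edist x y <= tau -> G y <= K) ->
  `|'D_e1 u x| <= 4 * (243 * K * tau + tau^-1 * (c * (4212 * C0)) + 3402 * Cu / rho) /\
  `|'D_e2 u x| <= 4 * (243 * K * tau + tau^-1 * (c * (4212 * C0)) + 3402 * Cu / rho).
Proof.
move=> px /andP[tau0 taur] K0 c0 cu cG uG Cu0 uC Gc GK.
have ins : inside p (4 * rho) x rho by apply: inside_ball; move: px rho0; lra.
apply: (gradient_bound oU a0 QU rho0 ins cu cG uG Cu0).
  move=> y /(annulus_edist rho0)/andP[h1 h2]; apply: uC.
  have := edist_triangle p x y; have := edist_triangle x p y; rewrite (edistC x p).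
  by move=> *; apply/andP; split; move: h1 h2 px rho0; lra.
move=> eps e0 _.
have G0 y : Q y -> 0 <= G y by move=> /uG; exact: le_trans.
have GK' y : Q y -> sqdist x y <= tau ^+ 2 -> G y <= K.
  by move=> _; rewrite -le_edist ?(ltW tau0)//; exact: GK.
apply: (le_trans (sqint_potential a0 tau0 taur e0 K0 ins cG G0 GK')).
rewrite lerD2l; apply: ler_wpM2l; first by rewrite invr_ge0 ltW.
have cc : cont_on Q (cutoff x rho) := Ck_cont_onT (Ck_cutoff x rho).
apply: (@le_trans _ _ (sqint p (4 * rho) (fun y => c * (density y * cutoff x rho y)))).
  apply: le_sqint; [exact: ltW|exact: cont_onM| |].
    exact: (cont_onM (@cont_on_cst R Q c) (cont_onM cf cc)).
  by move=> y Qy; rewrite mulrA; apply: ler_wpM2r; [exact: cutoff_ge0|exact: Gc].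
rewrite sqintZ; [|exact: ltW|exact: cont_onM].
by apply: ler_wpM2l => //; exact: density_mass.
Qed.

End NearBlowup.

(** * The expansion at scale d, with explicit error *)

Section RescaledExpansion.
Context {R : realType}.
Implicit Types (x y z : R * R).
Variables (U : set (R * R)) (V : R * R -> R) (p : R * R) (rho Vm VM VD C0 Lam : R).
Local Notation Q := (square p (4 * rho)).
Hypotheses (oU : open U) (rho0 : 0 < rho) (QU : Q `<=` U) (cV : Ck 1 U V)
  (Vm0 : 0 < Vm) (C00 : 0 <= C0).
Hypothesis Vbounds : forall y, Q y -> Vm <= V y <= VM.
Hypothesis Vgrad : forall y, Q y -> `|'D_e1 V y| + `|'D_e2 V y| <= VD.

Variables (lam d : R) (v : R * R -> R) (pk : R * R).
Hypotheses (lam0 : 0 < lam) (lamL : lam <= Lam) (d0 : 0 < d) (cv : Ck 2 U v).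
Hypothesis eqv : forall y, U y -> - laplacian v y = lam * V y * expR (v y).
Hypothesis pkp : edist p pk <= rho / 16.
Hypothesis vmax : forall y, edist pk y <= 2 * rho -> v y <= v pk.
Hypothesis dE : lam * V pk * expR (v pk) * d ^+ 2 = 1.
Hypothesis vC : forall y, rho / 8 <= edist p y <= 3 * rho -> `|v y| <= C0.
Hypotheses (v1p : 'D_e1 v pk = 0) (v2p : 'D_e2 v pk = 0).

Variables (L : R).
Hypotheses (L0 : 0 <= L) (drho : d <= rho) (Ld : 2 * (L * d) <= 7 / 16 * rho).

Let near_pk y : square pk (L * d) y -> edist p y <= rho / 2.
Proof.
move=> /squareP[h1 h2]; have := edist_le_coord h1 h2; have := edist_triangle p pk y.
by move: pkp Ld rho0; lra.
Qed.

Let sub : square pk (L * d) `<=` U.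
Proof.
move=> y /near_pk py; apply: QU; apply: ball_square.
by move: py rho0; lra.
Qed.

Let subQ : square pk (L * d) `<=` Q.
Proof.
by move=> y /near_pk py; apply: ball_square; move: py rho0; lra.
Qed.

Let Qpk : square pk (L * d) pk.
Proof. exact: (square_center pk (mulr_ge0 L0 (ltW d0))). Qed.

Let mind : Num.min d rho = d. Proof. exact: min_l. Qed.

Let VM0 : 0 < VM.
Proof. by have /andP[h1 h2] := Vbounds (subQ Qpk); exact: (lt_le_trans Vm0 (le_trans h1 h2)). Qed.

Let VD0 : 0 <= VD.
Proof. by apply: le_trans (Vgrad (subQ Qpk)); rewrite addr_ge0. Qed.

Let osc := osc_const Vm VM C0.
Let osc0 : 0 <= osc.
Proof.
exact: (addr_ge0 (mulr_ge0 (ler0n _ 243) (divr_ge0 (ltW VM0) (ltW Vm0)))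
  (mulr_ge0 (ler0n _ 4212) C00)).
Qed.

Lemma lerDl_norm (b b' : R) : `|b| <= `|b| + `|b'|. Proof. by rewrite lerDl. Qed.
Lemma lerDr_norm (b b' : R) : `|b'| <= `|b| + `|b'|. Proof. by rewrite lerDr. Qed.

Definition bubble_grad_const : R := 4 * (osc_const Vm VM C0 + 3402 * C0).

(** Times [d], this is the smallness parameter [eta] of [bubble_approx]: the first summand comes
    from the Hopf differential, the last from V / V pk - 1 on a square of half-width L d. *)
Definition bubble_defect_const : R :=
  4 * (VD / Vm * osc_const Vm VM C0 + rho * (6804 * annulus_const rho VM C0 Lam / rho +
     162 * annulus_const rho VM C0 Lam ^+ 2)) + 2 * VD * L / Vm.

Lemma grad_const_le (o c e s : R) : 0 < e -> e <= s -> 0 <= c ->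
  4 * (o / e + 3402 * c / s) <= 4 * (o + 3402 * c) / e.
Proof.
move=> e0 es c0; have s0 : 0 < s := lt_le_trans e0 es.
rewrite -[leRHS]mulrA; apply: ler_wpM2l; first exact: ler0n.
rewrite [leRHS]mulrDl lerD2l; apply: ler_wpM2l; first exact: (mulr_ge0 (ler0n _ 3402) c0).
by rewrite lef_pV2 ?posrE.
Qed.

Lemma defect_const_le (b H e s X : R) : 0 < e -> e <= s -> 0 <= H -> 0 <= X -> 0 <= b ->
  4 * (b / e + H) <= e * (4 * (b + s * H) + X) / e ^+ 2.
Proof.
move=> e0 es H0 X0 b0.
rewrite ler_pdivlMr ?exprn_gt0//.
rewrite (_ : 4 * (b / e + H) * e ^+ 2 = e * (4 * (b + e * H))); last first.
  by field; exact: lt0r_neq0.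
apply: ler_wpM2l; first exact: ltW.
rewrite -[leLHS]addr0; apply: lerD => //; apply: ler_wpM2l; first exact: ler0n.
by rewrite lerD2l; exact: ler_wpM2r.
Qed.

Let ann0 : 0 <= annulus_const rho VM C0 Lam.
Proof.
have F0 : 0 <= Lam * VM * expR C0.
  by rewrite !mulr_ge0 ?expR_ge0 ?(ltW VM0)// (le_trans (ltW lam0)).
have r4 : 0 <= rho / 4 by rewrite divr_ge0// ltW.
exact: (mulr_ge0 (ler0n _ 4) (addr_ge0 (mulr_ge0 (mulr_ge0 (ler0n _ 243) F0) r4)
  (divr_ge0 (mulr_ge0 (ler0n _ 3402) C00) r4))).
Qed.

Let H0 : 0 <= 6804 * annulus_const rho VM C0 Lam / rho + 162 * annulus_const rho VM C0 Lam ^+ 2.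
Proof.
exact: (addr_ge0 (divr_ge0 (mulr_ge0 (ler0n _ 6804) ann0) (ltW rho0))
  (mulr_ge0 (ler0n _ 162) (sqr_ge0 _))).
Qed.

Let X0 : 0 <= 2 * VD * L / Vm.
Proof. exact: (divr_ge0 (mulr_ge0 (mulr_ge0 (ler0n _ 2) VD0) L0) (ltW Vm0)). Qed.

Let b0 : 0 <= VD / Vm * osc.
Proof. exact: (mulr_ge0 (divr_ge0 VD0 (ltW Vm0)) osc0). Qed.

Let defect0 : 0 <= bubble_defect_const.
Proof.
exact: (addr_ge0 (mulr_ge0 (ler0n _ 4) (addr_ge0 b0 (mulr_ge0 (ltW rho0) H0))) X0).
Qed.

Let defect_ge : 2 * VD * L / Vm <= bubble_defect_const.
Proof.
have h : 0 <= 4 * (VD / Vm * osc_const Vm VM C0 + rho *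
    (6804 * annulus_const rho VM C0 Lam / rho + 162 * annulus_const rho VM C0 Lam ^+ 2)).
  exact: (mulr_ge0 (ler0n _ 4) (addr_ge0 b0 (mulr_ge0 (ltW rho0) H0))).
by have := lerD h (lexx (2 * VD * L / Vm)); rewrite add0r.
Qed.

Let Q_dist y : square pk (L * d) y -> `|y.1 - pk.1| + `|y.2 - pk.2| <= 2 * (L * d).
Proof. by move=> /squareP[y1 y2]; lra. Qed.

Lemma rescaled_bubble y : square pk (L * d) y ->
  `|v y - v pk - bubble (d^-1 *: (y - pk))| <=
  8 * L ^+ 2 * (d * bubble_defect_const *
    (L * expR (bubble_grad_const * L) * bubble_grad_const + 1 + expR (bubble_grad_const * L))).
Proof.
move=> Qy.
have grad z : square pk (L * d) z -> `|'D_e1 v z| <= bubble_grad_const / d /\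
    `|'D_e2 v z| <= bubble_grad_const / d.
  move=> Qz; have [h1 h2] := gradient_center oU rho0 QU cV Vm0 C00 Vbounds lam0 d0 cv eqv
    pkp vmax dE vC (near_pk Qz).
  have le := grad_const_le osc d0 drho C00.
  rewrite mind in h1 h2; by split; [exact: le_trans h1 le|exact: le_trans h2 le].
have hopf z : square pk (L * d) z -> `|hopfA v z| <= d * bubble_defect_const / d ^+ 2 /\
    `|hopfB v z| <= d * bubble_defect_const / d ^+ 2.
  move=> Qz; have [h1 h2] := hopf_center oU rho0 QU cV Vm0 C00 Vbounds Vgrad lam0 lamL d0 cv
    eqv pkp vmax dE vC (near_pk Qz).
  have le := defect_const_le d0 drho H0 X0 b0.
  rewrite mind /hopf_bound_const mulrA in h1 h2.
  by split; [exact: le_trans h1 le|exact: le_trans h2 le].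
have Vpk : 0 < V pk by have /andP[h _] := Vbounds (subQ Qpk); exact: lt_le_trans h.
apply: (@bubble_approx _ U v (fun z => V z / V pk) pk d L bubble_grad_const
  (d * bubble_defect_const) oU cv d0 L0) => //.
- exact: (mulr_ge0 (ler0n _ 4) (addr_ge0 osc0 (mulr_ge0 (ler0n _ 3402) C00))).
- exact: (mulr_ge0 (ltW d0) defect0).
- by move=> z /grad[].
- by move=> z /grad[].
- by move=> z /hopf[].
- by move=> z /hopf[].
- move=> z /squareP[h1 h2]; apply: vmax; apply: (le_trans (edist_le_coord h1 h2)).
  by move: Ld rho0; lra.
- move=> z Qz; rewrite (eqv (sub Qz)) expRD expRN.
  have lE : lam = (V pk * expR (v pk) * d ^+ 2)^-1.
    apply: (mulIf (x := V pk * expR (v pk) * d ^+ 2)).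
      by rewrite !mulf_neq0 ?expf_neq0 ?(lt0r_neq0 Vpk) ?(lt0r_neq0 d0) ?(lt0r_neq0 (expR_gt0 _)).
    rewrite mulVf; first by rewrite -dE !mulrA.
    by rewrite !mulf_neq0 ?expf_neq0 ?(lt0r_neq0 Vpk) ?(lt0r_neq0 d0) ?(lt0r_neq0 (expR_gt0 _)).
  rewrite lE; field.
  by rewrite (lt0r_neq0 Vpk) (lt0r_neq0 d0) (lt0r_neq0 (expR_gt0 _)).
- move=> z Qz.
  have := square_mean_value cV sub (fun z Qz => conj
    (le_trans (lerDl_norm ('D_e1 V z) ('D_e2 V z)) (Vgrad (subQ Qz)))
    (le_trans (lerDr_norm ('D_e1 V z) ('D_e2 V z)) (Vgrad (subQ Qz)))) Qz Qpk => hV.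
  have hV2 := le_trans hV (ler_wpM2l VD0 (Q_dist Qz)).
  rewrite (_ : V z / V pk - 1 = (V z - V pk) / V pk); last first.
    by rewrite mulrBl divff// lt0r_neq0.
  rewrite normrM normfV (gtr0_norm Vpk).
  apply: (@le_trans _ _ (VD * (2 * (L * d)) / Vm)).
    apply: ler_pM => //; first by rewrite invr_ge0 ltW.
    rewrite lef_pV2 ?posrE//; by have /andP[] := Vbounds (subQ Qpk).
  rewrite (_ : VD * (2 * (L * d)) / Vm = d * (2 * VD * L / Vm)); last by ring.
  exact: (ler_wpM2l (ltW d0) defect_ge).
Qed.

Variables (w : R * R -> R) (mu c T tau : R).
Hypotheses (mu0 : 0 < mu) (cw : Ck 2 U w).
Hypothesis eqw : forall y, U y -> - laplacian w y = mu * (lam * V y * expR (v y)) * w y.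
Hypothesis w1 : forall y, U y -> `|w y| <= 1.
Hypothesis wv : forall y, U y -> `|w y| <= mu * v y.
Hypothesis c1 : `|c| <= 1.
Hypotheses (T0 : 0 < T) (tau0 : 0 <= tau) (LTd : (2 * L + T) * d <= rho).
Hypothesis wc : forall y, square pk ((2 * L + T) * d) y -> `|w y - c| <= tau.

(** The subtraction leaves the source density * (w - c), which is small at scale [d] because [w] is
    close to [c] there. *)
Let u y := mu^-1 * w y - c * v y.

Let cu : Ck 2 U u.
Proof. exact: (CkB oU (CkM oU (Ck_cst 2 _ oU) cw) (CkM oU (Ck_cst 2 _ oU) cv)). Qed.

Let lapu y : U y -> laplacian u y = density V lam v y * (c - w y).
Proof.
move=> Uy; rewrite (laplacianB oU (CkM oU (Ck_cst 2 _ oU) cw) (CkM oU (Ck_cst 2 _ oU) cv) Uy).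
rewrite (laplacianZ _ oU cw Uy) (laplacianZ _ oU cv Uy).
rewrite -[laplacian w y]opprK (eqw Uy) -[laplacian v y]opprK (eqv Uy) /density.
by field; exact: lt0r_neq0.
Qed.

(** The three errors come from the inner disc of radius T d, where |w - c| <= tau, from the mass
    outside it, and from the annulus, where |u| <= 2 C0. The first two force T to be chosen large
    before tau is small. *)
Lemma rescaled_difference y : square pk (L * d) y ->
  `|u y - u pk| <= 8 * L * (243 * (VM / Vm) * tau * T + 8424 * C0 / T + 6804 * C0 * d / rho).
Proof.
move=> Qy.
pose G z := density V lam v z * `|c - w z|.
have cG : cont_on Q G.
  apply: cont_onM; first exact: Ck_cont_on QU (density_Ck oU cV lam cv).
  exact: (cont_on_norm (cont_onB (@cont_on_cst R Q c) (Ck_cont_on QU cw))).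
have dens0 z : Q z -> 0 <= density V lam v z.
  by exact: (density_ge0 Vm0 Vbounds v lam0).
have uG z : Q z -> `|laplacian u z| <= G z.
  by move=> Qz; rewrite (lapu (QU Qz)) normrM (ger0_norm (dens0 z Qz)) lexx.
have uC z : rho / 8 <= edist p z <= 3 * rho -> `|u z| <= 2 * C0.
  move=> pz; have /andP[_ pz3] := pz.
  have Uz : U z by apply: QU; apply: ball_square; move: pz3 rho0; lra.
  have hv := vC pz.
  have hw : `|mu^-1 * w z| <= C0.
    rewrite normrM gtr0_norm ?invr_gt0// ler_pdivrMl//.
    apply: (le_trans (wv Uz)); apply: ler_wpM2l; first exact: ltW.
    exact: (le_trans (ler_norm _) hv).
  have hcv : `|c * v z| <= C0.
    by rewrite normrM -[leRHS]mul1r; apply: ler_pM.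
  by have := ler_normB (mu^-1 * w z) (c * v z); rewrite /u; move: hw hcv; lra.
have G2 z : Q z -> G z <= 2 * density V lam v z.
  move=> Qz; rewrite /G mulrC; apply: ler_wpM2r; first exact: dens0.
  by have := w1 (QU Qz); have := ler_normB c (w z); move: c1; lra.
have Td0 : 0 < T * d by rewrite mulr_gt0.
have Tdr : T * d <= rho.
  by apply: le_trans LTd; rewrite ler_wpM2r ?(ltW d0)// lerDr mulr_ge0.
pose K := VM / Vm / d ^+ 2 * tau.
have K0 : 0 <= K.
  by rewrite /K mulr_ge0// divr_ge0 ?exprn_ge0 ?divr_ge0// ltW.
(* A point of the square is within Euclidean distance 2 L d of [pk], hence the radius (2 L + T) d in
   the hypothesis on [w]. *)
have GK z y' : square pk (L * d) z -> edist z y' <= T * d -> G y' <= K.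
  move=> Qz zy.
  have pky : edist pk y' <= (2 * L + T) * d.
    have /squareP[h1 h2] := Qz; have := edist_le_coord h1 h2; have := edist_triangle pk z y'.
    by move: zy; lra.
  have Qy' : Q y'.
    apply: ball_square; have := edist_triangle p pk y'.
    by move: pky pkp LTd rho0; lra.
  rewrite /G /K; apply: ler_pM => //; first exact: dens0.
    apply: (density_peak rho0 Vm0 Vbounds lam0 d0 pkp vmax dE Qy' _).
    by move: pky LTd rho0; lra.
  rewrite distrC; apply: wc; have [h1 h2] := edist_coord pk y'.
  by apply/squareP; split; [exact: le_trans h1 pky|exact: le_trans h2 pky].
have grad z : square pk (L * d) z ->
    `|'D_e1 u z| <= 4 * (243 * (VM / Vm) * tau * T + 8424 * C0 / T + 6804 * C0 * d / rho) / d /\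
    `|'D_e2 u z| <= 4 * (243 * (VM / Vm) * tau * T + 8424 * C0 / T + 6804 * C0 * d / rho) / d.
  move=> Qz.
  have TT : 0 < T * d <= rho by rewrite Td0.
  have := gradient_center_of oU rho0 QU cV Vm0 C00 Vbounds lam0 cv eqv vC
    (near_pk Qz) TT K0 (ler0n _ 2) cu cG uG (mulr_ge0 (ler0n _ 2) C00) uC G2
    (fun y' h => GK z y' Qz h).
  rewrite (_ : 4 * (243 * K * (T * d) + (T * d)^-1 * (2 * (4212 * C0)) +
      3402 * (2 * C0) / rho) = 4 * (243 * (VM / Vm) * tau * T + 8424 * C0 / T +
      6804 * C0 * d / rho) / d)//.
  rewrite /K; field.
  by rewrite (lt0r_neq0 Vm0) (lt0r_neq0 d0) (lt0r_neq0 T0) (lt0r_neq0 rho0).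
apply: (le_trans (square_mean_value (CkW cu) sub grad Qy Qpk)).
set Z := _ + _ + _.
have Z0 : 0 <= 4 * Z / d.
  have [h _] := grad pk Qpk; exact: le_trans (normr_ge0 _) h.
apply: (le_trans (ler_wpM2l Z0 (Q_dist Qy))).
rewrite (_ : 4 * Z / d * (2 * (L * d)) = 8 * L * Z)//.
by field; exact: lt0r_neq0.
Qed.

(** The normalised error is exactly u y - u pk plus c times the error of the bubble approximation,
    with y = d z + pk. *)
Lemma rescaled_expansion z : square (0, 0) L z ->
  `|(w (d *: z + pk) - (w pk + mu * c * bubble z)) / mu| <=
  8 * L * (243 * (VM / Vm) * tau * T + 8424 * C0 / T + 6804 * C0 * d / rho) +
  8 * L ^+ 2 * (d * bubble_defect_const *
    (L * expR (bubble_grad_const * L) * bubble_grad_const + 1 + expR (bubble_grad_const * L))).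
Proof.
move=> /squareP[/= z1 z2]; rewrite !subr0 in z1 z2.
pose y := d *: z + pk.
have Qy : square pk (L * d) y.
  by apply/squareP; rewrite /y /= /GRing.scale /= !addrK !normrM (gtr0_norm d0);
    split; rewrite mulrC; apply: ler_wpM2r => //; exact: ltW.
have zE : d^-1 *: (y - pk) = z by rewrite /y addrK scalerA mulVf ?lt0r_neq0// scale1r.
have hb := rescaled_bubble Qy; rewrite zE in hb.
have hd := rescaled_difference Qy.
have -> : (w y - (w pk + mu * c * bubble z)) / mu =
    (u y - u pk) + c * (v y - v pk - bubble z).
  by rewrite /u; field; exact: lt0r_neq0.
apply: (le_trans (ler_normD _ _)); apply: lerD => //.
rewrite normrM; apply: le_trans hb.
by rewrite -[leRHS]mul1r; apply: ler_wpM2r.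
Qed.

End RescaledExpansion.

(** * Uniform convergence on compact sets, subsequences, and small choices *)

Section Sequences.
Context {R : realType}.
Implicit Types (A K Omega : set (R * R)) (f : nat -> R * R -> R) (g : R * R -> R).

Lemma loc_unif_cvgP A f g : loc_unif_cvg A f g <->
  forall K, compact K -> K `<=` A -> forall eps, 0 < eps ->
    \forall k \near \oo, forall y, K y -> `|f k y - g y| < eps.
Proof.
rewrite /loc_unif_cvg; split.
  move=> /fam_cvgP fg K cK KA eps eps0.
  have /(_ [set h | forall y, K y -> `|h y - g y| < eps]) := fg K (conj cK KA).
  apply; apply/uniform_nbhs.
  exists [set yz | ball yz.1 eps yz.2]; split; first exact: entourage_ball (PosNum eps0).
  by move=> h /= hK y Ky; rewrite distrC; exact: hK.
move=> fg; apply/fam_cvgP => K [cK KA] P /uniform_nbhs[E [entE EP]].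
move: entE; rewrite -entourage_ballE => -[e /= e0 eE].
apply: filterS (fg K cK KA e e0) => k fk; apply: EP => y Ky; apply: eE => /=.
by rewrite /ball /= distrC; exact: fk.
Qed.

Lemma subsequence_near (s : nat -> nat) (P : nat -> Prop) : subsequence s ->
  (\forall k \near \oo, P k) -> \forall k \near \oo, P (s k).
Proof.
move=> ss [N _ NP]; exists N => // k /= Nk; apply: NP => /=; apply: leq_trans Nk _.
by elim: k => // k ih; exact: leq_ltn_trans ih (ss k k.+1 (ltnSn k)).
Qed.

Lemma within_bounded K g : compact K -> {within K, continuous g} ->
  exists M, forall y, K y -> `|g y| <= M.
Proof.
move=> cK cg; have [M [_ HM]] := compact_bounded (continuous_compact cg cK).
by exists (M + 1) => y Ky; apply: HM; [rewrite ltrDl|exists y].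
Qed.

Lemma annulus_compact (p : R * R) (a b : R) : 0 <= a -> 0 <= b ->
  compact [set y | a <= edist p y <= b].
Proof.
move=> a0 b0; apply: (@subclosed_compact _ _ (square p b)).
- rewrite (_ : [set y | _] = sqdist p @^-1` `[a ^+ 2, b ^+ 2]); last first.
    apply/seteqP; split => y /=; rewrite in_itv /= -le_edist// -edist_sqr.
      by move=> /andP[h ->]; rewrite andbT lerXn2r// nnegrE edist_ge0.
    by move=> /andP[+ ->]; rewrite andbT ler_sqr ?nnegrE ?edist_ge0.
  apply: closed_comp; last exact: interval_closed.
  by move=> y _; exact: (Ck_cont (Ck_sqdist 0%N p) I).
- exact: square_compact.
- move=> y /= /andP[_ yb]; have [h1 h2] := edist_coord p y.
  by apply/squareP; split; [exact: le_trans h1 yb|exact: le_trans h2 yb].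
Qed.

Lemma grad_eq0_at_max (U : set (R * R)) (u : R * R -> R) (p : R * R) (a : R) :
  0 < a -> Ck 1 U u -> square p a `<=` U -> (forall y, square p a y -> u y <= u p) ->
  'D_e1 u p = 0 /\ 'D_e2 u p = 0.
Proof.
case: p => p1 p2 a0 cu sub umax.
have in1 t : t \in `]p1 - a, p1 + a[ -> square (p1, p2) a (t, p2).
  rewrite in_itv /= => /andP[h1 h2]; apply/squareP; rewrite /= subrr normr0 ler_norml.
  by split; [apply/andP; split|]; lra.
have in2 t : t \in `]p2 - a, p2 + a[ -> square (p1, p2) a (p1, t).
  rewrite in_itv /= => /andP[h1 h2]; apply/squareP; rewrite /= subrr normr0 ler_norml.
  by split; [|apply/andP; split]; lra.
have Up := sub _ (square_center (p1, p2) (ltW a0)).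
have mem t : t \in `]t - a, t + a[ by rewrite in_itv /=; apply/andP; split; lra.
have le t : t - a <= t + a by lra.
split.
- have hd t (h : t \in `]p1 - a, p1 + a[) := is_derive_line1 (Ck_is_derive1 cu (sub _ (in1 t h))).
  have hm := derive1_at_max (le p1) (fun t h => @ex_derive _ _ _ _ _ _ _ (hd t h)) (mem p1)
    (fun t h => umax _ (in1 t h)).
  have [_ h1] := hm; have [_ h2] := hd p1 (mem p1); exact: etrans (esym h2) h1.
- have hd t (h : t \in `]p2 - a, p2 + a[) := is_derive_line2 (Ck_is_derive2 cu (sub _ (in2 t h))).
  have hm := derive1_at_max (le p2) (fun t h => @ex_derive _ _ _ _ _ _ _ (hd t h)) (mem p2)
    (fun t h => umax _ (in2 t h)).
  have [_ h1] := hm; have [_ h2] := hd p2 (mem p2); exact: etrans (esym h2) h1.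
Qed.

Lemma small_factor (a e : R) : 0 < e -> exists2 t : R, 0 < t & a * t < e.
Proof.
move=> e0; have a0 : 0 < `|a| + 1 by rewrite ltr_pwDr.
exists (e / (`|a| + 1)); first exact: divr_gt0.
rewrite mulrA ltr_pdivrMr// mulrC ltr_pM2l//.
by rewrite (le_lt_trans (ler_norm _))// ltrDl.
Qed.

Lemma sum_three_quarters (a b c e : R) : 0 < e -> a < e / 4 -> b < e / 4 -> c < e / 4 ->
  a + b + c < e.
Proof. by lra. Qed.

Lemma grad_bound_const_le (rho Vm VM C0 e t : R) : 0 <= VM / Vm -> 0 <= C0 ->
  0 < e -> e <= t -> grad_bound_const rho Vm VM C0 t <= grad_bound_const rho Vm VM C0 e.
Proof.
move=> V0 C00 e0 et; apply: ler_wpM2l; first exact: ler0n.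
rewrite lerD2r; apply: ler_wpM2l.
  exact: (addr_ge0 (mulr_ge0 (ler0n _ 243) V0) (mulr_ge0 (ler0n _ 4212) C00)).
by rewrite lef_pV2 ?posrE// (lt_le_trans e0).
Qed.

End Sequences.

(** * Uniformity in k and passage to the limit *)

Theorem theorem1p5 (R : realType) (Omega : set (R * R)) (V : R * R -> R)
  (lambda : nat -> R) (v : nat -> R * R -> R) (m : nat)
  (G : R * R -> R * R -> R)
  (xs : 'I_m -> R * R) (r : R) (x : 'I_m -> nat -> R * R)
  (delta : 'I_m -> nat -> R)
  (mu : nat -> nat -> R) (w : nat -> nat -> R * R -> R)
                                     
  (hOmega : smooth_bounded_domain Omega)
  (hV : C1_closure Omega V)
  (hVpos : forall y, closure Omega y -> 0 < V y)
  (hlambda_pos : forall k, 0 < lambda k)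
  (hlambda_dec : nonincreasing_seq lambda)
  (hlambda_lim : lambda k @[k --> \oo] --> (0 : R))
                            
  (hv : forall k, dirichlet_solution Omega
          (fun y => lambda k * V y * expR (v k y)) (v k))
  (hv_norm : Linfty_norm Omega (v k) @[k --> \oo] --> +oo%E)
  (hm : (0 < m)%N)
  (hv_mass : (\int[mu2]_(y in Omega) (lambda k * V y * expR (v k y))%:E)%E
               @[k --> \oo] --> (8 * pi * m%:R)%:E)
  (hG : green_function Omega G)
                   
  (hxs_inj : injective xs)
  (hxs_in : forall j, Omega (xs j))
  (hxs_blowup : blowup_set Omega v = range xs)
  (hv_lim : loc_unif_cvg (closure Omega `\` blowup_set Omega v) v
              (fun y => 8 * pi * \sum_(j < m) G y (xs j)))
                                
  (hr : 0 < r)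
  (hr_in : forall j, closure (eball (xs j) (2 * r)) `<=` Omega)
  (hr_disj : forall i j, i != j -> eball (xs i) r `&` eball (xs j) r = set0)
  (hx_in : forall j k, eball (xs j) r (x j k))
  (hx_max : forall j, \forall k \near \oo,
              v k (x j k) = sup [set v k y | y in eball (x j k) r])
  (hx_blowup : forall j, v k (x j k) @[k --> \oo] --> +oo%R)
  (hx_lim : forall j, x j k @[k --> \oo] --> xs j)
  (hdelta_pos : forall j k, 0 < delta j k)
  (hdelta : forall j k,
     lambda k * V (x j k) * expR (v k (x j k)) * delta j k ^+ 2 = 1)
                                                                         
  (hmu : forall k, eigenvalue_sequence Omega
           (fun y => lambda k * V y * expR (v k y)) (mu k))
  (hw : forall k, normalized_eigenfunctions Omega
          (fun y => lambda k * V y * expR (v k y)) (mu k) (w k)) :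
  forall (s : nat -> nat) (c : 'I_m -> 'rV[R]_m),
    subsequence s -> limit_vectors Omega G xs r x delta mu w s c ->
  forall n : 'I_m, exists t : nat -> nat, subsequence t /\
    forall j : 'I_m,
      loc_unif_cvg setT
        (fun k z => (rescaled x delta w j (s (t k)) n z
                     - (w (s (t k)) n (x j (s (t k)))
                        + mu (s (t k)) n * c n 0 j * bubble z))
                    / mu (s (t k)) n)
        (fun=> 0).
Proof.
(* All estimates hold along [s] itself, so the identity serves as the further subsequence. *)
move=> s c ss lv n; exists id; split=> // j; apply/loc_unif_cvgP => K cK _ eps eps0.
have [Ox0 oO _ bO _] := hOmega; have [cV _ _] := hV.
have cOm : compact (closure Omega) := closure_compact bO.
have OcO : Omega `<=` closure Omega by exact: subset_closure.
(* The square of half-width 4 rho then lies within distance 8 rho < 2 r of [p], and the annulus up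
   to 3 rho inside the ball of radius [r], away from the other blow-up points. *)
pose p := xs j; pose rho := r / 5.
have rho0 : 0 < rho by rewrite divr_gt0.
have rE : r = 5 * rho by rewrite /rho; lra.
have ballO y : edist p y < 2 * r -> Omega y.
  by move=> /eball_edist py; apply: (hr_in j); exact: subset_closure.
have QO : square p (4 * rho) `<=` Omega.
  move=> y /squareP[h1 h2]; apply: ballO; have := edist_le_coord h1 h2.
  by move: rho0 rE; lra.
have cQ := @square_compact R p (4 * rho).
have Qp : square p (4 * rho) p by apply: square_center; move: rho0; lra.
have [ymin /set_mem Qymin minV] :=
  compact_EVT_min (ex_intro _ p Qp) cQ (cont_on_within (Ck_cont_on QO cV)).
pose Vm := V ymin.
have Vm0 : 0 < Vm by apply: hVpos; apply: OcO; exact: QO.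
have [VM VMb] := cont_on_bounded cQ (Ck_cont_on QO cV).
have Vbounds y : square p (4 * rho) y -> Vm <= V y <= VM.
  move=> Qy; rewrite (minV y (mem_set Qy)) /=; apply: le_trans (VMb y Qy).
  exact: ler_norm.
have VmM : 0 <= VM / Vm.
  have /andP[h1 h2] := Vbounds p Qp.
  by apply: divr_ge0; [exact: (le_trans (ltW Vm0) (le_trans h1 h2))|exact: ltW].
have [D1 D1b] := cont_on_bounded cQ (Ck_cont_on QO (Ck_D1 cV)).
have [D2 D2b] := cont_on_bounded cQ (Ck_cont_on QO (Ck_D2 cV)).
have Vgrad y : square p (4 * rho) y -> `|'D_e1 V y| + `|'D_e2 V y| <= D1 + D2.
  by move=> Qy; exact: (lerD (D1b y Qy) (D2b y Qy)).
have sub_square q : edist p q <= rho / 16 -> square q rho `<=` Omega.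
  move=> pq y /squareP[h1 h2]; apply: ballO; have := edist_triangle p q y.
  by have := edist_le_coord h1 h2; move: pq rho0 rE; lra.
pose Ann := [set y | rho / 8 <= edist p y <= 3 * rho].
have cAnn : compact Ann by apply: annulus_compact; move: rho0; lra.
have AnnO : Ann `<=` Omega.
  by move=> y /andP[_ h]; apply: ballO; move: h rho0 rE; lra.
have AnnN i y : Ann y -> y <> xs i.
  move=> /andP[h1 h2] yE; rewrite yE in h1 h2.
  have [ij|ij] := eqVneq i j.
    move: h1; rewrite ij /p /edist /sqdist !subrr expr0n /= addr0 sqrtr0.
    by move: rho0; lra.
  have : (eball (xs i) r `&` eball (xs j) r) (xs i).
    split; apply/eball_edist.
      by rewrite /edist /sqdist !subrr expr0n /= addr0 sqrtr0.
    by move: h2 rho0 rE; rewrite /p; lra.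
  by rewrite hr_disj.
have /choice[MG MGb] i : exists M, forall y, Ann y -> `|G y (xs i)| <= M.
  have [_ _ cG _] := hG _ (hxs_in i).
  apply: within_bounded => //; apply: continuous_subspaceW cG => y Ay.
  by split; [exact: OcO (AnnO y Ay)|exact: AnnN].
(* A bound of the limit on the annulus, plus 1 for the distance of [v k] to its limit for large
   k. *)
pose C0 : R := 8 * pi * \sum_(i < m) `|MG i| + 1.
have pi0 : 0 <= 8 * pi :> R by rewrite mulr_ge0// pi_ge0.
have C00 : 0 <= C0 by rewrite addr_ge0// mulr_ge0// sumr_ge0.
have vAnn : \forall k \near \oo, forall y, Ann y -> `|v k y| <= C0.
  have AnnS : Ann `<=` closure Omega `\` blowup_set Omega v.
    move=> y Ay; split; first exact: OcO (AnnO y Ay).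
    by rewrite hxs_blowup => -[i _ /esym]; exact: AnnN.
  have := (loc_unif_cvgP _ _ _).1 hv_lim Ann cAnn AnnS 1 ltr01.
  apply: filterS => k vk y Ay.
  have gy : `|8 * pi * \sum_(i < m) G y (xs i)| <= 8 * pi * \sum_(i < m) `|MG i|.
    rewrite normrM (ger0_norm pi0); apply: ler_wpM2l => //.
    apply: (le_trans (ler_norm_sum _ _ _)); apply: ler_sum => i _.
    exact: (le_trans (MGb i y Ay) (ler_norm _)).
  have := ltW (vk y Ay).
  have := ler_normD (v k y - 8 * pi * \sum_(i < m) G y (xs i)) (8 * pi * \sum_(i < m) G y (xs i)).
  by rewrite subrK /C0; move: gy; lra.
have lamL k : lambda k <= lambda 0%N by exact: hlambda_dec.
have pk_near : \forall k \near \oo, edist p (x j k) <= rho / 16.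
  have h0 : 0 < rho / 32 by rewrite divr_gt0.
  have : \forall k \near \oo, ball p (rho / 32) (x j k).
    by apply: hx_lim; exact: nbhsx_ballx.
  apply: filterS => k [/ltW h1 /ltW h2].
  rewrite distrC in h1; rewrite distrC in h2.
  have := edist_le_coord h1 h2; move: rho0; lra.
have vmax : \forall k \near \oo, forall y, edist (x j k) y <= 2 * rho -> v k y <= v k (x j k).
  apply: filterS2 pk_near (hx_max j) => k pkp vsup y pky; rewrite vsup.
  apply: ub_le_sup; last first.
    by exists y => //; apply/eball_edist; move: pky rho0 rE; lra.
  have [_ cvk _ _] := hv k; have [M Mb] := within_bounded cOm cvk.
  exists M => _ [z /eball_edist pkz <-]; apply: (le_trans (ler_norm _)).
  apply: Mb; apply: OcO; apply: ballO; have := edist_triangle p (x j k) z.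
  by move: pkz pkp rho0 rE; lra.
(* If [delta j k] stayed above [e], then [peak_bound] would bound v k (x j k), which tends to
   infinity. *)
have delta_small e : 0 < e -> \forall k \near \oo, delta j k < e.
  move=> e0.
  have peak : \forall k \near \oo, C0 + grad_bound_const rho Vm VM C0 (Num.min e rho) *
      (3 * rho / 16) < v k (x j k).
    by have /cvgryPgt := hx_blowup j; apply.
  near=> k.
  have pkp : edist p (x j k) <= rho / 16 by near: k.
  have vm : forall y, edist (x j k) y <= 2 * rho -> v k y <= v k (x j k) by near: k.
  have vA : forall y, Ann y -> `|v k y| <= C0 by near: k.
  have pk : C0 + grad_bound_const rho Vm VM C0 (Num.min e rho) * (3 * rho / 16) <
    v k (x j k) by near: k.
  have [cvk _ eqv _] := hv k; rewrite ltNge; apply/negP => ed.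
  have := peak_bound oO rho0 QO cV Vm0 C00 Vbounds (hlambda_pos k) (hdelta_pos j k) cvk eqv
    pkp vm (hdelta j k) vA.
  have e'0 : 0 < Num.min e rho by rewrite lt_min e0.
  have e'd : Num.min e rho <= Num.min (delta j k) rho.
    by rewrite le_min !ge_min ed lexx orbT.
  have gb := grad_bound_const_le rho VmM C00 e'0 e'd.
  have gb' := ler_wpM2r (ltW (divr_gt0 (mulr_gt0 (ltr0n _ 3) rho0) (ltr0n _ 16))) gb.
  move=> vb; have := lt_le_trans pk vb; rewrite ltrD2l ltNge.
  by rewrite gb'.
(* Order of choices: [L] from the compact set, then T = 1 / t for the mass term, then [tau]
   depending on T, and last the smallness of [delta]. Each of the three error groups receives eps /
   4. *)
have [L L0 KL] := bounded_square (compact_bounded cK).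
have [t t0 tE] := small_factor (8 * L * (8424 * C0)) (divr_gt0 eps0 (ltr0n R 4)).
pose T := t^-1; have T0 : 0 < T by rewrite invr_gt0.
have [tau tau0 tauE] := small_factor (8 * L * (243 * (VM / Vm) * T)) (divr_gt0 eps0 (ltr0n R 4)).
pose gc := bubble_grad_const Vm VM C0.
pose S := 8 * L * (6804 * C0 / rho) + 8 * L ^+ 2 *
  (bubble_defect_const rho Vm VM (D1 + D2) C0 (lambda 0%N) L *
    (L * expR (gc * L) * gc + 1 + expR (gc * L))).
have [a a0 aE] := small_factor `|S| (divr_gt0 eps0 (ltr0n R 4)).
(* The bounds [b] and [b'] keep the rescaled squares inside the region where the estimates of the
   previous sections apply; 7 / 16 is 1 / 2 - 1 / 16. *)
have [b b0 bE] := small_factor (2 * L) (mulr_gt0 (divr_gt0 (ltr0n R 7) (ltr0n R 16)) rho0).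
have [b' b'0 b'E] := small_factor (2 * L + T) rho0.
have wc : \forall k \near \oo, forall z, square (0, 0) (2 * L + T) z ->
    `|rescaled x delta w j (s k) n z - c n 0 j| < tau.
  have /loc_unif_cvgP h := @limvec_rescaled _ _ _ _ _ _ _ _ _ _ _ _ lv n j.
  by apply: (h _ (@square_compact R (0, 0) (2 * L + T)) _ _ tau0).
near=> k => z Kz; rewrite subr0.
have hb : delta j (s k) < b by near: k; exact: (subsequence_near ss (delta_small _ b0)).
have hb' : delta j (s k) < b' by near: k; exact: (subsequence_near ss (delta_small _ b'0)).
have ha : delta j (s k) < a by near: k; exact: (subsequence_near ss (delta_small _ a0)).
have hrho : delta j (s k) < rho by near: k; exact: (subsequence_near ss (delta_small _ rho0)).
have pkp : edist p (x j (s k)) <= rho / 16.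
  by near: k; exact: (subsequence_near ss pk_near).
have vm : forall y, edist (x j (s k)) y <= 2 * rho -> v (s k) y <= v (s k) (x j (s k)).
  by near: k; exact: (subsequence_near ss vmax).
have vA : forall y, Ann y -> `|v (s k) y| <= C0 by near: k; exact: (subsequence_near ss vAnn).
have wck : forall z, square (0, 0) (2 * L + T) z ->
    `|rescaled x delta w j (s k) n z - c n 0 j| < tau by near: k.
move: hb hb' ha hrho pkp vm vA wck; set k' := s k => hb hb' ha hrho pkp vm vA wck.
have [cvk ccvk eqv bv] := hv k'.
have [eig linf _ _] := hw k'; have [mu0 _ mu_nd _] := hmu k'.
have mun : 0 < mu k' n := lt_le_trans mu0 (mu_nd _ _ (leq0n n)).
have [cwk ccwk eqw bw] := eig n.
have w1 y : Omega y -> `|w k' n y| <= 1.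
  by apply: (Linfty_norm_bound oO _ ltr01 (linf n)) => z' Oz'; exact: (Ck_cont cwk Oz').
have q0 y : Omega y -> 0 <= lambda k' * V y * expR (v k' y).
  move=> Oy; rewrite !mulr_ge0 ?expR_ge0//; first exact: ltW.
  by apply: ltW; apply: hVpos; exact: OcO.
have wv y : Omega y -> `|w k' n y| <= mu k' n * v k' y.
  move=> Oy; apply: (eigenfunction_le_potential oO bO mun (hv k') q0 (eig n) w1).
  exact: OcO.
have T2 : 0 <= 2 * L + T by apply: addr_ge0; [apply: mulr_ge0 => //; exact: ltW|exact: ltW].
have db : 2 * (L * delta j k') <= 7 / 16 * rho.
  rewrite mulrA; apply: le_trans (ltW bE); apply: ler_wpM2l.
    by apply: mulr_ge0 => //; exact: ltW.
  exact: ltW.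
have db' : (2 * L + T) * delta j k' <= rho.
  apply: le_trans (ltW b'E); apply: ler_wpM2l => //.
  exact: ltW.
(* The peak is an interior maximum, which fixes the constants of integration in the bubble
   approximation. *)
have [g1 g2] : 'D_e1 (v k') (x j k') = 0 /\ 'D_e2 (v k') (x j k') = 0.
  apply: (grad_eq0_at_max rho0 (CkW cvk) (sub_square _ pkp)) => y /squareP[h1 h2].
  by apply: vm; exact: edist_le_coord.
have wc' y : square (x j k') ((2 * L + T) * delta j k') y -> `|w k' n y - c n 0 j| <= tau.
  move=> /squareP[h1 h2]; have d0 := hdelta_pos j k'.
  have := ltW (wck ((delta j k')^-1 *: (y - x j k')) _).
  rewrite /rescaled scalerA divff ?lt0r_neq0// scale1r subrK; apply.
  by apply/squareP; rewrite /GRing.scale /= !subr0 !normrM normfV (gtr0_norm d0);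
    split; rewrite mulrC ler_pdivrMr.
have := rescaled_expansion oO rho0 QO cV Vm0 C00 Vbounds Vgrad (hlambda_pos k') (lamL k')
  (hdelta_pos j k') cvk eqv pkp vm (hdelta j k') vA g1 g2 (ltW L0) (ltW hrho) db mun cwk eqw w1 wv
  (limvec_le1 lv n j) T0 (ltW tau0) db' wc' (KL z (subset_closure Kz)).
move=> h; apply: (le_lt_trans h).
have aS : S * delta j k' < eps / 4.
  apply: le_lt_trans aE; apply: (le_trans (ler_norm _)); rewrite normrM.
  by apply: ler_wpM2l => //; rewrite gtr0_norm// ltW.
set X := (X in X < _).
have -> : X = 8 * L * (243 * (VM / Vm) * T) * tau + 8 * L * (8424 * C0) * t + S * delta j k'.
  by rewrite /X /S /T invrK -/gc; ring.
exact: sum_three_quarters eps0 tauE tE aS.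
Unshelve. all: by end_near.
Qed.
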